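(* Let $k>0$ be irrational and let $c,g,\tau$ be real constants. Let $\tilde\eta_0(\alpha_1,\alpha_2)=\sum_{(j_1,j_2)\in\mathbb Z^2}\hat\eta_{j_1,j_2}e^{i(j_1\alpha_1+j_2\alpha_2)}$ be an even function on $\mathbb T^2$ (i.e. $\tilde\eta_0(-\alpha_1,-\alpha_2)=\tilde\eta_0(\alpha_1,\alpha_2)$) such that, for some constants $C$ and $\varepsilon>0$, $$\hat\eta_{-j_1,-j_2}=\overline{\hat\eta_{j_1,j_2}},\qquad |\hat\eta_{j_1,j_2}|\le C e^{-3\varepsilon \max(k,1)\max(|j_1|,|j_2|)},\qquad (j_1,j_2)\in\mathbb Z^2 .$$ Define $\tilde\xi_0=H[\tilde\eta_0]$, $\tilde\zeta_0=\tilde\xi_0+i\tilde\eta_0$, $\tilde\varphi_0=c\,\tilde\xi_0$, and for $\alpha,\theta\in\mathbb R$ let $$\eta_0(\alpha;\theta)=\tilde\eta_0(\alpha,\theta+k\alpha),\quad \xi_0(\alpha;\theta)=\alpha+\tilde\xi_0(\alpha,\theta+k\alpha),\quad \zeta_0=\xi_0+i\eta_0 .$$ Suppose that for each $\theta\in[0,2\pi)$ the map $\alpha\mapsto\zeta_0(\alpha;\theta)$ is injective from $\mathbb R$ to $\mathbb C$ and $\partial_\alpha\zeta_0(\alpha;\theta)\neq0$ for all $\alpha\in\mathbb R$. Suppose that $\tilde\eta_0$ satisfies the torus version of the traveling wave equations with constants $c,g,\tau$ (see context), and that $\partial_\alpha\xi_0(\alpha;\theta)>0$ for all $\alpha\in[0,2\pi)$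 and $\theta\in[0,2\pi)$. Then, if $C_1$ is chosen as $$C_1=\left[H\left(\frac{D\tilde\psi}{\tilde J}\right)-\frac{(D\tilde\eta)(D\tilde\psi)}{(1+D\tilde\xi)\,\tilde J}\right]_{(\alpha_1,\alpha_2)=(0,0)}$$ (the choice which maintains $\tilde\xi(0,0,t)=0$), the solution of the torus version of the conformal water wave evolution equations (see context) with initial conditions $$\tilde\zeta(\alpha_1,\alpha_2,0)=\tilde\zeta_0(\alpha_1,\alpha_2),\qquad \tilde\varphi(\alpha_1,\alpha_2,0)=\tilde\varphi_0(\alpha_1,\alpha_2)$$ has the form $$\tilde\zeta(\alpha_1,\alpha_2,t)=\tilde\zeta_0\big(\alpha_1-\alpha_0(t),\alpha_2-k\alpha_0(t)\big)+ct-\alpha_0(t),$$ $$\tilde\varphi(\alpha_1,\alpha_2,t)=\tilde\varphi_0\big(\alpha_1-\alpha_0(t),\alpha_2-k\alpha_0(t)\big),$$ with $$\alpha_0(t)=ct-\mathcal A_0(-ct,-kct),$$ where $\mathcal A_0(x_1,x_2)$ is the real-valued function defined implicitly by $$\mathcal A_0(x_1,x_2)+\tilde\xi_0\big(x_1+\mathcal A_0(x_1,x_2),\;x_2+k\mathcal A_0(x_1,x_2)\big)=0,\qquad (x_1,x_2)\in\mathbb T^2 .$$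
   Context: $\mathbb T^2=\mathbb R^2/2\pi\mathbb Z^2$, and $k>0$ is a fixed irrational number. Torus operators. For $\tilde u(\alpha_1,\alpha_2)=\sum_{j_1,j_2}\hat u_{j_1,j_2}e^{i(j_1\alpha_1+j_2\alpha_2)}$ on $\mathbb T^2$, $H[\tilde u]=\sum_{j_1,j_2}(-i)\operatorname{sgn}(j_1+j_2k)\,\hat u_{j_1,j_2}e^{i(j_1\alpha_1+j_2\alpha_2)}$ with $\operatorname{sgn}(0)=0$; $P_0[\tilde u]=\hat u_{0,0}$ (the mean over $\mathbb T^2$); $P=\mathrm{id}-P_0$; and $D=\partial_{\alpha_1}+k\,\partial_{\alpha_2}$. Torus version of the traveling wave equations for $\tilde\eta$ (with constants $c,g,\tau$): setting $X=1+H[D\tilde\eta]$, $\tilde J=X^2+(D\tilde\eta)^2$ and $\tilde\kappa=\tilde J^{-3/2}\left(X\,D^2\tilde\eta-(D\tilde\eta)(DX)\right)$, $$P\left[\frac{c^2}{2\tilde J}+g\tilde\eta-\tau\tilde\kappa\right]=0\quad\text{on }\mathbb T^2 .$$ Torus version of the conformal water wave evolution equations (with constants $g,\tau$ and a real $C_1$ that is constant in $(\alpha_1,\alpha_2)$ but may depend on $t$ and on the solution at time $t$): the unknowns are $\tilde\zeta=\tilde\xi+i\tilde\eta$ and $\tilde\varphi$, functions of $(\alpha_1,\alpha_2,t)\in\mathbb T^2\times\mathbb R$, with $\tilde\xi=x_0(t)+H[\tilde\eta]$ for a real function $x_0(t)$. With $$X=1+D\tilde\xi=1+H[D\tilde\eta],\quad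 \tilde\psi=-H[\tilde\varphi],\quad \tilde J=X^2+(D\tilde\eta)^2,\quad \tilde\chi=\frac{D\tilde\psi}{\tilde J},\quad \tilde\kappa=\frac{X\,D^2\tilde\eta-(D\tilde\eta)(DX)}{\tilde J^{3/2}},$$ the equations are $$\frac{dx_0}{dt}=P_0\left[X\left(-H[\tilde\chi]+C_1\right)+(D\tilde\eta)\tilde\chi\right],\qquad \tilde\eta_t=-(D\tilde\eta)H[\tilde\chi]-X\tilde\chi+C_1D\tilde\eta,$$ $$\tilde\varphi_t=P\left[\frac{(D\tilde\psi)^2-(D\tilde\varphi)^2}{2\tilde J}-(D\tilde\varphi)H[\tilde\chi]+C_1D\tilde\varphi-g\tilde\eta+\tau\tilde\kappa\right].$$ *)

(* Defs.v *)
From Stdlib Require Import Reals ZArith QArith Qreals.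
From Coquelicot Require Import Coquelicot.
Open Scope R_scope.

(** Functions on the torus [R^2 / 2 pi Z^2] are functions [R -> R -> R] that
    are [2 pi]-periodic in each variable. *)

Definition periodic2 (u : R -> R -> R) : Prop :=
  forall a1 a2, u (a1 + 2 * PI) a2 = u a1 a2 /\ u a1 (a2 + 2 * PI) = u a1 a2.

Definition irrational (k : R) : Prop := forall q : Q, k <> Q2R q.

Definition pd1 (u : R -> R -> R) (a1 a2 : R) : R := Derive (fun s => u s a2) a1.
Definition pd2 (u : R -> R -> R) (a1 a2 : R) : R := Derive (fun s => u a1 s) a2.

Fixpoint C_n (n : nat) (u : R -> R -> R) : Prop :=
  match n with
  | O => forall a1 a2, continuity_2d_pt u a1 a2
  | S m =>
      (forall a1 a2, ex_derive (fun s => u s a2) a1 /\ ex_derive (fun s => u a1 s) a2)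
      /\ C_n m (pd1 u) /\ C_n m (pd2 u)
  end.

Definition smooth (u : R -> R -> R) : Prop := forall n, C_n n u.

(** * Fourier series on the torus *)

(** [exp (i (j1 a1 + j2 a2))] *)
Definition character (j1 j2 : Z) (a1 a2 : R) : C :=
  (cos (IZR j1 * a1 + IZR j2 * a2), sin (IZR j1 * a1 + IZR j2 * a2)).

Definition fourier_coef (u : R -> R -> R) (j1 j2 : Z) : C :=
  (RtoC (/ (2 * PI) ^ 2) *
   RInt (V := C_R_CompleteNormedModule)
     (fun a1 => RInt (V := C_R_CompleteNormedModule)
        (fun a2 => (RtoC (u a1 a2) * Cconj (character j1 j2 a1 a2))%C)
        0 (2 * PI)) 0 (2 * PI))%C.

(** Sum of [f j1 j2] over the square [|j1|, |j2| <= N]. *)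
Definition square_sum (f : Z -> Z -> C) (N : nat) : C :=
  sum_n (fun m1 => sum_n (fun m2 =>
    f (Z.of_nat m1 - Z.of_nat N)%Z (Z.of_nat m2 - Z.of_nat N)%Z) (2 * N)) (2 * N).

(** [sum_(j1, j2) c_(j1, j2) exp (i (j1 a1 + j2 a2))] as the limit of the square
    partial sums.  [Lim_seq] is a junk value for divergent series; the series
    of smooth functions and those with exponentially decaying coefficients
    converge absolutely. *)
Definition fourier_series (c : Z -> Z -> C) (a1 a2 : R) : C :=
  let S := square_sum (fun j1 j2 => (c j1 j2 * character j1 j2 a1 a2)%C) in
  (real (Lim_seq (fun N => Re (S N))), real (Lim_seq (fun N => Im (S N)))).

(** * Torus operators *)

(** The square partial sums are real when [u] is, so [Re] loses nothing. *)
Definition H (k : R) (u : R -> R -> R) (a1 a2 : R) : R :=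
  Re (fourier_series
        (fun j1 j2 =>
           (- Ci * RtoC (sign (IZR j1 + IZR j2 * k)) * fourier_coef u j1 j2)%C)
        a1 a2).

Definition P0 (u : R -> R -> R) : R := Re (fourier_coef u 0 0).

Definition P (u : R -> R -> R) (a1 a2 : R) : R := u a1 a2 - P0 u.

Definition D (k : R) (u : R -> R -> R) (a1 a2 : R) : R :=
  pd1 u a1 a2 + k * pd2 u a1 a2.

Definition X (k : R) (eta : R -> R -> R) (a1 a2 : R) : R :=
  1 + H k (D k eta) a1 a2.

Definition J (k : R) (eta : R -> R -> R) (a1 a2 : R) : R :=
  X k eta a1 a2 ^ 2 + D k eta a1 a2 ^ 2.

Definition kappa (k : R) (eta : R -> R -> R) (a1 a2 : R) : R :=
  (X k eta a1 a2 * D k (D k eta) a1 a2 - D k eta a1 a2 * D k (X k eta) a1 a2)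
  / Rpower (J k eta a1 a2) (3 / 2).

Definition psi (k : R) (phi : R -> R -> R) (a1 a2 : R) : R := - H k phi a1 a2.

Definition chi (k : R) (eta phi : R -> R -> R) (a1 a2 : R) : R :=
  D k (psi k phi) a1 a2 / J k eta a1 a2.

(** * The equations *)

Definition traveling_wave (k c g tau : R) (eta : R -> R -> R) : Prop :=
  forall a1 a2,
    P (fun b1 b2 => c ^ 2 / (2 * J k eta b1 b2) + g * eta b1 b2
                    - tau * kappa k eta b1 b2) a1 a2 = 0.

(** In time-dependent functions the time argument comes first: [zeta t a1 a2]. *)

Definition xi_of (zeta : R -> R -> R -> C) (t a1 a2 : R) : R := Re (zeta t a1 a2).
Definition eta_of (zeta : R -> R -> R -> C) (t a1 a2 : R) : R := Im (zeta t a1 a2).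

(** Solutions for all times [t], classical in the sense that they are smooth
    on the torus, so that every series and every derivative in the equations
    converges or exists, and that [J] never vanishes. *)
Definition water_wave_solution (k g tau : R) (C1 : R -> R)
    (zeta : R -> R -> R -> C) (phi : R -> R -> R -> R) : Prop :=
  let xi := xi_of zeta in
  let eta := eta_of zeta in
  (forall t, periodic2 (eta t) /\ smooth (eta t) /\
             periodic2 (phi t) /\ smooth (phi t)) /\
  (forall t a1 a2, 0 < J k (eta t) a1 a2) /\
  exists x0 : R -> R,
    (forall t a1 a2, xi t a1 a2 = x0 t + H k (eta t) a1 a2) /\
    (forall t, is_derive x0 t
       (P0 (fun a1 a2 =>
          X k (eta t) a1 a2 * (- H k (chi k (eta t) (phi t)) a1 a2 + C1 t)
          + D k (eta t) a1 a2 * chi k (eta t) (phi t) a1 a2))) /\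
    (forall t a1 a2, is_derive (fun s => eta s a1 a2) t
       (- D k (eta t) a1 a2 * H k (chi k (eta t) (phi t)) a1 a2
        - X k (eta t) a1 a2 * chi k (eta t) (phi t) a1 a2
        + C1 t * D k (eta t) a1 a2)) /\
    (forall t a1 a2, is_derive (fun s => phi s a1 a2) t
       (P (fun b1 b2 =>
          (D k (psi k (phi t)) b1 b2 ^ 2 - D k (phi t) b1 b2 ^ 2)
            / (2 * J k (eta t) b1 b2)
          - D k (phi t) b1 b2 * H k (chi k (eta t) (phi t)) b1 b2
          + C1 t * D k (phi t) b1 b2
          - g * eta t b1 b2 + tau * kappa k (eta t) b1 b2) a1 a2)).

Definition C1_choice (k : R) (zeta : R -> R -> R -> C) (phi : R -> R -> R -> R)
    (t : R) : R :=
  let xi := xi_of zeta in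
  let eta := eta_of zeta in
  H k (fun a1 a2 => D k (psi k (phi t)) a1 a2 / J k (eta t) a1 a2) 0 0
  - D k (eta t) 0 0 * D k (psi k (phi t)) 0 0
    / ((1 + D k (xi t) 0 0) * J k (eta t) 0 0).

(** * Initial data *)

Definition zeta0_torus (k : R) (eta0 : R -> R -> R) (a1 a2 : R) : C :=
  (H k eta0 a1 a2, eta0 a1 a2).

Definition phi0_torus (k c : R) (eta0 : R -> R -> R) (a1 a2 : R) : R :=
  c * H k eta0 a1 a2.

Definition eta0_line (k : R) (eta0 : R -> R -> R) (theta a : R) : R :=
  eta0 a (theta + k * a).

Definition xi0_line (k : R) (eta0 : R -> R -> R) (theta a : R) : R :=
  a + H k eta0 a (theta + k * a).

Definition zeta0_line (k : R) (eta0 : R -> R -> R) (theta a : R) : C :=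
  (xi0_line k eta0 theta a, eta0_line k eta0 theta a).

Definition dzeta0_line (k : R) (eta0 : R -> R -> R) (theta a : R) : C :=
  (Derive (xi0_line k eta0 theta) a, Derive (eta0_line k eta0 theta) a).

(* Main.v *)
From Stdlib Require Import Reals ZArith QArith Qreals.
From Stdlib Require Import Lra Lia FunctionalExtensionality.
From Coquelicot Require Import Coquelicot.
Require Import Defs.
Open Scope R_scope.

(** Along the flow lines of [D] the traveling wave is only translated, so
    everything reduces to one identity: [H (D eta / J) = 1 - X / J].  The function
    [y = X + i D eta] equals 1 plus a Fourier series with frequencies
    [j1 + j2 k < 0], and the identity says that [1 / y] is of the same form.  Since
    [Re y = X] is bounded below by a positive constant, [1 / y] is the sum of the
    series [lam (1 - lam y)^n] for small [lam > 0]; each term has frequencies in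
    the half plane, and the means add up to 1.  Estimating the terms at nearby
    complex points gives exponential decay of the coefficients of [1 / y].

    The function [alpha0] inverts [s - xi0 (- s, - k s) = c t], so
    [alpha0' = c / X]; the identity gives [C1 = c - alpha0'], and the evolution
    equations become algebraic consequences of the traveling wave equation. *)

(** * Square sums over the integer lattice *)

(** The frequencies [j1 + j2 k] accumulate at 0, so an extension of [y] to a half plane need not
    approach its limit 1 at an exponential rate. The series in powers of [1 - lam y] avoids such an
    extension: with [y] truncated, every power is a trigonometric polynomial, whose support and mean
    are known exactly, and no infinite convolution occurs.

    Exponential decay is required throughout because [H] is built from Fourier integrals and
    [Lim_seq], which are informative only once the series converges and its coefficients are
    recovered by integration. For functions given by decaying coefficients ([rep]), derivatives, [H]
    and translations are multipliers, and linear identities are checked frequency by frequency. The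
    quotient [D eta / J], the imaginary part of [- 1 / y], is the only nonlinear expression to which
    [H] is applied, so it is the only one whose coefficients have to be constructed.

    The lower bound on [Re y] comes from the assumption that the profile is a graph, together with
    compactness of the torus. *)

Ltac ringR := match goal with |- @eq _ ?x ?y => change (@eq R x y) end; ring.
Ltac ringC := match goal with |- @eq _ ?x ?y => change (@eq C x y) end; ring.

(** Uses the same shifted index as [square_sum], so that a square sum is an iterated symmetric sum
    by conversion and can be treated one index at a time. *)
Definition sym_sum {V : AbelianMonoid} (f : Z -> V) (N : nat) : V :=
  sum_n (fun m => f (Z.of_nat m - Z.of_nat N)%Z) (2 * N).

Lemma square_sumE (f : Z -> Z -> C) (N : nat) :
  square_sum f N = sym_sum (fun j1 => sym_sum (f j1) N) N.
Proof. reflexivity. Qed.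

Lemma sym_sum_0 {V : AbelianMonoid} (f : Z -> V) : sym_sum f 0 = f 0%Z.
Proof. unfold sym_sum. simpl. now rewrite sum_O. Qed.

Lemma sum_n_head {V : AbelianMonoid} (f : nat -> V) (n : nat) :
  sum_n f (S n) = plus (f 0%nat) (sum_n (fun m => f (S m)) n).
Proof.
  induction n as [|n IH].
  - now rewrite sum_Sn, !sum_O.
  - now rewrite sum_Sn, IH, (sum_Sn (fun m => f (S m))), plus_assoc.
Qed.

(** The offset changes with [N], so one term is peeled off at each end and the middle is reindexed.
    This is the recursion behind all inductions on [N]. *)
Lemma sym_sum_S {V : AbelianMonoid} (f : Z -> V) (N : nat) :
  sym_sum f (S N) =
  plus (sym_sum f N) (plus (f (Z.of_nat (S N))) (f (- Z.of_nat (S N))%Z)).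
Proof.
  unfold sym_sum.
  replace (2 * S N)%nat with (S (S (2 * N))) by lia.
  rewrite sum_Sn, sum_n_head.
  replace (Z.of_nat 0 - Z.of_nat (S N))%Z with (- Z.of_nat (S N))%Z by lia.
  replace (Z.of_nat (S (S (2 * N))) - Z.of_nat (S N))%Z
    with (Z.of_nat (S N)) by lia.
  rewrite (sum_n_ext _ (fun m => f (Z.of_nat m - Z.of_nat N)%Z))
    by (intros n; f_equal; lia).
  rewrite (plus_comm (f (- _)%Z)), <- plus_assoc.
  now rewrite (plus_comm (f (- _)%Z)).
Qed.

Lemma sym_sum_SR (f : Z -> R) (N : nat) :
  sym_sum f (S N) =
  sym_sum f N + (f (Z.of_nat (S N)) + f (- Z.of_nat (S N))%Z).
Proof. exact (sym_sum_S f N). Qed.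

Lemma sym_sum_SC (f : Z -> C) (N : nat) :
  sym_sum f (S N) =
  (sym_sum f N + (f (Z.of_nat (S N)) + f (- Z.of_nat (S N))%Z))%C.
Proof. exact (sym_sum_S f N). Qed.

Lemma sym_sum_ext {V : AbelianMonoid} (f g : Z -> V) (N : nat) :
  (forall j, f j = g j) -> sym_sum f N = sym_sum g N.
Proof. intros Hfg. apply sum_n_ext. intros; apply Hfg. Qed.

Lemma sym_sum_opp {V : AbelianMonoid} (f : Z -> V) (N : nat) :
  sym_sum (fun j => f (- j)%Z) N = sym_sum f N.
Proof.
  induction N as [|N IH].
  - now rewrite !sym_sum_0.
  - rewrite !sym_sum_S, IH, Z.opp_involutive. f_equal. apply plus_comm.
Qed.

Lemma sym_sum_plus {V : AbelianMonoid} (f g : Z -> V) (N : nat) :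
  sym_sum (fun j => plus (f j) (g j)) N = plus (sym_sum f N) (sym_sum g N).
Proof. apply sum_n_plus. Qed.

Lemma sym_sum_mult_l (z : C) (f : Z -> C) (N : nat) :
  sym_sum (fun j => (z * f j)%C) N = (z * sym_sum f N)%C.
Proof. exact (sum_n_mult_l (K := C_Ring) z _ _). Qed.

Lemma sym_sum_conj (f : Z -> C) (N : nat) :
  sym_sum (fun j => Cconj (f j)) N = Cconj (sym_sum f N).
Proof.
  induction N as [|N IH].
  - now rewrite !sym_sum_0.
  - rewrite !sym_sum_SC, IH. now rewrite !Cplus_conj.
Qed.

Lemma Cmod_sym_sum (f : Z -> C) (g : Z -> R) (N : nat) :
  (forall j, Cmod (f j) <= g j) -> Cmod (sym_sum f N) <= sym_sum g N.
Proof.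
  intros Hfg. induction N as [|N IH].
  - rewrite !sym_sum_0. apply Hfg.
  - rewrite sym_sum_SC, sym_sum_SR.
    eapply Rle_trans; [apply Cmod_triangle|]. apply Rplus_le_compat; [exact IH|].
    eapply Rle_trans; [apply Cmod_triangle|].
    apply Rplus_le_compat; apply Hfg.
Qed.

Lemma Cmod_sym_sum_diff (f : Z -> C) (g : Z -> R) (N M : nat) :
  (forall j, Cmod (f j) <= g j) -> (N <= M)%nat ->
  Cmod (sym_sum f M - sym_sum f N) <= sym_sum g M - sym_sum g N.
Proof.
  intros Hfg HNM. induction HNM as [|M HNM IH].
  - replace (sym_sum f N - sym_sum f N)%C with (RtoC 0) by ring.
    rewrite Cmod_0. lra.
  - rewrite sym_sum_SC, sym_sum_SR.
    set (u := f (Z.of_nat _)). set (v := f (- _)%Z).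
    assert (Hu : Cmod u <= g (Z.of_nat (S M))) by apply Hfg.
    assert (Hv : Cmod v <= g (- Z.of_nat (S M))%Z) by apply Hfg.
    replace (sym_sum f M + (u + v) - sym_sum f N)%C
      with ((sym_sum f M - sym_sum f N) + (u + v))%C by ring.
    pose proof (Cmod_triangle (sym_sum f M - sym_sum f N) (u + v)).
    pose proof (Cmod_triangle u v). lra.
Qed.

Lemma sym_sum_minus (f g : Z -> C) (N : nat) :
  (sym_sum f N - sym_sum g N)%C = sym_sum (fun j => (f j - g j)%C) N.
Proof.
  induction N as [|N IH].
  - now rewrite !sym_sum_0.
  - rewrite !sym_sum_SC, <- IH. ring.
Qed.

(** With the [l^1] length of the frequency, exponential bounds factor over [j1]
    and [j2], and their square sums have a closed form. *)
Definition abs1 (j1 j2 : Z) : R := Rabs (IZR j1) + Rabs (IZR j2).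

Definition geom_sum (rho : R) (N : nat) : R :=
  sym_sum (fun j => exp (- rho * Rabs (IZR j))) N.

Lemma geom_sumE (rho : R) (N : nat) : 0 < rho ->
  geom_sum rho N =
  (1 + exp (- rho) - 2 * exp (- rho) ^ S N) / (1 - exp (- rho)).
Proof.
  intros Hrho.
  assert (Hq : exp (- rho) < 1) by (rewrite <- exp_0; apply exp_increasing; lra).
  induction N as [|N IH]; unfold geom_sum in *.
  - rewrite sym_sum_0, Rabs_R0, Rmult_0_r, exp_0. simpl. field. lra.
  - rewrite sym_sum_SR, IH.
    assert (He : exp (- rho * INR (S N)) = exp (- rho) ^ S N).
    { rewrite <- (Rpower_pow (S N)) by apply exp_pos. unfold Rpower.
      rewrite ln_exp. f_equal. ring. }
    rewrite opp_IZR, Rabs_Ropp, <- INR_IZR_INZ, Rabs_right, He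
      by (apply Rle_ge, pos_INR).
    simpl. field. lra.
Qed.

Definition geom_total (rho : R) : R := (1 + exp (- rho)) / (1 - exp (- rho)).

(** The mass of [exp (- rho |j|)] outside the square, [|j|] being the [l^1] length. Both totals are
    perfect squares because the weight factors. *)
Definition geom_tail (rho : R) (N : nat) : R :=
  geom_total rho ^ 2 - geom_sum rho N ^ 2.

Lemma geom_sum_bounds (rho : R) (N : nat) : 0 < rho ->
  0 <= geom_sum rho N <= geom_total rho.
Proof.
  intros Hrho.
  assert (Hq : exp (- rho) < 1) by (rewrite <- exp_0; apply exp_increasing; lra).
  pose proof (exp_pos (- rho)) as Hp. split.
  - induction N as [|N IH]; unfold geom_sum in *.
    + rewrite sym_sum_0. left; apply exp_pos.
    + rewrite sym_sum_SR.
      pose proof (exp_pos (- rho * Rabs (IZR (Z.of_nat (S N))))).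
      pose proof (exp_pos (- rho * Rabs (IZR (- Z.of_nat (S N))))). lra.
  - rewrite geom_sumE by assumption. unfold geom_total, Rdiv.
    apply Rmult_le_compat_r; [left; apply Rinv_0_lt_compat; lra|].
    pose proof (pow_lt _ (S N) Hp). lra.
Qed.

Lemma geom_tail_lim (rho : R) : 0 < rho -> is_lim_seq (geom_tail rho) 0.
Proof.
  intros Hrho.
  assert (Hq : exp (- rho) < 1) by (rewrite <- exp_0; apply exp_increasing; lra).
  pose proof (exp_pos (- rho)) as Hp.
  assert (Hl : is_lim_seq (geom_sum rho) (geom_total rho)).
  { apply is_lim_seq_ext with
      (fun N => (1 + exp (- rho) - 2 * exp (- rho) ^ S N) * / (1 - exp (- rho))).
    { intros N. now rewrite geom_sumE. }
    unfold geom_total, Rdiv.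
    evar_last.
    - apply is_lim_seq_mult'; [|apply is_lim_seq_const].
      apply is_lim_seq_minus'; [apply is_lim_seq_const|].
      apply is_lim_seq_mult'; [apply is_lim_seq_const|].
      apply (is_lim_seq_incr_1 (fun N => exp (- rho) ^ N)).
      apply is_lim_seq_geom. rewrite Rabs_right; lra.
    - simpl. f_equal. ring. }
  unfold geom_tail. evar_last.
  - apply is_lim_seq_minus'; [apply is_lim_seq_const|].
    simpl. apply is_lim_seq_mult'; [exact Hl|].
    apply is_lim_seq_mult'; [exact Hl|apply is_lim_seq_const].
  - simpl. f_equal. ring.
Qed.

Lemma sym_sum_Rscal (K : R) (g : Z -> R) (N : nat) :
  sym_sum (fun j => K * g j) N = K * sym_sum g N.
Proof. exact (sum_n_mult_l (K := R_Ring) K _ _). Qed.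

Lemma sym_sum_Rminus (f g : Z -> R) (N : nat) :
  sym_sum (fun j => f j - g j) N = sym_sum f N - sym_sum g N.
Proof.
  induction N as [|N IH].
  - now rewrite !sym_sum_0.
  - rewrite !sym_sum_SR, IH. ringR.
Qed.

Lemma square_geom (K rho : R) (N M : nat) :
  sym_sum (fun j1 => sym_sum (fun j2 => K * exp (- rho * abs1 j1 j2)) N) M
  = K * (geom_sum rho N * geom_sum rho M).
Proof.
  rewrite (sym_sum_ext _
    (fun j1 => (K * geom_sum rho N) * exp (- rho * Rabs (IZR j1)))).
  - rewrite sym_sum_Rscal. unfold geom_sum. ringR.
  - intros j1. rewrite sym_sum_Rscal.
    rewrite (sym_sum_ext _ (fun j2 => exp (- rho * Rabs (IZR j1))
                                      * exp (- rho * Rabs (IZR j2)))).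
    + rewrite sym_sum_Rscal. unfold geom_sum. ringR.
    + intros j2. unfold abs1. rewrite <- exp_plus. f_equal. ring.
Qed.

Section Dominated.

Context (f : Z -> Z -> C) (K rho : R) (Hrho : 0 < rho)
  (Hf : forall j1 j2, Cmod (f j1 j2) <= K * exp (- rho * abs1 j1 j2)).

Lemma dominating_nonneg : 0 <= K.
Proof.
  pose proof (Hf 0 0) as H0. pose proof (Cmod_ge_0 (f 0%Z 0%Z)) as H1.
  pose proof (exp_pos (- rho * abs1 0 0)). nra.
Qed.

Lemma square_sum_bound (N : nat) :
  Cmod (square_sum f N) <= K * geom_total rho ^ 2.
Proof.
  rewrite square_sumE.
  eapply Rle_trans; [apply Cmod_sym_sum; intros j1; apply Cmod_sym_sum, Hf|].
  rewrite square_geom. apply Rmult_le_compat_l; [apply dominating_nonneg|].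
  pose proof (geom_sum_bounds rho N Hrho). simpl. nra.
Qed.

Lemma square_sum_diff (N M : nat) : (N <= M)%nat ->
  Cmod (square_sum f M - square_sum f N) <= K * geom_tail rho N.
Proof.
  intros HNM. rewrite !square_sumE.
  (* The rectangle [|j1| <= N], [|j2| <= M] lies between the two squares, so that each of the two
     differences involves a single index. *)
  set (A := sym_sum (fun j1 => sym_sum (f j1) M) N).
  replace (_ - _)%C with
    ((sym_sum (fun j1 => sym_sum (f j1) M) M - A)
     + (A - sym_sum (fun j1 => sym_sum (f j1) N) N))%C by ring.
  eapply Rle_trans; [apply Cmod_triangle|].
  assert (H1 : Cmod (sym_sum (fun j1 => sym_sum (f j1) M) M - A)
    <= K * (geom_sum rho M * geom_sum rho M) - K * (geom_sum rho M * geom_sum rho N)).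
  { rewrite <- !square_geom. apply Cmod_sym_sum_diff; [|assumption].
    intros j1. apply Cmod_sym_sum, Hf. }
  assert (H2 : Cmod (A - sym_sum (fun j1 => sym_sum (f j1) N) N)
    <= K * (geom_sum rho M * geom_sum rho N) - K * (geom_sum rho N * geom_sum rho N)).
  { unfold A. rewrite sym_sum_minus.
    set (e := fun j1 j2 => K * exp (- rho * abs1 j1 j2)).
    eapply Rle_trans.
    { apply Cmod_sym_sum with (g := fun j1 => sym_sum (e j1) M - sym_sum (e j1) N).
      intros j1. now apply Cmod_sym_sum_diff. }
    rewrite <- !square_geom. right. apply sym_sum_Rminus. }
  pose proof (geom_sum_bounds rho M Hrho). pose proof (geom_sum_bounds rho N Hrho).
  pose proof dominating_nonneg.
  assert (K * geom_sum rho M ^ 2 <= K * geom_total rho ^ 2).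
  { apply Rmult_le_compat_l; [assumption|]. apply pow_incr. lra. }
  unfold geom_tail. nra.
Qed.

End Dominated.

(** Genuine convergence of the square sums. [Lim_seq] is total and has no unconditional algebra, so
    identities between series are proved here and then transferred by [sums_fourier_series]. *)
Definition sums (f : Z -> Z -> C) (z : C) : Prop :=
  forall eps, 0 < eps -> exists N0, forall N, (N0 <= N)%nat ->
    Cmod (square_sum f N - z) < eps.

Lemma Cmod_le_Re_Im (z : C) : Cmod z <= Rabs (Re z) + Rabs (Im z).
Proof.
  replace z with (RtoC (Re z) + Ci * RtoC (Im z))%C at 1.
  - eapply Rle_trans; [apply Cmod_triangle|].
    rewrite Cmod_mult, Cmod_Ci, !Cmod_R. lra.
  - destruct z as [x y]. apply injective_projections; simpl; ring.
Qed.

Lemma im_le_Cmod (z : C) : Rabs (Im z) <= Cmod z.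
Proof. eapply Rle_trans; [apply Rmax_r|apply Rmax_Cmod]. Qed.

Lemma sums_lim (f : Z -> Z -> C) (z : C) : sums f z ->
  is_lim_seq (fun N => Re (square_sum f N)) (Re z) /\
  is_lim_seq (fun N => Im (square_sum f N)) (Im z).
Proof.
  intros Hf. split; apply is_lim_seq_spec; intros eps;
    destruct (Hf eps (cond_pos eps)) as [N0 HN]; exists N0; intros N HN0;
    (eapply Rle_lt_trans; [|apply (HN N HN0)]).
  - apply (re_le_Cmod (square_sum f N - z)).
  - apply (im_le_Cmod (square_sum f N - z)).
Qed.

Lemma sums_fourier_series (c : Z -> Z -> C) (a1 a2 : R) (z : C) :
  sums (fun j1 j2 => (c j1 j2 * character j1 j2 a1 a2)%C) z ->
  fourier_series c a1 a2 = z.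
Proof.
  intros Hz. destruct (sums_lim _ _ Hz) as [H1 H2]. unfold fourier_series.
  rewrite (is_lim_seq_unique _ _ H1), (is_lim_seq_unique _ _ H2).
  now destruct z.
Qed.

Lemma sums_ext (f g : Z -> Z -> C) (z : C) :
  (forall j1 j2, f j1 j2 = g j1 j2) -> sums f z -> sums g z.
Proof.
  intros Hfg. replace g with f; [easy|].
  extensionality j1. extensionality j2. apply Hfg.
Qed.

Lemma sums_plus (f g : Z -> Z -> C) (z w : C) : sums f z -> sums g w ->
  sums (fun j1 j2 => (f j1 j2 + g j1 j2)%C) (z + w)%C.
Proof.
  intros Hf Hg eps He.
  destruct (Hf (eps / 2) ltac:(lra)) as [N1 H1].
  destruct (Hg (eps / 2) ltac:(lra)) as [N2 H2].
  exists (max N1 N2). intros N HN.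
  specialize (H1 N ltac:(lia)). specialize (H2 N ltac:(lia)).
  replace (square_sum _ N) with (square_sum f N + square_sum g N)%C.
  - replace (_ - _)%C with ((square_sum f N - z) + (square_sum g N - w))%C by ring.
    eapply Rle_lt_trans; [apply Cmod_triangle|]. lra.
  - rewrite !square_sumE, <- (sym_sum_plus (V := C_AbelianMonoid)).
    apply sym_sum_ext. intros j1. symmetry.
    apply (sym_sum_plus (V := C_AbelianMonoid)).
Qed.

Lemma sums_scal (w : C) (f : Z -> Z -> C) (z : C) : sums f z ->
  sums (fun j1 j2 => (w * f j1 j2)%C) (w * z)%C.
Proof.
  intros Hf eps He. pose proof (Cmod_ge_0 w).
  destruct (Hf (eps / (Cmod w + 1))) as [N0 HN].
  { apply Rdiv_lt_0_compat; lra. }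
  exists N0. intros N HN0. specialize (HN N HN0).
  replace (square_sum _ N) with (w * square_sum f N)%C.
  - replace (_ - _)%C with (w * (square_sum f N - z))%C by ring.
    rewrite Cmod_mult. apply Rlt_div_r in HN; [|lra].
    pose proof (Cmod_ge_0 (square_sum f N - z)). nra.
  - rewrite !square_sumE, <- sym_sum_mult_l. apply sym_sum_ext.
    intros j1. now rewrite <- sym_sum_mult_l.
Qed.

Lemma sums_minus (f g : Z -> Z -> C) (z w : C) : sums f z -> sums g w ->
  sums (fun j1 j2 => (f j1 j2 - g j1 j2)%C) (z - w)%C.
Proof.
  intros Hf Hg. replace (z - w)%C with (z + (- (1)) * w)%C by ring.
  eapply sums_ext; [|apply (sums_plus _ _ _ _ Hf (sums_scal (- (1)) _ _ Hg))].
  intros; simpl; ring.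
Qed.

Lemma sums_conj (f : Z -> Z -> C) (z : C) : sums f z ->
  sums (fun j1 j2 => Cconj (f j1 j2)) (Cconj z).
Proof.
  intros Hf eps He. destruct (Hf eps He) as [N0 HN].
  exists N0. intros N HN0.
  replace (square_sum _ N) with (Cconj (square_sum f N)).
  - rewrite <- Cminus_conj, Cmod_conj. auto.
  - rewrite !square_sumE, <- sym_sum_conj. apply sym_sum_ext.
    intros j1. now rewrite <- sym_sum_conj.
Qed.

Lemma sums_opp (f : Z -> Z -> C) (z : C) : sums f z ->
  sums (fun j1 j2 => f (- j1)%Z (- j2)%Z) z.
Proof.
  intros Hf eps He. destruct (Hf eps He) as [N0 HN].
  exists N0. intros N HN0.
  replace (square_sum _ N) with (square_sum f N); [auto|].
  rewrite !square_sumE, <- (sym_sum_opp (fun j1 => sym_sum (f j1) N)).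
  apply sym_sum_ext. intros j1. now rewrite <- (sym_sum_opp (f (- j1)%Z)).
Qed.

Lemma sums_bound (f : Z -> Z -> C) (z : C) (K rho : R) : 0 < rho ->
  (forall j1 j2, Cmod (f j1 j2) <= K * exp (- rho * abs1 j1 j2)) ->
  sums f z -> Cmod z <= K * geom_total rho ^ 2.
Proof.
  intros Hrho Hf Hz. apply le_epsilon. intros eps He.
  destruct (Hz eps He) as [N HN]. specialize (HN N (le_n N)).
  pose proof (square_sum_bound f K rho Hrho Hf N).
  replace z with (square_sum f N - (square_sum f N - z))%C by ring.
  eapply Rle_trans; [apply Cmod_triangle|]. rewrite Cmod_opp. lra.
Qed.

(** The larger square in [square_sum_diff] tends to infinity. The rate depends on [f] only through
    [K] and [rho], which makes the convergence of a Fourier series uniform on the torus. *)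
Lemma sums_tail (f : Z -> Z -> C) (z : C) (K rho : R) (N : nat) : 0 < rho ->
  (forall j1 j2, Cmod (f j1 j2) <= K * exp (- rho * abs1 j1 j2)) ->
  sums f z -> Cmod (square_sum f N - z) <= K * geom_tail rho N.
Proof.
  intros Hrho Hf Hz. apply le_epsilon. intros eps He.
  destruct (Hz eps He) as [N0 HN]. specialize (HN (max N N0) ltac:(lia)).
  pose proof (square_sum_diff f K rho Hrho Hf N (max N N0) ltac:(lia)) as Hd.
  replace (square_sum f N - z)%C with
    ((square_sum f (max N N0) - z) - (square_sum f (max N N0) - square_sum f N))%C
    by ring.
  eapply Rle_trans; [apply Cmod_triangle|]. rewrite Cmod_opp. lra.
Qed.

Lemma geom_tail_small (K rho eps : R) : 0 < rho -> 0 < eps ->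
  exists N0, forall N, (N0 <= N)%nat -> K * geom_tail rho N < eps.
Proof.
  intros Hrho He.
  assert (Hl : is_lim_seq (fun N => K * geom_tail rho N) 0).
  { evar_last.
    - apply is_lim_seq_mult'; [apply is_lim_seq_const|apply geom_tail_lim, Hrho].
    - simpl; f_equal; ring. }
  apply is_lim_seq_spec in Hl. destruct (Hl (mkposreal eps He)) as [N0 HN].
  exists N0. intros N HN0. specialize (HN N HN0). simpl in HN.
  rewrite Rminus_0_r in HN. eapply Rle_lt_trans; [apply Rle_abs|exact HN].
Qed.

Lemma sums_exists (f : Z -> Z -> C) (K rho : R) : 0 < rho ->
  (forall j1 j2, Cmod (f j1 j2) <= K * exp (- rho * abs1 j1 j2)) ->
  exists z, sums f z.
Proof.
  intros Hrho Hf.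
  assert (Hc : forall eps, 0 < eps -> exists N0, forall N M,
    (N0 <= N)%nat -> (N0 <= M)%nat ->
    Cmod (square_sum f M - square_sum f N) < eps).
  { intros eps He.
    destruct (geom_tail_small K rho (eps / 2) Hrho ltac:(lra)) as [N0 HN].
    specialize (HN N0 (le_n N0)). exists N0. intros N M HN1 HM1.
    pose proof (square_sum_diff f K rho Hrho Hf N0 N HN1).
    pose proof (square_sum_diff f K rho Hrho Hf N0 M HM1).
    replace (_ - _)%C with ((square_sum f M - square_sum f N0)
                            - (square_sum f N - square_sum f N0))%C by ring.
    eapply Rle_lt_trans; [apply Cmod_triangle|]. rewrite Cmod_opp. lra. }
  assert (H1 : ex_finite_lim_seq (fun N => Re (square_sum f N))).
  { apply ex_lim_seq_cauchy_corr. intros eps.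
    destruct (Hc eps (cond_pos eps)) as [N0 HN]. exists N0. intros n m Hn Hm.
    eapply Rle_lt_trans; [apply (re_le_Cmod (square_sum f n - square_sum f m))|].
    now apply HN. }
  assert (H2 : ex_finite_lim_seq (fun N => Im (square_sum f N))).
  { apply ex_lim_seq_cauchy_corr. intros eps.
    destruct (Hc eps (cond_pos eps)) as [N0 HN]. exists N0. intros n m Hn Hm.
    eapply Rle_lt_trans; [apply (im_le_Cmod (square_sum f n - square_sum f m))|].
    now apply HN. }
  destruct H1 as [x Hx], H2 as [y Hy]. exists (x, y).
  apply is_lim_seq_spec in Hx. apply is_lim_seq_spec in Hy.
  intros eps He.
  destruct (Hx (mkposreal (eps / 2) ltac:(lra))) as [N1 HN1].
  destruct (Hy (mkposreal (eps / 2) ltac:(lra))) as [N2 HN2].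
  exists (max N1 N2). intros N HN.
  specialize (HN1 N ltac:(lia)). specialize (HN2 N ltac:(lia)). simpl in HN1, HN2.
  eapply Rle_lt_trans; [apply Cmod_le_Re_Im|]. simpl.
  unfold Re, Im, Rminus in *. lra.
Qed.

(** * Fourier series with exponentially decaying coefficients *)

Definition expi (x : R) : C := (cos x, sin x).

Lemma characterE (j1 j2 : Z) (a1 a2 : R) :
  character j1 j2 a1 a2 = expi (IZR j1 * a1 + IZR j2 * a2).
Proof. reflexivity. Qed.

Lemma expi_0 : expi 0 = RtoC 1.
Proof. unfold expi. now rewrite cos_0, sin_0. Qed.

Lemma expi_plus (x y : R) : expi (x + y) = (expi x * expi y)%C.
Proof.
  unfold expi. rewrite cos_plus, sin_plus.
  apply injective_projections; simpl; ring.
Qed.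

Lemma expi_conj (x : R) : Cconj (expi x) = expi (- x).
Proof. unfold expi, Cconj. simpl. now rewrite cos_neg, sin_neg. Qed.

Lemma Cmod_expi (x : R) : Cmod (expi x) = 1.
Proof.
  unfold Cmod, expi. simpl fst. simpl snd.
  replace (cos x ^ 2 + sin x ^ 2) with 1; [apply sqrt_1|].
  pose proof (sin2_cos2 x) as E. unfold Rsqr in E. simpl. lra.
Qed.

Lemma expi_period (j : Z) : expi (IZR j * (2 * PI)) = RtoC 1.
Proof.
  assert (Hn : forall n : nat, expi (INR n * (2 * PI)) = RtoC 1).
  { induction n as [|n IH].
    - simpl INR. now rewrite Rmult_0_l, expi_0.
    - rewrite S_INR, Rmult_plus_distr_r, expi_plus, IH, Rmult_1_l.
      unfold expi. rewrite cos_2PI, sin_2PI.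
      apply injective_projections; simpl; ring. }
  destruct (Z.le_ge_cases 0 j) as [Hj|Hj].
  - rewrite <- (Z2Nat.id j Hj), <- INR_IZR_INZ. apply Hn.
  - replace (IZR j * (2 * PI)) with (- (IZR (- j) * (2 * PI)))
      by (rewrite opp_IZR; ring).
    rewrite <- expi_conj, <- (Z2Nat.id (- j)), <- INR_IZR_INZ, Hn by lia.
    apply injective_projections; simpl; ring.
Qed.

Lemma Rabs_sin_le (x : R) : Rabs (sin x) <= Rabs x.
Proof.
  destruct (MVT_gen sin 0 x cos) as [y [_ Hy]].
  - intros; apply is_derive_Reals, derivable_pt_lim_sin.
  - intros; apply continuity_sin.
  - rewrite sin_0, !Rminus_0_r in Hy. rewrite Hy, Rabs_mult.
    pose proof (COS_bound y). pose proof (Rabs_pos x).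
    assert (Rabs (cos y) <= 1) by (apply Rabs_le; lra). nra.
Qed.

Lemma Rabs_cos_sub1_le (x : R) : Rabs (cos x - 1) <= Rabs x.
Proof.
  destruct (MVT_gen cos 0 x (fun y => - sin y)) as [y [_ Hy]].
  - intros; apply is_derive_Reals, derivable_pt_lim_cos.
  - intros; apply continuity_cos.
  - rewrite cos_0, !Rminus_0_r in Hy. rewrite Hy, Rabs_mult, Rabs_Ropp.
    pose proof (SIN_bound y). pose proof (Rabs_pos x).
    assert (Rabs (sin y) <= 1) by (apply Rabs_le; lra). nra.
Qed.

Lemma Rmin_max_0_abs (x y : R) :
  Rmin 0 x <= y <= Rmax 0 x -> Rabs y <= Rabs x.
Proof.
  intros [H1 H2]. unfold Rmin, Rmax in *. destruct (Rle_dec 0 x).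
  - rewrite !Rabs_right; lra.
  - rewrite !Rabs_left1; lra.
Qed.

Lemma Cmod_expi_sub1 (x : R) : Cmod (expi x - 1) <= 2 * Rabs x.
Proof.
  eapply Rle_trans; [apply Cmod_le_Re_Im|]. simpl.
  pose proof (Rabs_cos_sub1_le x). pose proof (Rabs_sin_le x).
  unfold Rminus in *. rewrite Ropp_0, Rplus_0_r. lra.
Qed.

(** The mean value theorem turns the first-order bounds for sine and cosine into second-order ones.
    Only the quadratic order matters, for [fs_taylor]. *)
Lemma Cmod_expi_taylor (x : R) :
  Cmod (expi x - 1 - Ci * RtoC x) <= 2 * Rabs x ^ 2.
Proof.
  eapply Rle_trans; [apply Cmod_le_Re_Im|]. simpl.
  replace (cos x + - (1) + - (0 * x - 1 * 0)) with (cos x - 1) by ring.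
  replace (sin x + - 0 + - (0 * 0 + 1 * x)) with (sin x - x) by ring.
  assert (H1 : Rabs (cos x - 1) <= Rabs x ^ 2).
  { destruct (MVT_gen cos 0 x (fun y => - sin y)) as [y [Hy1 Hy]].
    - intros; apply is_derive_Reals, derivable_pt_lim_cos.
    - intros; apply continuity_cos.
    - rewrite cos_0, !Rminus_0_r in Hy. rewrite Hy, Rabs_mult, Rabs_Ropp.
      pose proof (Rabs_sin_le y). pose proof (Rabs_pos x).
      pose proof (Rmin_max_0_abs _ _ Hy1). nra. }
  assert (H2 : Rabs (sin x - x) <= Rabs x ^ 2).
  { destruct (MVT_gen (fun y => sin y - y) 0 x (fun y => cos y - 1))
      as [y [Hy1 Hy]].
    - intros. auto_derive; [easy|ring].
    - intros. apply continuity_pt_minus;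
        [apply continuity_sin|apply derivable_continuous_pt, derivable_pt_id].
    - rewrite sin_0, !Rminus_0_r in Hy. rewrite Hy, Rabs_mult.
      pose proof (Rabs_cos_sub1_le y). pose proof (Rabs_pos x).
      pose proof (Rmin_max_0_abs _ _ Hy1). nra. }
  simpl in H1, H2. lra.
Qed.

Lemma exp_le (x y : R) : x <= y -> exp x <= exp y.
Proof.
  intros [Hxy| ->]; [left; now apply exp_increasing|apply Rle_refl].
Qed.

(** Analyticity in a complex strip, expressed by coefficients. The rate is existential because
    multipliers of linear growth, such as derivatives, lower it. *)
Definition decay (c : Z -> Z -> C) : Prop :=
  exists K rho, 0 < rho /\
    forall j1 j2, Cmod (c j1 j2) <= K * exp (- rho * abs1 j1 j2).

Lemma abs1_nonneg (j1 j2 : Z) : 0 <= abs1 j1 j2.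
Proof.
  unfold abs1. pose proof (Rabs_pos (IZR j1)). pose proof (Rabs_pos (IZR j2)). lra.
Qed.

(** Half of the exponential absorbs the linear factor: [1 + t <= exp t] at [t = rho x / 2] gives
    [x exp (- rho x / 2) <= 2 / rho]. The other half remains as decay. *)
Lemma decay_mult (mu c : Z -> Z -> C) (A : R) : decay c ->
  (forall j1 j2, Cmod (mu j1 j2) <= A * (1 + abs1 j1 j2)) ->
  decay (fun j1 j2 => (mu j1 j2 * c j1 j2)%C).
Proof.
  intros [K [rho [Hrho Hc]]] Hmu.
  pose proof (dominating_nonneg c K rho Hc) as HK.
  exists (A * K * (1 + 2 / rho)), (rho / 2). split; [lra|].
  intros j1 j2. rewrite Cmod_mult.
  set (x := abs1 j1 j2) in *. pose proof (abs1_nonneg j1 j2) as Hx. fold x in Hx.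
  specialize (Hc j1 j2). specialize (Hmu j1 j2). fold x in Hc, Hmu.
  pose proof (Cmod_ge_0 (mu j1 j2)). pose proof (Cmod_ge_0 (c j1 j2)).
  assert (He : exp (- rho * x) = exp (- (rho / 2) * x) * exp (- (rho / 2) * x))
    by (rewrite <- exp_plus; f_equal; field).
  set (E := exp (- (rho / 2) * x)) in *.
  assert (HE : 0 < E) by apply exp_pos.
  assert (HE1 : E <= 1).
  { unfold E. rewrite <- exp_0. apply exp_le. nra. }
  assert (HE2 : x * E <= 2 / rho).
  { pose proof (exp_ineq1_le (rho / 2 * x)) as Hi.
    assert (Hinv : exp (rho / 2 * x) * E = 1).
    { unfold E. rewrite <- exp_plus, <- exp_0. f_equal. ring. }
    assert (rho / 2 * x * E <= exp (rho / 2 * x) * E)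
      by (apply Rmult_le_compat_r; lra).
    replace (x * E) with (2 / rho * (rho / 2 * x * E)) by (field; lra).
    replace (2 / rho) with (2 / rho * 1) at 2 by ring.
    apply Rmult_le_compat_l; [left; apply Rdiv_lt_0_compat|]; lra. }
  assert (HA : 0 <= A).
  { assert (0 <= A * (1 + x)) by lra. nra. }
  apply Rle_trans with ((A * (1 + x)) * (K * (E * E))).
  { rewrite <- He. apply Rmult_le_compat; assumption. }
  replace (A * (1 + x) * (K * (E * E))) with (A * K * ((E + x * E) * E)) by ring.
  replace (A * K * (1 + 2 / rho) * E) with (A * K * ((1 + 2 / rho) * E)) by ring.
  apply Rmult_le_compat_l; [nra|]. nra.
Qed.

Lemma decay_bounded_mult (mu c : Z -> Z -> C) (A : R) : decay c ->
  (forall j1 j2, Cmod (mu j1 j2) <= A) ->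
  decay (fun j1 j2 => (mu j1 j2 * c j1 j2)%C).
Proof.
  intros Hc Hmu. apply decay_mult with A; [assumption|].
  intros j1 j2. pose proof (Hmu j1 j2). pose proof (Cmod_ge_0 (mu j1 j2)).
  pose proof (abs1_nonneg j1 j2). nra.
Qed.

Lemma decay_le (c d : Z -> Z -> C) : decay d ->
  (forall j1 j2, Cmod (c j1 j2) <= Cmod (d j1 j2)) -> decay c.
Proof.
  intros [K [rho [Hrho Hd]]] Hcd. exists K, rho. split; [assumption|].
  intros. eapply Rle_trans; [apply Hcd|apply Hd].
Qed.

Lemma decay_scal (z : C) (c : Z -> Z -> C) : decay c ->
  decay (fun j1 j2 => (z * c j1 j2)%C).
Proof.
  intros Hc. apply (decay_bounded_mult (fun _ _ => z) c (Cmod z)); [assumption|].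
  intros; apply Rle_refl.
Qed.

Lemma decay_opp (c : Z -> Z -> C) : decay c ->
  decay (fun j1 j2 => c (- j1)%Z (- j2)%Z).
Proof.
  intros [K [rho [Hrho Hc]]]. exists K, rho. split; [assumption|].
  intros j1 j2. eapply Rle_trans; [apply Hc|].
  unfold abs1. rewrite !opp_IZR, !Rabs_Ropp. apply Rle_refl.
Qed.

Lemma decay_conj_opp (c : Z -> Z -> C) : decay c ->
  decay (fun j1 j2 => Cconj (c (- j1)%Z (- j2)%Z)).
Proof.
  intros Hc. apply decay_le with (1 := decay_opp c Hc).
  intros j1 j2. rewrite Cmod_conj. apply Rle_refl.
Qed.

Lemma decay_plus (c d : Z -> Z -> C) : decay c -> decay d ->
  decay (fun j1 j2 => (c j1 j2 + d j1 j2)%C).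
Proof.
  intros [K [rho [Hrho Hc]]] [K' [rho' [Hrho' Hd]]].
  exists (K + K'), (Rmin rho rho'). split; [now apply Rmin_glb_lt|].
  intros j1 j2. eapply Rle_trans; [apply Cmod_triangle|].
  pose proof (dominating_nonneg c K rho Hc). pose proof (dominating_nonneg d K' rho' Hd).
  pose proof (abs1_nonneg j1 j2).
  specialize (Hc j1 j2). specialize (Hd j1 j2).
  pose proof (Rmin_l rho rho'). pose proof (Rmin_r rho rho').
  assert (exp (- rho * abs1 j1 j2) <= exp (- Rmin rho rho' * abs1 j1 j2))
    by (apply exp_le; nra).
  assert (exp (- rho' * abs1 j1 j2) <= exp (- Rmin rho rho' * abs1 j1 j2))
    by (apply exp_le; nra).
  nra.
Qed.

(** * Pointwise calculus of decaying series *)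

Definition term (c : Z -> Z -> C) (a1 a2 : R) (j1 j2 : Z) : C :=
  (c j1 j2 * character j1 j2 a1 a2)%C.

Lemma Cmod_term (c : Z -> Z -> C) (a1 a2 : R) (j1 j2 : Z) :
  Cmod (term c a1 a2 j1 j2) = Cmod (c j1 j2).
Proof. unfold term. rewrite Cmod_mult, characterE, Cmod_expi. ring. Qed.

Lemma sums_fs (c : Z -> Z -> C) (a1 a2 : R) : decay c ->
  sums (term c a1 a2) (fourier_series c a1 a2).
Proof.
  intros [K [rho [Hrho Hc]]].
  destruct (sums_exists (term c a1 a2) K rho Hrho) as [z Hz].
  { intros. rewrite Cmod_term. apply Hc. }
  now rewrite (sums_fourier_series c a1 a2 z Hz).
Qed.

Lemma fs_eq (c : Z -> Z -> C) (a1 a2 : R) (z : C) :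
  sums (term c a1 a2) z -> fourier_series c a1 a2 = z.
Proof. apply sums_fourier_series. Qed.

Lemma fs_plus (c d : Z -> Z -> C) (a1 a2 : R) : decay c -> decay d ->
  fourier_series (fun j1 j2 => (c j1 j2 + d j1 j2)%C) a1 a2 =
  (fourier_series c a1 a2 + fourier_series d a1 a2)%C.
Proof.
  intros Hc Hd. apply fs_eq.
  eapply sums_ext; [|apply (sums_plus _ _ _ _ (sums_fs c a1 a2 Hc) (sums_fs d a1 a2 Hd))].
  intros. unfold term. ring.
Qed.

Lemma fs_scal (z : C) (c : Z -> Z -> C) (a1 a2 : R) : decay c ->
  fourier_series (fun j1 j2 => (z * c j1 j2)%C) a1 a2 =
  (z * fourier_series c a1 a2)%C.
Proof.
  intros Hc. apply fs_eq.
  eapply sums_ext; [|apply (sums_scal z _ _ (sums_fs c a1 a2 Hc))].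
  intros. unfold term. ring.
Qed.

Lemma fs_conj (c : Z -> Z -> C) (a1 a2 : R) : decay c ->
  Cconj (fourier_series c a1 a2) =
  fourier_series (fun j1 j2 => Cconj (c (- j1)%Z (- j2)%Z)) a1 a2.
Proof.
  intros Hc. symmetry. apply fs_eq.
  eapply sums_ext; [|apply (sums_conj _ _ (sums_opp _ _ (sums_fs c a1 a2 Hc)))].
  intros. unfold term. rewrite Cmult_conj, !characterE, expi_conj, !opp_IZR.
  do 2 f_equal. ring.
Qed.

Lemma fs_opp (c : Z -> Z -> C) (a1 a2 : R) : decay c ->
  fourier_series c (- a1) (- a2) =
  fourier_series (fun j1 j2 => c (- j1)%Z (- j2)%Z) a1 a2.
Proof.
  intros Hc. symmetry. apply fs_eq.
  eapply sums_ext; [|apply (sums_opp _ _ (sums_fs c (- a1) (- a2) Hc))].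
  intros. unfold term. rewrite !characterE, !opp_IZR. do 2 f_equal. ring.
Qed.

Definition shift_coef (s1 s2 : R) (c : Z -> Z -> C) (j1 j2 : Z) : C :=
  (expi (- (IZR j1 * s1 + IZR j2 * s2)) * c j1 j2)%C.

Lemma decay_shift (s1 s2 : R) (c : Z -> Z -> C) :
  decay c -> decay (shift_coef s1 s2 c).
Proof.
  intros Hc. apply decay_bounded_mult with 1; [assumption|].
  intros. rewrite Cmod_expi. lra.
Qed.

Lemma fs_shift (c : Z -> Z -> C) (s1 s2 a1 a2 : R) : decay c ->
  fourier_series c (a1 - s1) (a2 - s2) = fourier_series (shift_coef s1 s2 c) a1 a2.
Proof.
  intros Hc. symmetry. apply fs_eq.
  eapply sums_ext; [|apply (sums_fs c (a1 - s1) (a2 - s2) Hc)].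
  intros j1 j2. unfold term, shift_coef. rewrite !characterE.
  replace (IZR j1 * (a1 - s1) + IZR j2 * (a2 - s2)) with
    (- (IZR j1 * s1 + IZR j2 * s2) + (IZR j1 * a1 + IZR j2 * a2)) by ring.
  rewrite expi_plus. ring.
Qed.

Lemma fs_periodic (c : Z -> Z -> C) (a1 a2 : R) :
  fourier_series c (a1 + 2 * PI) a2 = fourier_series c a1 a2 /\
  fourier_series c a1 (a2 + 2 * PI) = fourier_series c a1 a2.
Proof.
  split; unfold fourier_series;
    replace (fun j1 j2 => (c j1 j2 * _)%C) with (term c a1 a2); try reflexivity;
    extensionality j1; extensionality j2; unfold term; rewrite !characterE.
  - replace (IZR j1 * (a1 + 2 * PI) + IZR j2 * a2) with
      (IZR j1 * (2 * PI) + (IZR j1 * a1 + IZR j2 * a2)) by ring.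
    rewrite (expi_plus (IZR j1 * (2 * PI))), expi_period. ring.
  - replace (IZR j1 * a1 + IZR j2 * (a2 + 2 * PI)) with
      (IZR j2 * (2 * PI) + (IZR j1 * a1 + IZR j2 * a2)) by ring.
    rewrite (expi_plus (IZR j2 * (2 * PI))), expi_period. ring.
Qed.

Lemma fs_bounded (c : Z -> Z -> C) : decay c ->
  exists B, forall a1 a2, Cmod (fourier_series c a1 a2) <= B.
Proof.
  intros Hc. pose proof Hc as [K [rho [Hrho HK]]].
  exists (K * geom_total rho ^ 2). intros a1 a2.
  apply (sums_bound (term c a1 a2)); [assumption| |now apply sums_fs].
  intros. rewrite Cmod_term. apply HK.
Qed.

Lemma fs_uniform (c : Z -> Z -> C) (eps : R) : decay c -> 0 < eps ->
  exists N0, forall N, (N0 <= N)%nat -> forall a1 a2,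
    Cmod (square_sum (term c a1 a2) N - fourier_series c a1 a2) < eps.
Proof.
  intros Hc Heps. pose proof Hc as [K [rho [Hrho HK]]].
  destruct (geom_tail_small K rho eps Hrho Heps) as [N0 HN].
  exists N0. intros N HN0 a1 a2. eapply Rle_lt_trans; [|apply (HN N HN0)].
  apply (sums_tail (term c a1 a2)); [assumption| |now apply sums_fs].
  intros. rewrite Cmod_term. apply HK.
Qed.

(** * Lipschitz and Taylor estimates *)

Lemma Rabs_dot_le (j1 j2 : Z) (v1 v2 : R) :
  Rabs (IZR j1 * v1 + IZR j2 * v2) <= (1 + abs1 j1 j2) * (Rabs v1 + Rabs v2).
Proof.
  eapply Rle_trans; [apply Rabs_triang|]. rewrite !Rabs_mult. unfold abs1.
  pose proof (Rabs_pos (IZR j1)). pose proof (Rabs_pos (IZR j2)).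
  pose proof (Rabs_pos v1). pose proof (Rabs_pos v2). nra.
Qed.

(** The multiplier of [v1 d/da1 + v2 d/da2]. A general direction covers both partial derivatives and
    [D], which is the direction [(1, k)]. *)
Definition deriv_coef (v1 v2 : R) (c : Z -> Z -> C) (j1 j2 : Z) : C :=
  (Ci * RtoC (IZR j1 * v1 + IZR j2 * v2) * c j1 j2)%C.

Lemma decay_deriv (v1 v2 : R) (c : Z -> Z -> C) :
  decay c -> decay (deriv_coef v1 v2 c).
Proof.
  intros Hc. apply decay_mult with (Rabs v1 + Rabs v2); [assumption|].
  intros j1 j2. rewrite Cmod_mult, Cmod_Ci, Cmod_R, Rmult_1_l.
  eapply Rle_trans; [apply Rabs_dot_le|right; ring].
Qed.

(** Two powers of the frequency are what a second-order Taylor remainder of a character costs. *)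
Lemma decay_quadratic (c : Z -> Z -> C) : decay c ->
  exists K rho, 0 < rho /\ forall j1 j2,
    (1 + abs1 j1 j2) ^ 2 * Cmod (c j1 j2) <= K * exp (- rho * abs1 j1 j2).
Proof.
  intros Hc.
  set (mu := fun j1 j2 => RtoC (1 + abs1 j1 j2)).
  assert (Hmu : forall j1 j2, Cmod (mu j1 j2) = 1 + abs1 j1 j2).
  { intros j1 j2. unfold mu. rewrite Cmod_R. apply Rabs_right.
    pose proof (abs1_nonneg j1 j2). lra. }
  assert (Hmu' : forall j1 j2, Cmod (mu j1 j2) <= 1 * (1 + abs1 j1 j2))
    by (intros; rewrite Hmu; lra).
  destruct (decay_mult mu _ 1 (decay_mult mu c 1 Hc Hmu') Hmu')
    as [K [rho [Hrho H]]].
  exists K, rho. split; [assumption|]. intros j1 j2.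
  specialize (H j1 j2). rewrite !Cmod_mult, !Hmu in H. simpl. lra.
Qed.

Lemma fs_lipschitz (c : Z -> Z -> C) : decay c ->
  exists L, 0 <= L /\ forall a1 a2 b1 b2,
    Cmod (fourier_series c a1 a2 - fourier_series c b1 b2)
    <= L * (Rabs (a1 - b1) + Rabs (a2 - b2)).
Proof.
  intros Hc. destruct (decay_quadratic c Hc) as [K [rho [Hrho HK]]].
  assert (HK0 : 0 <= K).
  { specialize (HK 0%Z 0%Z). pose proof (Cmod_ge_0 (c 0%Z 0%Z)).
    pose proof (exp_pos (- rho * abs1 0 0)).
    pose proof (pow2_ge_0 (1 + abs1 0 0)). nra. }
  exists (2 * K * geom_total rho ^ 2). split.
  { pose proof (pow2_ge_0 (geom_total rho)). nra. }
  intros a1 a2 b1 b2. set (h := Rabs (a1 - b1) + Rabs (a2 - b2)).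
  assert (Hh : 0 <= h).
  { unfold h. pose proof (Rabs_pos (a1 - b1)). pose proof (Rabs_pos (a2 - b2)). lra. }
  eapply Rle_trans.
  - apply (sums_bound (fun j1 j2 => (term c a1 a2 j1 j2 - term c b1 b2 j1 j2)%C) _
      (2 * K * h) rho Hrho); [|now apply sums_minus; apply sums_fs].
    intros j1 j2. unfold term. rewrite !characterE.
    replace (IZR j1 * a1 + IZR j2 * a2) with
      ((IZR j1 * b1 + IZR j2 * b2) + (IZR j1 * (a1 - b1) + IZR j2 * (a2 - b2)))
      by ring.
    rewrite expi_plus.
    set (x := IZR j1 * (a1 - b1) + IZR j2 * (a2 - b2)).
    replace (_ - _)%C with
      (c j1 j2 * expi (IZR j1 * b1 + IZR j2 * b2) * (expi x - 1))%C by ring.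
    rewrite !Cmod_mult, Cmod_expi, Rmult_1_r.
    pose proof (Cmod_expi_sub1 x) as H1.
    pose proof (Rabs_dot_le j1 j2 (a1 - b1) (a2 - b2)) as H2. fold x h in H2.
    specialize (HK j1 j2). pose proof (Cmod_ge_0 (c j1 j2)).
    pose proof (abs1_nonneg j1 j2) as H3.
    apply Rle_trans with (Cmod (c j1 j2) * (2 * ((1 + abs1 j1 j2) * h))).
    { apply Rmult_le_compat_l; lra. }
    replace (2 * K * h * _) with (2 * h * (K * exp (- rho * abs1 j1 j2))) by ring.
    replace (Cmod (c j1 j2) * _) with
      (2 * h * ((1 + abs1 j1 j2) * Cmod (c j1 j2))) by ring.
    apply Rmult_le_compat_l; [lra|]. eapply Rle_trans; [|apply HK].
    apply Rmult_le_compat_r; [assumption|]. simpl; nra.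
  - right; ring.
Qed.

(** The remainder is estimated term by term and summed. Being uniformly quadratic in the increment,
    it yields the derivative of the series directly, without an exchange of limit and derivative. *)
Lemma fs_taylor (c : Z -> Z -> C) : decay c ->
  exists L, 0 <= L /\ forall a1 a2 v1 v2,
    Cmod (fourier_series c (a1 + v1) (a2 + v2) - fourier_series c a1 a2
          - fourier_series (deriv_coef v1 v2 c) a1 a2)
    <= L * (Rabs v1 + Rabs v2) ^ 2.
Proof.
  intros Hc. destruct (decay_quadratic c Hc) as [K [rho [Hrho HK]]].
  assert (HK0 : 0 <= K).
  { specialize (HK 0%Z 0%Z). pose proof (Cmod_ge_0 (c 0%Z 0%Z)).
    pose proof (exp_pos (- rho * abs1 0 0)).
    pose proof (pow2_ge_0 (1 + abs1 0 0)). nra. }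
  exists (2 * K * geom_total rho ^ 2). split.
  { pose proof (pow2_ge_0 (geom_total rho)). nra. }
  intros a1 a2 v1 v2. set (h := Rabs v1 + Rabs v2).
  assert (Hh : 0 <= h).
  { unfold h. pose proof (Rabs_pos v1). pose proof (Rabs_pos v2). lra. }
  eapply Rle_trans.
  - apply (sums_bound (fun j1 j2 => (term c (a1 + v1) (a2 + v2) j1 j2 - term c a1 a2 j1 j2
        - term (deriv_coef v1 v2 c) a1 a2 j1 j2)%C) _
      (2 * K * h ^ 2) rho Hrho).
    2: { apply sums_minus; [apply sums_minus|]; apply sums_fs; try assumption.
         now apply decay_deriv. }
    intros j1 j2. unfold term, deriv_coef. rewrite !characterE.
    replace (IZR j1 * (a1 + v1) + IZR j2 * (a2 + v2)) with
      ((IZR j1 * a1 + IZR j2 * a2) + (IZR j1 * v1 + IZR j2 * v2))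
      by ring.
    rewrite expi_plus.
    set (x := IZR j1 * v1 + IZR j2 * v2).
    replace (_ - _)%C with
      (c j1 j2 * expi (IZR j1 * a1 + IZR j2 * a2) * (expi x - 1 - Ci * RtoC x))%C
      by ring.
    rewrite !Cmod_mult, Cmod_expi, Rmult_1_r.
    pose proof (Cmod_expi_taylor x) as H1.
    pose proof (Rabs_dot_le j1 j2 v1 v2) as H2. fold x h in H2.
    specialize (HK j1 j2). pose proof (Cmod_ge_0 (c j1 j2)).
    pose proof (abs1_nonneg j1 j2) as H3.
    apply Rle_trans with (Cmod (c j1 j2) * (2 * ((1 + abs1 j1 j2) * h) ^ 2)).
    { apply Rmult_le_compat_l; [lra|]. eapply Rle_trans; [apply H1|].
      apply Rmult_le_compat_l; [lra|]. apply pow_incr.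
      split; [apply Rabs_pos|assumption]. }
    replace (2 * K * h ^ 2 * _) with (2 * h ^ 2 * (K * exp (- rho * abs1 j1 j2)))
      by ring.
    replace (Cmod (c j1 j2) * _) with
      (2 * h ^ 2 * ((1 + abs1 j1 j2) ^ 2 * Cmod (c j1 j2))) by ring.
    apply Rmult_le_compat_l; [|apply HK]. pose proof (pow2_ge_0 h). lra.
  - right; ring.
Qed.

(** * Means and Fourier coefficients *)

Definition cont2 (u : R -> R -> R) : Prop :=
  forall a1 a2, continuity_2d_pt u a1 a2.

(** The zero mode as an iterated real integral; [P0E] identifies it with [P0] on continuous
    functions. *)
Definition mean (u : R -> R -> R) : R :=
  / (2 * PI) ^ 2 * RInt (fun a1 => RInt (u a1) 0 (2 * PI)) 0 (2 * PI).

Lemma cont2_continuous (u : R -> R -> R) (a1 a2 : R) :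
  cont2 u -> continuous (u a1) a2.
Proof.
  intros Hu. apply continuity_pt_filterlim. intros eps Heps.
  destruct (Hu a1 a2 (mkposreal eps Heps)) as [d Hd].
  exists d. split; [apply cond_pos|]. intros y [_ Hy].
  apply Hd; [|exact Hy]. rewrite Rminus_eq_0, Rabs_R0. apply cond_pos.
Qed.

Lemma cont2_ex_RInt (u : R -> R -> R) (a1 a b : R) :
  cont2 u -> ex_RInt (u a1) a b.
Proof.
  intros Hu. apply (ex_RInt_continuous (V := R_CompleteNormedModule)).
  intros; now apply cont2_continuous.
Qed.

Lemma two_PI_pos : 0 < 2 * PI.
Proof. pose proof PI_RGT_0. lra. Qed.

Lemma continuous_RInt_cont2 (u : R -> R -> R) (a1 : R) : cont2 u ->
  continuous (fun x => RInt (u x) 0 (2 * PI)) a1.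
Proof.
  intros Hu. pose proof two_PI_pos as HPI.
  apply continuity_pt_filterlim. intros eps Heps.
  (* The window of radius 1 around [a1] makes the domain a compact rectangle; integrating the
     tolerance over a period then gives [eps / 2], hence a strict bound. *)
  destruct (uniform_continuity_2d u (a1 - 1) (a1 + 1) 0 (2 * PI)
    (fun x y _ _ => Hu x y) (mkposreal (eps / (2 * (2 * PI))) ltac:(apply Rdiv_lt_0_compat; lra)))
    as [d Hd].
  exists (Rmin d 1). split; [apply Rmin_glb_lt; [apply cond_pos|lra]|].
  intros x [_ Hx]. simpl in Hx |- *. unfold R_dist in *.
  assert (Hx1 : Rabs (x - a1) < d) by (eapply Rlt_le_trans; [exact Hx|apply Rmin_l]).
  assert (Hx2 : Rabs (x - a1) < 1) by (eapply Rlt_le_trans; [exact Hx|apply Rmin_r]).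
  apply Rabs_def2 in Hx2.
  assert (E : RInt (fun y => u x y - u a1 y) 0 (2 * PI) =
              RInt (u x) 0 (2 * PI) - RInt (u a1) 0 (2 * PI)).
  { apply (RInt_minus (V := R_CompleteNormedModule));
      apply cont2_ex_RInt; assumption. }
  rewrite <- E.
  apply Rle_lt_trans with ((2 * PI - 0) * (eps / (2 * (2 * PI)))).
  - apply abs_RInt_le_const; [lra| |].
    + apply (ex_RInt_minus (V := R_NormedModule)); apply cont2_ex_RInt; assumption.
    + intros t Ht. left. apply Hd; try lra.
      rewrite Rminus_eq_0, Rabs_R0. apply cond_pos.
  - replace ((2 * PI - 0) * (eps / (2 * (2 * PI)))) with (eps / 2) by (field; lra).
    lra.
Qed.

Lemma cont2_ex_RInt2 (u : R -> R -> R) (a b : R) : cont2 u ->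
  ex_RInt (fun a1 => RInt (u a1) 0 (2 * PI)) a b.
Proof.
  intros Hu. apply (ex_RInt_continuous (V := R_CompleteNormedModule)).
  intros; now apply continuous_RInt_cont2.
Qed.

Lemma RInt_Rplus (f g : R -> R) (a b : R) : ex_RInt f a b -> ex_RInt g a b ->
  RInt (fun x => f x + g x) a b = RInt f a b + RInt g a b.
Proof. apply (RInt_plus (V := R_CompleteNormedModule)). Qed.

Lemma RInt_Rscal (f : R -> R) (z a b : R) : ex_RInt f a b ->
  RInt (fun x => z * f x) a b = z * RInt f a b.
Proof. apply (RInt_scal (V := R_CompleteNormedModule)). Qed.

Lemma RInt_Rconst (z a b : R) : RInt (fun _ => z) a b = (b - a) * z.
Proof. apply (RInt_const (V := R_CompleteNormedModule)). Qed.

Lemma mean_plus (u v : R -> R -> R) : cont2 u -> cont2 v ->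
  mean (fun a1 a2 => u a1 a2 + v a1 a2) = mean u + mean v.
Proof.
  intros Hu Hv. unfold mean.
  rewrite (RInt_ext _ (fun a1 => RInt (u a1) 0 (2 * PI) + RInt (v a1) 0 (2 * PI))).
  - rewrite RInt_Rplus by (apply cont2_ex_RInt2; assumption). ring.
  - intros x _. apply RInt_Rplus; apply cont2_ex_RInt; assumption.
Qed.

Lemma mean_scal (z : R) (u : R -> R -> R) : cont2 u ->
  mean (fun a1 a2 => z * u a1 a2) = z * mean u.
Proof.
  intros Hu. unfold mean.
  rewrite (RInt_ext _ (fun a1 => z * RInt (u a1) 0 (2 * PI))).
  - rewrite RInt_Rscal by (apply cont2_ex_RInt2; assumption). ring.
  - intros x _. apply RInt_Rscal, cont2_ex_RInt, Hu.
Qed.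

Lemma mean_const (z : R) : mean (fun _ _ => z) = z.
Proof.
  unfold mean. rewrite (RInt_ext _ (fun _ => (2 * PI - 0) * z)).
  - rewrite RInt_Rconst. field. apply PI_neq0.
  - intros x _. apply RInt_Rconst.
Qed.

Lemma mean_abs_le (u : R -> R -> R) (B : R) : cont2 u ->
  (forall a1 a2, Rabs (u a1 a2) <= B) -> Rabs (mean u) <= B.
Proof.
  intros Hu HB. pose proof two_PI_pos as HPI. unfold mean.
  assert (Hpos : 0 < / (2 * PI) ^ 2) by (apply Rinv_0_lt_compat, pow_lt, HPI).
  rewrite Rabs_mult, (Rabs_right (/ _)) by lra.
  apply Rle_trans with (/ (2 * PI) ^ 2 * ((2 * PI - 0) * ((2 * PI - 0) * B))).
  - apply Rmult_le_compat_l; [lra|].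
    apply abs_RInt_le_const; [lra|now apply cont2_ex_RInt2|].
    intros t _. apply abs_RInt_le_const; [lra|now apply cont2_ex_RInt|].
    intros; apply HB.
  - right. field. apply PI_neq0.
Qed.

(** * Means of complex-valued functions *)

Definition ccont (U : R -> R -> C) : Prop :=
  cont2 (fun a1 a2 => Re (U a1 a2)) /\ cont2 (fun a1 a2 => Im (U a1 a2)).

Definition cmean (U : R -> R -> C) : C :=
  (mean (fun a1 a2 => Re (U a1 a2)), mean (fun a1 a2 => Im (U a1 a2))).

Lemma ccont_plus (U V : R -> R -> C) : ccont U -> ccont V ->
  ccont (fun a1 a2 => (U a1 a2 + V a1 a2)%C).
Proof.
  intros [H1 H2] [H3 H4]; split; intros a1 a2; simpl;
    apply continuity_2d_pt_plus; auto.
Qed.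

Lemma ccont_mult (U V : R -> R -> C) : ccont U -> ccont V ->
  ccont (fun a1 a2 => (U a1 a2 * V a1 a2)%C).
Proof.
  intros [H1 H2] [H3 H4]; split; intros a1 a2; simpl.
  - apply continuity_2d_pt_minus; apply continuity_2d_pt_mult;
      [apply H1|apply H3|apply H2|apply H4].
  - apply continuity_2d_pt_plus; apply continuity_2d_pt_mult;
      [apply H1|apply H4|apply H2|apply H3].
Qed.

Lemma ccont_const (z : C) : ccont (fun _ _ => z).
Proof. split; intros a1 a2; apply continuity_2d_pt_const. Qed.

Lemma ccont_RtoC (u : R -> R -> R) : cont2 u -> ccont (fun a1 a2 => RtoC (u a1 a2)).
Proof. intros Hu; split; [exact Hu|intros a1 a2; apply (continuity_2d_pt_const a1 a2 0)]. Qed.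

Lemma ccont_conj (U : R -> R -> C) : ccont U ->
  ccont (fun a1 a2 => Cconj (U a1 a2)).
Proof.
  intros [H1 H2]; split; [exact H1|].
  intros a1 a2. simpl. apply continuity_2d_pt_opp. apply H2.
Qed.

Lemma ccont_lipschitz (U : R -> R -> C) (L : R) : 0 <= L ->
  (forall a1 a2 b1 b2, Cmod (U a1 a2 - U b1 b2)
     <= L * (Rabs (a1 - b1) + Rabs (a2 - b2))) -> ccont U.
Proof.
  intros HL HU.
  assert (Hd : forall a1 a2 (eps : posreal), exists delta : posreal,
    forall b1 b2, Rabs (b1 - a1) < delta -> Rabs (b2 - a2) < delta ->
    Cmod (U b1 b2 - U a1 a2) < eps).
  { intros a1 a2 eps. pose proof (cond_pos eps) as He.
    assert (Hp : 0 < eps / (2 * (L + 1))) by (apply Rdiv_lt_0_compat; lra).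
    exists (mkposreal _ Hp). simpl. intros b1 b2 H1 H2.
    eapply Rle_lt_trans; [apply HU|].
    apply Rle_lt_trans with (L * (2 * (eps / (2 * (L + 1))))).
    - apply Rmult_le_compat_l; lra.
    - apply Rlt_le_trans with ((L + 1) * (2 * (eps / (2 * (L + 1))))).
      + apply Rmult_lt_compat_r; lra.
      + right. field. lra. }
  split; intros a1 a2 eps; destruct (Hd a1 a2 eps) as [d H]; exists d;
    intros b1 b2 H1 H2; (eapply Rle_lt_trans; [|apply (H b1 b2 H1 H2)]).
  - apply (re_le_Cmod (U b1 b2 - U a1 a2)).
  - apply (im_le_Cmod (U b1 b2 - U a1 a2)).
Qed.

Lemma ccont_expi (x1 x2 y : R) : ccont (fun a1 a2 => expi (x1 * a1 + x2 * a2 + y)).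
Proof.
  assert (Hl : forall a1 a2, continuity_2d_pt (fun b1 b2 => x1 * b1 + x2 * b2 + y) a1 a2).
  { intros a1 a2.
    apply continuity_2d_pt_plus; [|apply continuity_2d_pt_const].
    apply continuity_2d_pt_plus; apply continuity_2d_pt_mult;
      try apply continuity_2d_pt_const;
      [apply continuity_2d_pt_id1|apply continuity_2d_pt_id2]. }
  split; intros a1 a2; simpl.
  - apply (continuity_1d_2d_pt_comp cos); [apply continuity_cos|apply Hl].
  - apply (continuity_1d_2d_pt_comp sin); [apply continuity_sin|apply Hl].
Qed.

Lemma ccont_character (j1 j2 : Z) : ccont (character j1 j2).
Proof.
  destruct (ccont_expi (IZR j1) (IZR j2) 0) as [H1 H2].
  replace (character j1 j2) with
    (fun a1 a2 => expi (IZR j1 * a1 + IZR j2 * a2 + 0)); [now split|].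
  extensionality a1; extensionality a2. now rewrite Rplus_0_r.
Qed.

Lemma ccont_fs (c : Z -> Z -> C) : decay c -> ccont (fourier_series c).
Proof.
  intros Hc. destruct (fs_lipschitz c Hc) as [L [HL H]].
  now apply ccont_lipschitz with L.
Qed.

Lemma cmean_plus (U V : R -> R -> C) : ccont U -> ccont V ->
  cmean (fun a1 a2 => (U a1 a2 + V a1 a2)%C) = (cmean U + cmean V)%C.
Proof.
  intros [H1 H2] [H3 H4].
  apply injective_projections;
    [exact (mean_plus _ _ H1 H3)|exact (mean_plus _ _ H2 H4)].
Qed.

Lemma cmean_scal (z : C) (U : R -> R -> C) : ccont U ->
  cmean (fun a1 a2 => (z * U a1 a2)%C) = (z * cmean U)%C.
Proof.
  intros [H1 H2]. destruct z as [x y].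
  assert (Hs : forall t u, cont2 u -> cont2 (fun a1 a2 => t * u a1 a2)).
  { intros t u Hu a1 a2. apply continuity_2d_pt_mult; [apply continuity_2d_pt_const|apply Hu]. }
  unfold cmean. apply injective_projections; simpl fst; simpl snd; symmetry.
  - replace (fun a1 a2 => x * _ - y * _) with
      (fun a1 a2 => x * Re (U a1 a2) + (- y) * Im (U a1 a2))
      by (extensionality a1; extensionality a2; unfold Re, Im; ring).
    rewrite (mean_plus (fun a1 a2 => x * Re (U a1 a2)) (fun a1 a2 => - y * Im (U a1 a2)))
      by (apply Hs; assumption).
    rewrite (mean_scal x (fun a1 a2 => Re (U a1 a2))) by assumption.
    rewrite (mean_scal (- y) (fun a1 a2 => Im (U a1 a2))) by assumption.
    ring.
  - etransitivity; [|symmetry; apply (mean_plus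
      (fun a1 a2 => x * Im (U a1 a2)) (fun a1 a2 => y * Re (U a1 a2)));
      apply Hs; assumption].
    rewrite (mean_scal x (fun a1 a2 => Im (U a1 a2))) by assumption.
    rewrite (mean_scal y (fun a1 a2 => Re (U a1 a2))) by assumption.
    reflexivity.
Qed.

(** Real and imaginary parts are estimated separately, whence the factor 2, which reappears in every
    later coefficient bound. *)
Lemma cmean_bound (U : R -> R -> C) (B : R) : ccont U ->
  (forall a1 a2, Cmod (U a1 a2) <= B) -> Cmod (cmean U) <= 2 * B.
Proof.
  intros [H1 H2] HB.
  eapply Rle_trans; [apply Cmod_le_Re_Im|]. unfold cmean; simpl.
  assert (Rabs (mean (fun a1 a2 => Re (U a1 a2))) <= B).
  { apply mean_abs_le; [assumption|]. intros.
    eapply Rle_trans; [apply re_le_Cmod|apply HB]. }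
  assert (Rabs (mean (fun a1 a2 => Im (U a1 a2))) <= B).
  { apply mean_abs_le; [assumption|]. intros.
    eapply Rle_trans; [apply im_le_Cmod|apply HB]. }
  lra.
Qed.

(** * Orthogonality of the characters *)

Definition delta0 (j1 j2 : Z) : C :=
  if Z.eq_dec j1 0 then if Z.eq_dec j2 0 then RtoC 1 else RtoC 0 else RtoC 0.

Lemma RInt_cos_lin (x y : R) : x <> 0 -> sin (x * (2 * PI) + y) = sin y ->
  RInt (fun a => cos (x * a + y)) 0 (2 * PI) = 0.
Proof.
  intros Hx Hs.
  rewrite (is_RInt_unique _ _ _
    (sin (x * (2 * PI) + y) / x - sin (x * 0 + y) / x)).
  - rewrite Hs, Rmult_0_r, Rplus_0_l. apply Rminus_eq_0.
  - apply (is_RInt_derive (fun a => sin (x * a + y) / x)).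
    + intros a _. auto_derive; [easy|]. field. assumption.
    + intros a _. apply continuity_pt_filterlim.
      apply derivable_continuous_pt. exists (- sin (x * a + y) * x).
      apply is_derive_Reals. auto_derive; [easy|ring].
Qed.

Lemma RInt_sin_lin (x y : R) : x <> 0 -> cos (x * (2 * PI) + y) = cos y ->
  RInt (fun a => sin (x * a + y)) 0 (2 * PI) = 0.
Proof.
  intros Hx Hs.
  rewrite (is_RInt_unique _ _ _
    (- cos (x * (2 * PI) + y) / x - - cos (x * 0 + y) / x)).
  - rewrite Hs, Rmult_0_r, Rplus_0_l. apply Rminus_eq_0.
  - apply (is_RInt_derive (fun a => - cos (x * a + y) / x)).
    + intros a _. auto_derive; [easy|]. field. assumption.
    + intros a _. apply continuity_pt_filterlim.
      apply derivable_continuous_pt. exists (cos (x * a + y) * x).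
      apply is_derive_Reals. auto_derive; [easy|ring].
Qed.

Lemma expi_period_plus (j : Z) (y : R) : expi (IZR j * (2 * PI) + y) = expi y.
Proof. rewrite expi_plus, expi_period. ring. Qed.

Lemma cmean_character (j1 j2 : Z) : cmean (character j1 j2) = delta0 j1 j2.
Proof.
  unfold delta0, cmean, mean, character. simpl Re; simpl Im.
  assert (Hp : forall j y, cos (IZR j * (2 * PI) + y) = cos y /\
                           sin (IZR j * (2 * PI) + y) = sin y).
  { intros j y. pose proof (expi_period_plus j y) as E. now injection E. }
  assert (Hj : forall j, j <> 0%Z -> IZR j <> 0) by (intros j Hj0; now apply not_0_IZR).
  (* For [j2] nonzero the inner integral vanishes already; for [j2 = 0] the integrand does not
     depend on [a2] and the outer integral decides. *)
  destruct (Z.eq_dec j2 0) as [->|H2].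
  - assert (Hc : forall x, RInt (fun a2 => cos (IZR j1 * x + 0 * a2)) 0 (2 * PI)
                = 2 * PI * cos (IZR j1 * x + 0)).
    { intros x. rewrite (RInt_ext _ (fun _ => cos (IZR j1 * x + 0)))
        by (intros; f_equal; ring).
      rewrite RInt_Rconst. ringR. }
    assert (Hs : forall x, RInt (fun a2 => sin (IZR j1 * x + 0 * a2)) 0 (2 * PI)
                = 2 * PI * sin (IZR j1 * x + 0)).
    { intros x. rewrite (RInt_ext _ (fun _ => sin (IZR j1 * x + 0)))
        by (intros; f_equal; ring).
      rewrite RInt_Rconst. ringR. }
    destruct (Z.eq_dec j1 0) as [->|H1].
    + apply injective_projections; simpl.
      * rewrite (RInt_ext _ (fun _ => 2 * PI)).
        { rewrite RInt_Rconst. field. apply PI_neq0. }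
        intros x _. etransitivity; [apply Hc|].
        rewrite Rmult_0_l, Rplus_0_l, cos_0. ringR.
      * rewrite (RInt_ext _ (fun _ => 0)).
        { rewrite RInt_Rconst. ringR. }
        intros x _. etransitivity; [apply Hs|].
        rewrite Rmult_0_l, Rplus_0_l, sin_0. ringR.
    + assert (Ec : forall y, ex_RInt (fun x => cos (IZR j1 * x + y)) 0 (2 * PI)).
      { intros y. apply (ex_RInt_continuous (V := R_CompleteNormedModule)).
        intros a _. apply continuity_pt_filterlim.
        apply derivable_continuous_pt. exists (- sin (IZR j1 * a + y) * IZR j1).
        apply is_derive_Reals. auto_derive; [easy|ring]. }
      assert (Es : forall y, ex_RInt (fun x => sin (IZR j1 * x + y)) 0 (2 * PI)).
      { intros y. apply (ex_RInt_continuous (V := R_CompleteNormedModule)).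
        intros a _. apply continuity_pt_filterlim.
        apply derivable_continuous_pt. exists (cos (IZR j1 * a + y) * IZR j1).
        apply is_derive_Reals. auto_derive; [easy|ring]. }
      apply injective_projections; simpl.
      * rewrite (RInt_ext _ (fun x => 2 * PI * cos (IZR j1 * x + 0))).
        { rewrite RInt_Rscal by apply Ec.
          rewrite RInt_cos_lin by (try apply Hp; now apply Hj).
          ring. }
        intros x _. apply Hc.
      * rewrite (RInt_ext _ (fun x => 2 * PI * sin (IZR j1 * x + 0))).
        { rewrite RInt_Rscal by apply Es.
          rewrite RInt_sin_lin by (try apply Hp; now apply Hj).
          ring. }
        intros x _. apply Hs.
  - assert (Hz : forall f : R -> R, (forall x, f x = 0) ->
      / (2 * PI) ^ 2 * RInt f 0 (2 * PI) = 0).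
    { intros f Hf. rewrite (RInt_ext f (fun _ => 0)) by (intros; apply Hf).
      rewrite RInt_Rconst. ringR. }
    replace (if Z.eq_dec j1 0 then RtoC 0 else RtoC 0) with (RtoC 0)
      by now destruct (Z.eq_dec j1 0).
    unfold RtoC. f_equal; apply Hz; intros x.
    + rewrite (RInt_ext _ (fun a2 => cos (IZR j2 * a2 + IZR j1 * x)))
        by (intros; f_equal; ring).
      apply RInt_cos_lin; [now apply Hj|apply Hp].
    + rewrite (RInt_ext _ (fun a2 => sin (IZR j2 * a2 + IZR j1 * x)))
        by (intros; f_equal; ring).
      apply RInt_sin_lin; [now apply Hj|apply Hp].
Qed.

(** Coefficients of complex-valued functions: [1 / y] and its approximations are not real, so
    [fourier_coef] does not apply to them. *)
Definition ccoef (U : R -> R -> C) (j1 j2 : Z) : C :=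
  cmean (fun a1 a2 => (Cconj (character j1 j2 a1 a2) * U a1 a2)%C).

Lemma ccont_conj_character_mult (U : R -> R -> C) (j1 j2 : Z) : ccont U ->
  ccont (fun a1 a2 => (Cconj (character j1 j2 a1 a2) * U a1 a2)%C).
Proof. intros HU. apply ccont_mult; [apply ccont_conj, ccont_character|assumption]. Qed.

Lemma ccoef_plus (U V : R -> R -> C) (j1 j2 : Z) : ccont U -> ccont V ->
  ccoef (fun a1 a2 => (U a1 a2 + V a1 a2)%C) j1 j2 = (ccoef U j1 j2 + ccoef V j1 j2)%C.
Proof.
  intros HU HV. unfold ccoef.
  rewrite <- cmean_plus by (apply ccont_conj_character_mult; assumption).
  f_equal. extensionality a1; extensionality a2. ring.
Qed.

Lemma ccoef_scal (z : C) (U : R -> R -> C) (j1 j2 : Z) : ccont U ->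
  ccoef (fun a1 a2 => (z * U a1 a2)%C) j1 j2 = (z * ccoef U j1 j2)%C.
Proof.
  intros HU. unfold ccoef.
  rewrite <- cmean_scal by (apply ccont_conj_character_mult; assumption).
  f_equal. extensionality a1; extensionality a2. ring.
Qed.

Lemma ccoef_bound (U : R -> R -> C) (B : R) (j1 j2 : Z) : ccont U ->
  (forall a1 a2, Cmod (U a1 a2) <= B) -> Cmod (ccoef U j1 j2) <= 2 * B.
Proof.
  intros HU HB. apply cmean_bound; [now apply ccont_conj_character_mult|].
  intros a1 a2. rewrite Cmod_mult, Cmod_conj, characterE, Cmod_expi, Rmult_1_l.
  apply HB.
Qed.

Lemma ccoef_character (l1 l2 j1 j2 : Z) :
  ccoef (character l1 l2) j1 j2 = delta0 (l1 - j1) (l2 - j2).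
Proof.
  rewrite <- cmean_character. unfold ccoef. f_equal.
  extensionality a1; extensionality a2. rewrite !characterE, expi_conj, <- expi_plus.
  f_equal. rewrite !minus_IZR. ring.
Qed.

Lemma sym_sum_delta (f : Z -> C) (l : Z) (N : nat) :
  sym_sum (fun j => if Z.eq_dec (j - l) 0 then f j else RtoC 0) N =
  if Z_le_dec (Z.abs l) (Z.of_nat N) then f l else RtoC 0.
Proof.
  induction N as [|N IH].
  - rewrite sym_sum_0. destruct (Z.eq_dec (0 - l) 0), (Z_le_dec (Z.abs l) (Z.of_nat 0));
      try lia; [|reflexivity]. now replace l with 0%Z by lia.
  - rewrite sym_sum_SC, IH. cbv beta.
    destruct (Z_le_dec (Z.abs l) (Z.of_nat N)), (Z_le_dec (Z.abs l) (Z.of_nat (S N))),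
      (Z.eq_dec (Z.of_nat (S N) - l) 0), (Z.eq_dec (- Z.of_nat (S N) - l) 0);
      try lia; try ringC.
    + replace l with (Z.of_nat (S N)) by lia. ringC.
    + replace l with (- Z.of_nat (S N))%Z by lia. ringC.
Qed.

Lemma square_sum_delta (f : Z -> Z -> C) (l1 l2 : Z) (N : nat) :
  (Z.abs l1 <= Z.of_nat N)%Z -> (Z.abs l2 <= Z.of_nat N)%Z ->
  square_sum (fun j1 j2 => (delta0 (j1 - l1) (j2 - l2) * f j1 j2)%C) N = f l1 l2.
Proof.
  intros H1 H2. rewrite square_sumE.
  rewrite (sym_sum_ext _ (fun j1 => if Z.eq_dec (j1 - l1) 0 then f j1 l2 else RtoC 0)).
  - rewrite sym_sum_delta. now destruct (Z_le_dec (Z.abs l1) (Z.of_nat N)).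
  - intros j1.
    rewrite (sym_sum_ext _ (fun j2 => if Z.eq_dec (j2 - l2) 0 then
      (if Z.eq_dec (j1 - l1) 0 then f j1 j2 else RtoC 0) else RtoC 0)).
    + rewrite sym_sum_delta. now destruct (Z_le_dec (Z.abs l2) (Z.of_nat N)).
    + intros j2. unfold delta0.
      destruct (Z.eq_dec (j1 - l1) 0), (Z.eq_dec (j2 - l2) 0); ringC.
Qed.

Lemma ccont_sym_sum (F : Z -> R -> R -> C) (N : nat) : (forall j, ccont (F j)) ->
  ccont (fun a1 a2 => sym_sum (fun j => F j a1 a2) N).
Proof.
  intros HF. induction N as [|N IH].
  - replace (fun a1 a2 => _) with (F 0%Z); [apply HF|].
    extensionality a1; extensionality a2. now rewrite sym_sum_0.
  - replace (fun a1 a2 => _) with (fun a1 a2 => (sym_sum (fun j => F j a1 a2) N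
      + (F (Z.of_nat (S N)) a1 a2 + F (- Z.of_nat (S N))%Z a1 a2))%C).
    + apply ccont_plus; [apply IH|]. now apply ccont_plus.
    + extensionality a1; extensionality a2. now rewrite sym_sum_SC.
Qed.

Lemma ccoef_sym_sum (F : Z -> R -> R -> C) (N : nat) (j1 j2 : Z) :
  (forall j, ccont (F j)) ->
  ccoef (fun a1 a2 => sym_sum (fun j => F j a1 a2) N) j1 j2 =
  sym_sum (fun j => ccoef (F j) j1 j2) N.
Proof.
  intros HF. induction N as [|N IH].
  - rewrite sym_sum_0. f_equal. extensionality a1; extensionality a2.
    now rewrite sym_sum_0.
  - rewrite sym_sum_SC, <- IH, <- !ccoef_plus; try apply HF.
    + f_equal. extensionality a1; extensionality a2. now rewrite sym_sum_SC.
    + now apply ccont_sym_sum.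
    + now apply ccont_plus.
Qed.

Lemma ccoef_square_sum (c : Z -> Z -> C) (N : nat) (j1 j2 : Z) :
  (Z.abs j1 <= Z.of_nat N)%Z -> (Z.abs j2 <= Z.of_nat N)%Z ->
  ccoef (fun a1 a2 => square_sum (term c a1 a2) N) j1 j2 = c j1 j2.
Proof.
  intros H1 H2.
  assert (Ht : forall l1 l2, ccont (fun a1 a2 => term c a1 a2 l1 l2)).
  { intros l1 l2. apply ccont_mult; [apply ccont_const|apply ccont_character]. }
  transitivity (square_sum (fun l1 l2 => ccoef (fun a1 a2 => term c a1 a2 l1 l2) j1 j2) N).
  - rewrite square_sumE, (sym_sum_ext _ (fun l1 =>
      ccoef (fun a1 a2 => sym_sum (fun l2 => term c a1 a2 l1 l2) N) j1 j2)).
    + rewrite <- ccoef_sym_sum; [reflexivity|]. intros l1. now apply ccont_sym_sum.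
    + intros l1. symmetry. now apply ccoef_sym_sum.
  - rewrite <- (square_sum_delta c j1 j2 N H1 H2). f_equal.
    extensionality l1; extensionality l2. unfold term.
    rewrite ccoef_scal, ccoef_character by apply ccont_character. ring.
Qed.

(** A square sum has exactly the coefficient [c j1 j2] once the square contains [(j1, j2)], and
    uniform convergence passes to the integral. Uniqueness of coefficients follows. *)
Lemma ccoef_fs (c : Z -> Z -> C) (j1 j2 : Z) : decay c ->
  ccoef (fourier_series c) j1 j2 = c j1 j2.
Proof.
  intros Hc.
  assert (Hd : forall eps, 0 < eps -> Cmod (c j1 j2 - ccoef (fourier_series c) j1 j2) <= eps).
  { intros eps He. destruct (fs_uniform c (eps / 2) Hc ltac:(lra)) as [N0 HN].
    set (N := max N0 (max (Z.to_nat (Z.abs j1)) (Z.to_nat (Z.abs j2)))).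
    specialize (HN N ltac:(lia)).
    assert (HS : ccont (fun a1 a2 => square_sum (term c a1 a2) N)).
    { apply (ccont_sym_sum (fun j1 a1 a2 => sym_sum (term c a1 a2 j1) N)).
      intros l1. apply (ccont_sym_sum (fun j2 a1 a2 => term c a1 a2 l1 j2)).
      intros l2. apply ccont_mult; [apply ccont_const|apply ccont_character]. }
    rewrite <- (ccoef_square_sum c N j1 j2) by lia.
    replace (_ - _)%C with (ccoef (fun a1 a2 => square_sum (term c a1 a2) N
      + (- (1)) * fourier_series c a1 a2)%C j1 j2).
    - replace eps with (2 * (eps / 2)) by field. apply ccoef_bound.
      + apply ccont_plus; [assumption|].
        apply ccont_mult; [apply ccont_const|now apply ccont_fs].
      + intros a1 a2. left. replace (_ + _)%C with
          (square_sum (term c a1 a2) N - fourier_series c a1 a2)%C by ring. apply HN.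
    - rewrite (ccoef_plus _ (fun a1 a2 => (- (1)) * fourier_series c a1 a2)%C).
      + rewrite ccoef_scal by now apply ccont_fs. ring.
      + assumption.
      + apply ccont_mult; [apply ccont_const|now apply ccont_fs]. }
  assert (H0 : Cmod (c j1 j2 - ccoef (fourier_series c) j1 j2) = 0).
  { apply Rle_antisym; [|apply Cmod_ge_0]. apply le_epsilon. intros eps He.
    rewrite Rplus_0_l. now apply Hd. }
  apply Cmod_eq_0 in H0.
  replace (c j1 j2) with ((c j1 j2 - ccoef (fourier_series c) j1 j2)
    + ccoef (fourier_series c) j1 j2)%C by ring.
  rewrite H0. ring.
Qed.

Lemma RInt_pair (f : R -> C) (a b : R) :
  ex_RInt (fun x => Re (f x)) a b -> ex_RInt (fun x => Im (f x)) a b ->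
  RInt (V := C_R_CompleteNormedModule) f a b =
  (RInt (fun x => Re (f x)) a b, RInt (fun x => Im (f x)) a b).
Proof.
  intros H1 H2. apply is_RInt_unique.
  apply (is_RInt_fct_extend_pair (U := R_NormedModule) (V := R_NormedModule) f);
    now apply (RInt_correct (V := R_CompleteNormedModule)).
Qed.

Lemma fourier_coefE (u : R -> R -> R) (j1 j2 : Z) : cont2 u ->
  fourier_coef u j1 j2 = ccoef (fun a1 a2 => RtoC (u a1 a2)) j1 j2.
Proof.
  intros Hu. unfold fourier_coef, ccoef, cmean.
  replace (fun a1 a2 => Re (Cconj (character j1 j2 a1 a2) * RtoC (u a1 a2))) with
    (fun a1 a2 => Re (RtoC (u a1 a2) * Cconj (character j1 j2 a1 a2)))
    by (extensionality a1; extensionality a2; f_equal; ring).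
  replace (fun a1 a2 => Im (Cconj (character j1 j2 a1 a2) * RtoC (u a1 a2))) with
    (fun a1 a2 => Im (RtoC (u a1 a2) * Cconj (character j1 j2 a1 a2)))
    by (extensionality a1; extensionality a2; f_equal; ring).
  destruct (ccont_mult _ _ (ccont_RtoC u Hu) (ccont_conj _ (ccont_character j1 j2)))
    as [H1 H2].
  set (U := fun a1 a2 => (RtoC (u a1 a2) * Cconj (character j1 j2 a1 a2))%C) in *.
  rewrite (RInt_ext (V := C_R_CompleteNormedModule) _ (fun a1 =>
    (RInt (fun a2 => Re (U a1 a2)) 0 (2 * PI), RInt (fun a2 => Im (U a1 a2)) 0 (2 * PI)))).
  - rewrite RInt_pair.
    + unfold mean. apply injective_projections; simpl; unfold Re, Im; ring.
    + now apply (cont2_ex_RInt2 (fun a1 a2 => Re (U a1 a2))).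
    + now apply (cont2_ex_RInt2 (fun a1 a2 => Im (U a1 a2))).
  - intros x _. apply (RInt_pair (U x)).
    + now apply (cont2_ex_RInt (fun a1 a2 => Re (U a1 a2))).
    + now apply (cont2_ex_RInt (fun a1 a2 => Im (U a1 a2))).
Qed.

(** * Torus operators on Fourier series *)

(** The working class of functions. The equation in [C] also says that the series has real values,
    from which [rep_conj] deduces the symmetry of the coefficients. *)
Definition rep (u : R -> R -> R) (c : Z -> Z -> C) : Prop :=
  decay c /\ forall a1 a2, RtoC (u a1 a2) = fourier_series c a1 a2.

Lemma rep_Re (u : R -> R -> R) (c : Z -> Z -> C) (a1 a2 : R) :
  rep u c -> u a1 a2 = Re (fourier_series c a1 a2).
Proof. intros [_ Hu]. now rewrite <- Hu. Qed.

Lemma rep_cont2 (u : R -> R -> R) (c : Z -> Z -> C) : rep u c -> cont2 u.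
Proof.
  intros Hu. destruct (ccont_fs c (proj1 Hu)) as [H1 _].
  replace u with (fun a1 a2 => Re (fourier_series c a1 a2)); [exact H1|].
  extensionality a1; extensionality a2. now rewrite <- (rep_Re u c).
Qed.

Lemma rep_coef (u : R -> R -> R) (c : Z -> Z -> C) (j1 j2 : Z) :
  rep u c -> fourier_coef u j1 j2 = c j1 j2.
Proof.
  intros Hu. rewrite fourier_coefE by now apply rep_cont2 with c.
  rewrite <- (ccoef_fs c j1 j2) by apply Hu. f_equal.
  extensionality a1; extensionality a2. apply Hu.
Qed.

Lemma rep_unique (u : R -> R -> R) (c d : Z -> Z -> C) (j1 j2 : Z) :
  rep u c -> rep u d -> c j1 j2 = d j1 j2.
Proof. intros Hc Hd. now rewrite <- (rep_coef u c), (rep_coef u d). Qed.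

(** A real function equals its conjugate, whose coefficients are the reflected conjugates;
    uniqueness identifies the two families. *)
Lemma rep_conj (u : R -> R -> R) (c : Z -> Z -> C) (j1 j2 : Z) :
  rep u c -> c (- j1)%Z (- j2)%Z = Cconj (c j1 j2).
Proof.
  intros Hu.
  rewrite (rep_unique u c (fun j1 j2 => Cconj (c (- j1)%Z (- j2)%Z)) (-j1) (-j2) Hu).
  - now rewrite !Z.opp_involutive.
  - split; [apply decay_conj_opp, Hu|]. intros a1 a2.
    rewrite <- fs_conj, <- (proj2 Hu) by apply Hu.
    apply injective_projections; simpl; ring.
Qed.

Lemma rep_periodic (u : R -> R -> R) (c : Z -> Z -> C) : rep u c -> periodic2 u.
Proof.
  intros Hu a1 a2. rewrite !(rep_Re u c) by assumption.
  now destruct (fs_periodic c a1 a2) as [-> ->].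
Qed.

Lemma rep_of_symmetric (c : Z -> Z -> C) : decay c ->
  (forall j1 j2, c (- j1)%Z (- j2)%Z = Cconj (c j1 j2)) ->
  rep (fun a1 a2 => Re (fourier_series c a1 a2)) c.
Proof.
  intros Hc Hs. split; [assumption|]. intros a1 a2.
  assert (E : Cconj (fourier_series c a1 a2) = fourier_series c a1 a2).
  { rewrite fs_conj by assumption. f_equal. extensionality j1; extensionality j2.
    now rewrite Hs, Cconj_conj. }
  destruct (fourier_series c a1 a2) as [x y]. injection E as Ey.
  apply injective_projections; simpl; lra.
Qed.

Lemma rep_scal (r : R) (u : R -> R -> R) (c : Z -> Z -> C) : rep u c ->
  rep (fun a1 a2 => r * u a1 a2) (fun j1 j2 => (RtoC r * c j1 j2)%C).
Proof.
  intros Hu. split; [apply decay_scal, Hu|]. intros a1 a2.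
  now rewrite fs_scal, RtoC_mult, (proj2 Hu) by apply Hu.
Qed.

Lemma rep_shift (s1 s2 : R) (u : R -> R -> R) (c : Z -> Z -> C) : rep u c ->
  rep (fun a1 a2 => u (a1 - s1) (a2 - s2)) (shift_coef s1 s2 c).
Proof.
  intros Hu. split; [apply decay_shift, Hu|]. intros a1 a2.
  rewrite <- fs_shift by apply Hu. apply Hu.
Qed.

Lemma is_derive_quadratic (f : R -> R) (x l L : R) : 0 <= L ->
  (forall h, Rabs (f (x + h) - f x - h * l) <= L * Rabs h ^ 2) -> is_derive f x l.
Proof.
  intros HL Hf. apply is_derive_Reals. intros eps Heps.
  assert (Hp : 0 < eps / (L + 1)) by (apply Rdiv_lt_0_compat; lra).
  exists (mkposreal _ Hp). simpl. intros h Hh0 Hh.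
  replace ((f (x + h) - f x) / h - l) with ((f (x + h) - f x - h * l) / h)
    by (field; assumption).
  rewrite Rabs_div by assumption.
  assert (Ha : 0 < Rabs h) by now apply Rabs_pos_lt.
  apply Rle_lt_trans with (L * Rabs h).
  - apply Rle_div_l; [assumption|]. eapply Rle_trans; [apply Hf|]. right; ring.
  - apply Rle_lt_trans with ((L + 1) * Rabs h); [apply Rmult_le_compat_r; lra|].
    apply Rlt_div_r in Hh; lra.
Qed.

Lemma deriv_coef_scal (h v1 v2 : R) (c : Z -> Z -> C) :
  deriv_coef (h * v1) (h * v2) c =
  (fun j1 j2 => (RtoC h * deriv_coef v1 v2 c j1 j2)%C).
Proof.
  extensionality j1; extensionality j2. unfold deriv_coef.
  replace (IZR j1 * (h * v1) + IZR j2 * (h * v2)) with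
    (h * (IZR j1 * v1 + IZR j2 * v2)) by ring.
  rewrite RtoC_mult. ring.
Qed.

Lemma rep_is_derive (u : R -> R -> R) (c : Z -> Z -> C) (v1 v2 a1 a2 t : R) :
  rep u c ->
  is_derive (fun s => u (a1 + s * v1) (a2 + s * v2)) t
    (Re (fourier_series (deriv_coef v1 v2 c) (a1 + t * v1) (a2 + t * v2))).
Proof.
  intros Hu. destruct (fs_taylor c (proj1 Hu)) as [L [HL HT]].
  pose proof (pow2_ge_0 (Rabs v1 + Rabs v2)).
  apply is_derive_quadratic with (L * (Rabs v1 + Rabs v2) ^ 2); [nra|].
  intros h. specialize (HT (a1 + t * v1) (a2 + t * v2) (h * v1) (h * v2)).
  rewrite deriv_coef_scal, fs_scal in HT by apply decay_deriv, Hu.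
  rewrite !(rep_Re u c) by assumption.
  replace (a1 + (t + h) * v1) with (a1 + t * v1 + h * v1) by ring.
  replace (a2 + (t + h) * v2) with (a2 + t * v2 + h * v2) by ring.
  rewrite !Rabs_mult in HT.
  replace (L * (Rabs h * Rabs v1 + Rabs h * Rabs v2) ^ 2) with
    (L * (Rabs v1 + Rabs v2) ^ 2 * Rabs h ^ 2) in HT by ring.
  eapply Rle_trans; [|apply HT]. eapply Rle_trans; [|apply re_le_Cmod].
  right. f_equal. unfold Re. simpl. ring.
Qed.

Lemma rep_deriv (u : R -> R -> R) (c : Z -> Z -> C) (v1 v2 : R) : rep u c ->
  rep (fun a1 a2 => Re (fourier_series (deriv_coef v1 v2 c) a1 a2))
    (deriv_coef v1 v2 c).
Proof.
  intros Hu. apply rep_of_symmetric; [apply decay_deriv, Hu|].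
  intros j1 j2. unfold deriv_coef. rewrite (rep_conj u c) by assumption.
  rewrite !Cmult_conj, !opp_IZR. f_equal.
  apply injective_projections; simpl; ring.
Qed.

Lemma rep_is_derive1 (u : R -> R -> R) (c : Z -> Z -> C) (a1 a2 : R) : rep u c ->
  is_derive (fun s => u s a2) a1 (Re (fourier_series (deriv_coef 1 0 c) a1 a2)).
Proof.
  intros Hu. pose proof (rep_is_derive u c 1 0 0 a2 a1 Hu) as Hd.
  rewrite Rplus_0_l, Rmult_1_r, Rmult_0_r, Rplus_0_r in Hd.
  apply is_derive_ext with (2 := Hd). intros t. f_equal; ring.
Qed.

Lemma rep_is_derive2 (u : R -> R -> R) (c : Z -> Z -> C) (a1 a2 : R) : rep u c ->
  is_derive (fun s => u a1 s) a2 (Re (fourier_series (deriv_coef 0 1 c) a1 a2)).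
Proof.
  intros Hu. pose proof (rep_is_derive u c 0 1 a1 0 a2 Hu) as Hd.
  rewrite Rplus_0_l, Rmult_1_r, Rmult_0_r, Rplus_0_r in Hd.
  apply is_derive_ext with (2 := Hd). intros t. f_equal; ring.
Qed.

Lemma pd1E (u : R -> R -> R) (c : Z -> Z -> C) : rep u c ->
  pd1 u = (fun a1 a2 => Re (fourier_series (deriv_coef 1 0 c) a1 a2)).
Proof.
  intros Hu. extensionality a1; extensionality a2.
  now apply is_derive_unique, rep_is_derive1.
Qed.

Lemma pd2E (u : R -> R -> R) (c : Z -> Z -> C) : rep u c ->
  pd2 u = (fun a1 a2 => Re (fourier_series (deriv_coef 0 1 c) a1 a2)).
Proof.
  intros Hu. extensionality a1; extensionality a2.
  now apply is_derive_unique, rep_is_derive2.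
Qed.

Lemma rep_smooth (u : R -> R -> R) (c : Z -> Z -> C) : rep u c -> smooth u.
Proof.
  intros Hu n. revert u c Hu. induction n as [|n IH]; intros u c Hu; simpl.
  - now apply rep_cont2 with c.
  - split; [|split].
    + intros a1 a2. split; eexists; [exact (rep_is_derive1 u c a1 a2 Hu)|exact (rep_is_derive2 u c a1 a2 Hu)].
    + rewrite (pd1E u c Hu). exact (IH _ _ (rep_deriv u c 1 0 Hu)).
    + rewrite (pd2E u c Hu). exact (IH _ _ (rep_deriv u c 0 1 Hu)).
Qed.

Lemma DE (k : R) (u : R -> R -> R) (c : Z -> Z -> C) : rep u c ->
  D k u = (fun a1 a2 => Re (fourier_series (deriv_coef 1 k c) a1 a2)).
Proof.
  intros Hu. extensionality a1; extensionality a2. unfold D.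
  rewrite (pd1E u c Hu), (pd2E u c Hu).
  replace (deriv_coef 1 k c) with
    (fun j1 j2 => (deriv_coef 1 0 c j1 j2 + RtoC k * deriv_coef 0 1 c j1 j2)%C).
  - assert (H1 : decay (deriv_coef 1 0 c)) by apply decay_deriv, Hu.
    assert (H2 : decay (deriv_coef 0 1 c)) by apply decay_deriv, Hu.
    rewrite fs_plus, fs_scal by (try apply decay_scal; assumption).
    unfold Re; simpl. ring.
  - extensionality j1; extensionality j2. unfold deriv_coef.
    apply injective_projections; simpl; ring.
Qed.

Lemma rep_D (k : R) (u : R -> R -> R) (c : Z -> Z -> C) : rep u c ->
  rep (D k u) (deriv_coef 1 k c).
Proof. intros Hu. rewrite (DE k u c Hu). now apply rep_deriv with u. Qed.

Lemma rep_is_derive_line (k : R) (u : R -> R -> R) (c : Z -> Z -> C) (a1 a2 t : R) :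
  rep u c ->
  is_derive (fun s => u (a1 + s) (a2 + k * s)) t (D k u (a1 + t) (a2 + k * t)).
Proof.
  intros Hu. pose proof (rep_is_derive u c 1 k a1 a2 t Hu) as Hd.
  rewrite (DE k u c Hu). rewrite Rmult_1_r, (Rmult_comm t k) in Hd.
  apply is_derive_ext with (2 := Hd). intros s. f_equal; ring.
Qed.

Lemma Derive_shift (f : R -> R) (s x : R) :
  Derive (fun y => f (y - s)) x = Derive f (x - s).
Proof.
  unfold Derive. f_equal. f_equal. extensionality h.
  now replace (x + h - s) with (x - s + h) by ring.
Qed.

Lemma D_shift (k s1 s2 : R) (u : R -> R -> R) :
  D k (fun a1 a2 => u (a1 - s1) (a2 - s2)) =
  (fun a1 a2 => D k u (a1 - s1) (a2 - s2)).
Proof.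
  extensionality a1; extensionality a2. unfold D, pd1, pd2.
  now rewrite (Derive_shift (fun s => u s (a2 - s2))), (Derive_shift (u (a1 - s1))).
Qed.

(** * The Hilbert transform as a multiplier *)

Definition hilbert_coef (k : R) (c : Z -> Z -> C) (j1 j2 : Z) : C :=
  (- Ci * RtoC (sign (IZR j1 + IZR j2 * k)) * c j1 j2)%C.

Lemma Rabs_sign_le (x : R) : Rabs (sign x) <= 1.
Proof.
  destruct (Rtotal_order x 0) as [Hx|[->|Hx]].
  - rewrite sign_eq_m1 by assumption. rewrite Rabs_left; lra.
  - rewrite sign_0, Rabs_R0. lra.
  - rewrite sign_eq_1 by assumption. rewrite Rabs_R1. lra.
Qed.

Lemma decay_hilbert (k : R) (c : Z -> Z -> C) : decay c -> decay (hilbert_coef k c).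
Proof.
  intros Hc. apply decay_bounded_mult with 1; [assumption|].
  intros j1 j2. rewrite Cmod_mult, Cmod_opp, Cmod_Ci, Cmod_R, Rmult_1_l.
  apply Rabs_sign_le.
Qed.

(** The sign is odd in the frequency and [- i] is imaginary, so the multiplier preserves conjugate
    symmetry and the transform of a real function is real. *)
Lemma rep_H (k : R) (u : R -> R -> R) (c : Z -> Z -> C) : rep u c ->
  rep (H k u) (hilbert_coef k c).
Proof.
  intros Hu.
  replace (H k u) with (fun a1 a2 => Re (fourier_series (hilbert_coef k c) a1 a2)).
  - apply rep_of_symmetric; [apply decay_hilbert, Hu|].
    intros j1 j2. unfold hilbert_coef. rewrite (rep_conj u c) by assumption.
    rewrite !Cmult_conj, !opp_IZR. f_equal.
    replace (- IZR j1 + - IZR j2 * k) with (- (IZR j1 + IZR j2 * k)) by ring.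
    rewrite sign_opp. apply injective_projections; simpl; ring.
  - extensionality a1; extensionality a2. unfold H. do 2 f_equal.
    extensionality j1; extensionality j2. now rewrite (rep_coef u c).
Qed.

(** Operator identities are proved this way: both sides are represented, and only their multipliers
    are compared. *)
Lemma rep_eq (u v : R -> R -> R) (c : Z -> Z -> C) : rep u c -> rep v c -> u = v.
Proof.
  intros Hu Hv. extensionality a1; extensionality a2.
  now rewrite (rep_Re u c), (rep_Re v c).
Qed.

Lemma H_shift (k s1 s2 : R) (u : R -> R -> R) (c : Z -> Z -> C) : rep u c ->
  H k (fun a1 a2 => u (a1 - s1) (a2 - s2)) =
  (fun a1 a2 => H k u (a1 - s1) (a2 - s2)).
Proof.
  intros Hu. apply rep_eq with (hilbert_coef k (shift_coef s1 s2 c)).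
  - now apply rep_H, rep_shift.
  - replace (hilbert_coef k (shift_coef s1 s2 c)) with
      (shift_coef s1 s2 (hilbert_coef k c)); [now apply rep_shift, rep_H|].
    extensionality j1; extensionality j2. unfold hilbert_coef, shift_coef. ring.
Qed.

(** An even function has even coefficients and the multiplier of [H] is odd. At the origin this
    gives [xi0 (0, 0) = 0], hence the initial condition [alpha0 0 = 0]. *)
Lemma H_even (k : R) (u : R -> R -> R) (c : Z -> Z -> C) (a1 a2 : R) : rep u c ->
  (forall b1 b2, u (- b1) (- b2) = u b1 b2) ->
  H k u (- a1) (- a2) = - H k u a1 a2.
Proof.
  intros Hu Heven.
  assert (Hc : forall j1 j2, c (- j1)%Z (- j2)%Z = c j1 j2).
  { intros j1 j2. apply (rep_unique u (fun j1 j2 => c (- j1)%Z (- j2)%Z)); [|assumption].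
    split; [apply decay_opp, Hu|]. intros b1 b2.
    rewrite <- fs_opp, <- Heven by apply Hu. apply Hu. }
  pose proof (rep_H k u c Hu) as HH.
  rewrite !(rep_Re _ _ _ _ HH), fs_opp by apply HH.
  replace (fun j1 j2 => hilbert_coef k c (- j1) (- j2)) with
    (fun j1 j2 => (- (1) * hilbert_coef k c j1 j2)%C).
  - rewrite fs_scal by apply HH. unfold Re; simpl. ring.
  - extensionality j1; extensionality j2. unfold hilbert_coef.
    rewrite Hc, !opp_IZR.
    replace (- IZR j1 + - IZR j2 * k) with (- (IZR j1 + IZR j2 * k)) by ring.
    rewrite sign_opp, RtoC_opp. ring.
Qed.

Lemma H_scal (k r : R) (u : R -> R -> R) (c : Z -> Z -> C) : rep u c ->
  H k (fun a1 a2 => r * u a1 a2) = (fun a1 a2 => r * H k u a1 a2).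
Proof.
  intros Hu. apply rep_eq with (hilbert_coef k (fun j1 j2 => (RtoC r * c j1 j2)%C)).
  - now apply rep_H, rep_scal.
  - replace (hilbert_coef _ _) with (fun j1 j2 => (RtoC r * hilbert_coef k c j1 j2)%C);
      [now apply rep_scal, rep_H|].
    extensionality j1; extensionality j2. unfold hilbert_coef. ring.
Qed.

Lemma H_D (k : R) (u : R -> R -> R) (c : Z -> Z -> C) : rep u c ->
  H k (D k u) = D k (H k u).
Proof.
  intros Hu. apply rep_eq with (hilbert_coef k (deriv_coef 1 k c)).
  - now apply rep_H, rep_D.
  - replace (hilbert_coef k (deriv_coef 1 k c)) with
      (deriv_coef 1 k (hilbert_coef k c)); [now apply rep_D, rep_H|].
    extensionality j1; extensionality j2. unfold hilbert_coef, deriv_coef. ring.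
Qed.

(** [H] squares to [- 1] except at frequency [m = 0], where [D] vanishes: the multipliers agree
    because [sign m ^ 2 * m = m]. *)
Lemma D_H_H (k : R) (u : R -> R -> R) (c : Z -> Z -> C) : rep u c ->
  D k (H k (H k u)) = (fun a1 a2 => - D k u a1 a2).
Proof.
  intros Hu.
  apply rep_eq with (deriv_coef 1 k (hilbert_coef k (hilbert_coef k c))).
  - now apply rep_D, rep_H, rep_H.
  - replace (deriv_coef _ _ _) with
      (fun j1 j2 => (RtoC (-1) * deriv_coef 1 k c j1 j2)%C).
    + replace (fun a1 a2 => - D k u a1 a2) with (fun a1 a2 => -1 * D k u a1 a2)
        by (extensionality a1; extensionality a2; ring).
      now apply rep_scal, rep_D.
    + extensionality j1; extensionality j2. unfold hilbert_coef, deriv_coef.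
      rewrite Rmult_1_r. set (m := IZR j1 + IZR j2 * k).
      assert (Hs : sign m * sign m * m = m).
      { destruct (Rtotal_order m 0) as [Hm|[->|Hm]].
        - rewrite sign_eq_m1 by assumption. ring.
        - ring.
        - rewrite sign_eq_1 by assumption. ring. }
      rewrite <- Hs at 1. rewrite !RtoC_mult.
      apply injective_projections; simpl; ring.
Qed.

Lemma P0E (u : R -> R -> R) : cont2 u -> P0 u = mean u.
Proof.
  intros Hu. unfold P0. rewrite fourier_coefE by assumption. unfold ccoef, cmean.
  simpl Re. f_equal. extensionality a1; extensionality a2. simpl.
  rewrite !Rmult_0_l, Rplus_0_l, cos_0, sin_0. ring.
Qed.

Lemma mean_rep (u : R -> R -> R) (c : Z -> Z -> C) : rep u c ->
  mean u = Re (c 0%Z 0%Z).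
Proof.
  intros Hu. rewrite <- P0E by now apply rep_cont2 with c.
  unfold P0. now rewrite (rep_coef u c).
Qed.

Lemma mean_affine (A B : R) (u : R -> R -> R) : cont2 u ->
  mean (fun a1 a2 => A + B * u a1 a2) = A + B * mean u.
Proof.
  intros Hu. rewrite (mean_plus (fun _ _ => A) (fun a1 a2 => B * u a1 a2)).
  - now rewrite mean_const, mean_scal.
  - intros a1 a2. apply continuity_2d_pt_const.
  - intros a1 a2. apply continuity_2d_pt_mult; [apply continuity_2d_pt_const|apply Hu].
Qed.

(** The multiplier of [D] vanishes at the zero mode. The right-hand sides for [x0] and [phi] reduce
    to this affine form, so their projections are explicit. *)
Lemma P0_affine_D (k A B s1 s2 : R) (u : R -> R -> R) (c : Z -> Z -> C) : rep u c ->
  P0 (fun a1 a2 => A + B * D k u (a1 - s1) (a2 - s2)) = A.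
Proof.
  intros Hu. pose proof (rep_shift s1 s2 _ _ (rep_D k u c Hu)) as Hr.
  pose proof (rep_cont2 _ _ Hr) as Hc.
  rewrite P0E.
  - rewrite mean_affine, (mean_rep _ _ Hr) by assumption.
    unfold shift_coef, deriv_coef, Re; simpl. ring.
  - intros a1 a2. apply continuity_2d_pt_plus; [apply continuity_2d_pt_const|].
    apply continuity_2d_pt_mult; [apply continuity_2d_pt_const|apply Hc].
Qed.

(** * Inverses in the half-plane algebra *)

(** The character with frequency [(j1, j2)] at the complex point [a + i b]. *)
Definition complex_character (j1 j2 : Z) (a1 a2 b1 b2 : R) : C :=
  (RtoC (exp (- (IZR j1 * b1 + IZR j2 * b2))) * character j1 j2 a1 a2)%C.

(** Trigonometric polynomials in [a + i b] whose nonconstant terms have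
    frequencies [j1 + j2 k < 0]; the last index is the mean. *)
Inductive lower_poly (k : R) : (R -> R -> R -> R -> C) -> C -> Prop :=
| lower_const z : lower_poly k (fun _ _ _ _ => z) z
| lower_character j1 j2 : IZR j1 + IZR j2 * k < 0 ->
    lower_poly k (complex_character j1 j2) (RtoC 0)
| lower_plus f g s t : lower_poly k f s -> lower_poly k g t ->
    lower_poly k (fun a1 a2 b1 b2 => (f a1 a2 b1 b2 + g a1 a2 b1 b2)%C) (s + t)%C
| lower_scal z f s : lower_poly k f s ->
    lower_poly k (fun a1 a2 b1 b2 => (z * f a1 a2 b1 b2)%C) (z * s)%C.

Lemma lower_ext (k : R) (f g : R -> R -> R -> R -> C) (s t : C) :
  (forall a1 a2 b1 b2, f a1 a2 b1 b2 = g a1 a2 b1 b2) -> s = t ->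
  lower_poly k f s -> lower_poly k g t.
Proof.
  intros Hfg ->. replace g with f; [easy|].
  extensionality a1; extensionality a2; extensionality b1; extensionality b2.
  apply Hfg.
Qed.

Lemma complex_character_mult (j1 j2 l1 l2 : Z) (a1 a2 b1 b2 : R) :
  (complex_character j1 j2 a1 a2 b1 b2 * complex_character l1 l2 a1 a2 b1 b2)%C =
  complex_character (j1 + l1) (j2 + l2) a1 a2 b1 b2.
Proof.
  unfold complex_character. rewrite !characterE, !plus_IZR.
  replace (- ((IZR j1 + IZR l1) * b1 + (IZR j2 + IZR l2) * b2)) with
    (- (IZR j1 * b1 + IZR j2 * b2) + - (IZR l1 * b1 + IZR l2 * b2)) by ring.
  replace ((IZR j1 + IZR l1) * a1 + (IZR j2 + IZR l2) * a2) with
    ((IZR j1 * a1 + IZR j2 * a2) + (IZR l1 * a1 + IZR l2 * a2)) by ring.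
  rewrite exp_plus, (expi_plus (IZR j1 * a1 + IZR j2 * a2)), RtoC_mult. ring.
Qed.

(** Negative frequencies are closed under addition, so a product of nonconstant terms never returns
    to frequency 0. Hence the mean is multiplicative on this algebra. *)
Lemma lower_mult (k : R) (f g : R -> R -> R -> R -> C) (s t : C) :
  lower_poly k f s -> lower_poly k g t ->
  lower_poly k (fun a1 a2 b1 b2 => (f a1 a2 b1 b2 * g a1 a2 b1 b2)%C) (s * t)%C.
Proof.
  intros Hf Hg.
  induction Hf as [z|j1 j2 Hj|f f' s s' _ IH _ IH'|z f s _ IH].
  - now apply lower_scal.
  - induction Hg as [w|l1 l2 Hl|g g' t t' _ IH _ IH'|w g t _ IH].
    + eapply lower_ext; [| |apply (lower_scal k w), (lower_character k j1 j2 Hj)];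
        intros; cbv beta; ring.
    + eapply lower_ext; [| |apply (lower_character k (j1 + l1) (j2 + l2))].
      * intros. symmetry. apply complex_character_mult.
      * ring.
      * rewrite !plus_IZR. lra.
    + eapply lower_ext; [| |apply (lower_plus k _ _ _ _ IH IH')]; intros; cbv beta; ring.
    + eapply lower_ext; [| |apply (lower_scal k w _ _ IH)]; intros; cbv beta; ring.
  - eapply lower_ext; [| |apply (lower_plus k _ _ _ _ IH IH')]; intros; cbv beta; ring.
  - eapply lower_ext; [| |apply (lower_scal k z _ _ IH)]; intros; cbv beta; ring.
Qed.

Lemma lower_sym_sum (k : R) (F : Z -> R -> R -> R -> R -> C) (N : nat) :
  (forall j, lower_poly k (F j) (RtoC 0)) ->
  lower_poly k (fun a1 a2 b1 b2 => sym_sum (fun j => F j a1 a2 b1 b2) N) (RtoC 0).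
Proof.
  intros HF. induction N as [|N IH].
  - eapply lower_ext; [| |apply (HF 0%Z)]; [|reflexivity].
    intros. now rewrite sym_sum_0.
  - eapply lower_ext; [| |apply (lower_plus k _ _ _ _ IH
      (lower_plus k _ _ _ _ (HF (Z.of_nat (S N))) (HF (- Z.of_nat (S N))%Z)))].
    + intros. now rewrite sym_sum_SC.
    + ring.
Qed.

Lemma delta0_opp (j1 j2 : Z) : delta0 (- j1) (- j2) = delta0 j1 j2.
Proof.
  unfold delta0. destruct (Z.eq_dec (- j1) 0), (Z.eq_dec j1 0); try lia; [|easy].
  destruct (Z.eq_dec (- j2) 0), (Z.eq_dec j2 0); easy || lia.
Qed.

(** One finitely supported family describes the polynomial at every height [b]: moving from [a] to
    [a + i b] only multiplies the coefficients by [exp (- j . b)]. The bound [N0] covers the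
    support, so square sums are eventually exact. *)
Lemma lower_coef_exists (k : R) (f : R -> R -> R -> R -> C) (s : C) :
  lower_poly k f s -> exists c N0,
    (forall j1 j2, 0 <= IZR j1 + IZR j2 * k -> c j1 j2 = (s * delta0 j1 j2)%C) /\
    (forall N, (N0 <= N)%nat -> forall a1 a2,
       square_sum (term c a1 a2) N = f a1 a2 0 0) /\
    (forall b1 b2, ccont (fun a1 a2 => f a1 a2 b1 b2) /\ forall j1 j2,
       ccoef (fun a1 a2 => f a1 a2 b1 b2) j1 j2 =
       (RtoC (exp (- (IZR j1 * b1 + IZR j2 * b2))) * c j1 j2)%C).
Proof.
  intros Hf. induction Hf as [z|l1 l2 Hl|f g s t _ IHf _ IHg|z f s _ IH].
  - exists (fun j1 j2 => (z * delta0 j1 j2)%C), 0%nat. split; [reflexivity|split].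
    + intros N _ a1 a2. unfold term.
      replace (fun j1 j2 => (z * delta0 j1 j2 * character j1 j2 a1 a2)%C) with
        (fun j1 j2 => (delta0 (j1 - 0) (j2 - 0) * (z * character j1 j2 a1 a2))%C)
        by (extensionality j1; extensionality j2; rewrite !Z.sub_0_r; ring).
      rewrite square_sum_delta by lia.
      rewrite characterE, !Rmult_0_l, Rplus_0_l, expi_0. ring.
    + intros b1 b2. split; [apply ccont_const|]. intros j1 j2.
      replace (fun _ _ => z) with (fun a1 a2 => (z * character 0 0 a1 a2)%C).
      2: { extensionality a1; extensionality a2.
           rewrite characterE, !Rmult_0_l, Rplus_0_l, expi_0. ring. }
      rewrite ccoef_scal, ccoef_character by apply ccont_character.
      rewrite <- delta0_opp.
      replace (- (0 - j1))%Z with j1 by ring. replace (- (0 - j2))%Z with j2 by ring.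
      unfold delta0. destruct (Z.eq_dec j1 0) as [->|]; [|ring].
      destruct (Z.eq_dec j2 0) as [->|]; [|ring].
      rewrite !Rmult_0_l, Rplus_0_l, Ropp_0, exp_0. ring.
  - exists (fun j1 j2 => delta0 (j1 - l1) (j2 - l2)),
      (max (Z.to_nat (Z.abs l1)) (Z.to_nat (Z.abs l2))).
    split; [|split].
    + intros j1 j2 Hj. unfold delta0 at 1.
      destruct (Z.eq_dec (j1 - l1) 0), (Z.eq_dec (j2 - l2) 0); try ring.
      exfalso. replace j1 with l1 in Hj by lia. replace j2 with l2 in Hj by lia. lra.
    + intros N HN a1 a2. unfold term. rewrite square_sum_delta by lia.
      unfold complex_character. rewrite !Rmult_0_r, Rplus_0_l, Ropp_0, exp_0. ring.
    + intros b1 b2. split.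
      { apply ccont_mult; [apply ccont_const|apply ccont_character]. }
      intros j1 j2. unfold complex_character.
      rewrite ccoef_scal, ccoef_character by apply ccont_character.
      rewrite <- delta0_opp.
      replace (- (l1 - j1))%Z with (j1 - l1)%Z by ring.
      replace (- (l2 - j2))%Z with (j2 - l2)%Z by ring.
      unfold delta0. destruct (Z.eq_dec (j1 - l1) 0) as [E1|]; [|ring].
      destruct (Z.eq_dec (j2 - l2) 0) as [E2|]; [|ring].
      now replace l1 with j1 by lia; replace l2 with j2 by lia.
  - destruct IHf as [c [N1 [Hc1 [Hc2 Hc3]]]], IHg as [d [N2 [Hd1 [Hd2 Hd3]]]].
    exists (fun j1 j2 => (c j1 j2 + d j1 j2)%C), (max N1 N2). split; [|split].
    + intros j1 j2 Hj. rewrite Hc1, Hd1 by assumption. ring.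
    + intros N HN a1 a2. rewrite <- (Hc2 N ltac:(lia)), <- (Hd2 N ltac:(lia)).
      rewrite !square_sumE, <- (sym_sum_plus (V := C_AbelianMonoid)).
      apply sym_sum_ext. intros j1.
      rewrite <- (sym_sum_plus (V := C_AbelianMonoid)).
      apply sym_sum_ext. intros j2. unfold term. apply Cmult_plus_distr_r.
    + intros b1 b2. destruct (Hc3 b1 b2) as [C1 E1], (Hd3 b1 b2) as [C2 E2].
      split; [now apply ccont_plus|]. intros j1 j2.
      rewrite (ccoef_plus (fun a1 a2 => f a1 a2 b1 b2)), E1, E2 by assumption. ring.
  - destruct IH as [c [N1 [Hc1 [Hc2 Hc3]]]].
    exists (fun j1 j2 => (z * c j1 j2)%C), N1. split; [|split].
    + intros j1 j2 Hj. rewrite Hc1 by assumption. ring.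
    + intros N HN a1 a2. rewrite <- (Hc2 N ltac:(lia)).
      rewrite !square_sumE, <- sym_sum_mult_l.
      apply sym_sum_ext. intros j1. rewrite <- sym_sum_mult_l.
      apply sym_sum_ext. intros j2. unfold term. ringC.
    + intros b1 b2. destruct (Hc3 b1 b2) as [C1 E1].
      split; [apply ccont_mult; [apply ccont_const|assumption]|]. intros j1 j2.
      rewrite ccoef_scal, E1 by assumption. ring.
Qed.

(** The bound on the complex torus [b = (+-rho, +-rho)] makes the coefficients
    decay, since moving to [a + i b] multiplies them by [exp (- j . b)]. *)
Lemma lower_coef (k : R) (f : R -> R -> R -> R -> C) (s : C) (rho B : R) :
  lower_poly k f s ->
  (forall a1 a2 b1 b2, Rabs b1 = rho -> Rabs b2 = rho ->
     Cmod (f a1 a2 b1 b2) <= B) ->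
  0 < rho -> exists c,
    (forall j1 j2, 0 <= IZR j1 + IZR j2 * k -> c j1 j2 = (s * delta0 j1 j2)%C) /\
    (forall j1 j2, Cmod (c j1 j2) <= 2 * B * exp (- rho * abs1 j1 j2)) /\
    (forall a1 a2, fourier_series c a1 a2 = f a1 a2 0 0).
Proof.
  intros Hf HB Hrho. destruct (lower_coef_exists k f s Hf) as [c [N0 [H1 [H2 H3]]]].
  exists c. split; [exact H1|split].
  - intros j1 j2.
    (* Each height has the sign opposite to its frequency, so that the factor [exp (- j . b)] takes
       its largest value [exp (rho |j|)]. *)
    set (b := fun j => if Z_le_dec 0 j then - rho else rho).
    assert (Hb : forall j, Rabs (b j) = rho /\ - (IZR j * b j) = rho * Rabs (IZR j)).
    { intros j. unfold b. destruct (Z_le_dec 0 j) as [Hj|Hj].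
      - rewrite Rabs_Ropp, !Rabs_right; [split; ring| |lra].
        now apply Rle_ge, IZR_le.
      - rewrite Rabs_right, (Rabs_left (IZR j)); [split; ring| |lra].
        apply IZR_lt. lia. }
    destruct (H3 (b j1) (b j2)) as [Hcont E].
    pose proof (ccoef_bound _ B j1 j2 Hcont (fun a1 a2 =>
      HB a1 a2 _ _ (proj1 (Hb j1)) (proj1 (Hb j2)))) as Hle.
    rewrite E, Cmod_mult, Cmod_R, Rabs_right in Hle by (left; apply exp_pos).
    replace (- (IZR j1 * b j1 + IZR j2 * b j2)) with (rho * abs1 j1 j2) in Hle.
    2: { unfold abs1. rewrite Rmult_plus_distr_l, <- (proj2 (Hb j1)), <- (proj2 (Hb j2)).
         ring. }
    replace (- rho * abs1 j1 j2) with (- (rho * abs1 j1 j2)) by ring.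
    rewrite exp_Ropp. pose proof (exp_pos (rho * abs1 j1 j2)) as He.
    apply Rmult_le_reg_l with (1 := He).
    replace (_ * (2 * B * _)) with (2 * B) by (field; lra). exact Hle.
  - intros a1 a2. apply fs_eq. intros eps Heps. exists N0. intros N HN.
    rewrite H2 by assumption. replace (_ - _)%C with (RtoC 0) by ring. now rewrite Cmod_0.
Qed.

(** The sum [1 + w + ... + w ^ n] in Horner form, which makes its membership in [lower_poly] an
    induction over sums and products. *)
Fixpoint cgeom (w : C) (n : nat) : C :=
  match n with
  | O => RtoC 1
  | S m => (1 + w * cgeom w m)%C
  end.

Lemma cgeomE (w : C) (n : nat) : ((1 - w) * cgeom w n)%C = (1 - w ^ S n)%C.
Proof.
  induction n as [|n IH].
  - simpl. ring.
  - replace ((1 - w) * cgeom w (S n))%C with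
      ((1 - w) + w * ((1 - w) * cgeom w n))%C by (simpl; ring).
    rewrite IH. rewrite (Cpow_S w (S n)). ring.
Qed.

(** The bound is the fixed point of [x -> 1 + r x], hence independent of [n]. *)
Lemma Cmod_cgeom (w : C) (r : R) (n : nat) : r < 1 -> Cmod w <= r ->
  Cmod (cgeom w n) <= / (1 - r).
Proof.
  intros Hr Hw. pose proof (Cmod_ge_0 w).
  assert (Hp : 0 < / (1 - r)) by (apply Rinv_0_lt_compat; lra).
  assert (E : / (1 - r) = 1 + r * / (1 - r)) by (field; lra).
  induction n as [|n IH]; simpl.
  - rewrite Cmod_1, E. nra.
  - eapply Rle_trans; [apply Cmod_triangle|]. rewrite Cmod_1, Cmod_mult, E.
    apply Rplus_le_compat_l, Rmult_le_compat; auto using Cmod_ge_0.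
Qed.

Lemma lower_cgeom (k : R) (f : R -> R -> R -> R -> C) (s : C) (n : nat) :
  lower_poly k f s ->
  lower_poly k (fun a1 a2 b1 b2 => cgeom (f a1 a2 b1 b2) n) (cgeom s n).
Proof.
  intros Hf. induction n as [|n IH]; simpl.
  - apply lower_const.
  - apply (lower_plus k (fun _ _ _ _ => RtoC 1)); [apply lower_const|].
    now apply lower_mult.
Qed.

Lemma ccoef_close (G : R -> R -> C) (c : Z -> Z -> C) (eps : R) (j1 j2 : Z) :
  ccont G -> decay c ->
  (forall a1 a2, Cmod (fourier_series c a1 a2 - G a1 a2) <= eps) ->
  Cmod (ccoef G j1 j2 - c j1 j2) <= 2 * eps.
Proof.
  intros HG Hc Hle. rewrite <- (ccoef_fs c j1 j2) by assumption.
  assert (Hneg : ccont (fun a1 a2 => (- (1)) * fourier_series c a1 a2)%C)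
    by (apply ccont_mult; [apply ccont_const|now apply ccont_fs]).
  replace (_ - _)%C with
    (ccoef (fun a1 a2 => (G a1 a2 + (- (1)) * fourier_series c a1 a2)%C) j1 j2).
  - apply ccoef_bound; [now apply ccont_plus|].
    intros a1 a2.
    replace (_ + _)%C with (- (fourier_series c a1 a2 - G a1 a2))%C by ring.
    rewrite Cmod_opp. apply Hle.
  - rewrite ccoef_plus, ccoef_scal by (assumption || now apply ccont_fs). ring.
Qed.

(** Uniform closeness moves each coefficient little, so the common decay bound survives in the
    limit. Closeness alone does not control the sum of the coefficient differences; interpolating it
    with the common bound makes them summable with a small total. *)
Lemma fs_limit (G : R -> R -> C) (K rho : R) : 0 < rho -> ccont G ->
  (forall eps, 0 < eps -> exists c,
     (forall j1 j2, Cmod (c j1 j2) <= K * exp (- rho * abs1 j1 j2)) /\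
     (forall a1 a2, Cmod (fourier_series c a1 a2 - G a1 a2) <= eps)) ->
  decay (ccoef G) /\ forall a1 a2, fourier_series (ccoef G) a1 a2 = G a1 a2.
Proof.
  intros Hrho HG Happ.
  assert (Hdecay : forall j1 j2, Cmod (ccoef G j1 j2) <= K * exp (- rho * abs1 j1 j2)).
  { intros j1 j2. apply le_epsilon. intros eps Heps.
    destruct (Happ (eps / 2) ltac:(lra)) as [c [Hc1 Hc2]].
    assert (Hc : decay c) by (exists K, rho; now split).
    pose proof (ccoef_close G c (eps / 2) j1 j2 HG Hc Hc2).
    replace (ccoef G j1 j2) with ((ccoef G j1 j2 - c j1 j2) + c j1 j2)%C by ring.
    eapply Rle_trans; [apply Cmod_triangle|]. specialize (Hc1 j1 j2). lra. }
  assert (Hdec : decay (ccoef G)) by (exists K, rho; now split).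
  split; [assumption|]. intros a1 a2.
  pose proof (dominating_nonneg _ _ _ Hdecay) as HK.
  set (E := sqrt (2 * K) * geom_total (rho / 2) ^ 2).
  assert (HE : 0 <= E).
  { apply Rmult_le_pos; [apply sqrt_pos|apply pow2_ge_0]. }
  assert (Hle : forall eta, 0 < eta ->
    Cmod (fourier_series (ccoef G) a1 a2 - G a1 a2) <= eta * E + eta * eta / 2).
  { intros eta Heta.
    (* [ccoef_close] doubles the tolerance, so the coefficients differ by at most [eta ^ 2], and the
       geometric mean below contributes the factor [eta]. *)
    destruct (Happ (eta * eta / 2)) as [c [Hc1 Hc2]]; [nra|].
    assert (Hc : decay c) by (exists K, rho; now split).
    pose proof (fun j1 j2 => ccoef_close G c _ j1 j2 HG Hc Hc2) as Hcl.
    replace (_ - _)%C with ((fourier_series (ccoef G) a1 a2 - fourier_series c a1 a2)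
      + (fourier_series c a1 a2 - G a1 a2))%C by ring.
    eapply Rle_trans; [apply Cmod_triangle|]. apply Rplus_le_compat; [|apply Hc2].
    replace (eta * E) with ((eta * sqrt (2 * K)) * geom_total (rho / 2) ^ 2)
      by (unfold E; ring).
    apply (sums_bound (fun j1 j2 =>
      (term (ccoef G) a1 a2 j1 j2 - term c a1 a2 j1 j2)%C)); [lra| |].
    2: now apply sums_minus; apply sums_fs.
    intros j1 j2. unfold term.
    replace (_ - _)%C with ((ccoef G j1 j2 - c j1 j2) * character j1 j2 a1 a2)%C by ring.
    rewrite Cmod_mult, characterE, Cmod_expi, Rmult_1_r.
    (* The difference is at most both [eta^2] and [2 K exp (- rho |j|)], hence at
       most their geometric mean. *)
    set (x := Cmod (ccoef G j1 j2 - c j1 j2)).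
    assert (Hx0 : 0 <= x) by apply Cmod_ge_0.
    assert (Hx1 : x <= eta ^ 2) by (specialize (Hcl j1 j2); fold x in Hcl; simpl; lra).
    set (e := exp (- (rho / 2) * abs1 j1 j2)).
    assert (He : 0 < e) by apply exp_pos.
    assert (Hee : exp (- rho * abs1 j1 j2) = e * e)
      by (unfold e; rewrite <- exp_plus; f_equal; field).
    set (q := sqrt (2 * K)).
    assert (Hq : q * q = 2 * K) by (apply sqrt_sqrt; lra).
    assert (Hq0 : 0 <= q) by apply sqrt_pos.
    assert (Hx2 : x <= (q * e) ^ 2).
    { replace ((q * e) ^ 2) with ((q * q) * (e * e)) by ring. rewrite Hq, <- Hee.
      unfold x. replace (ccoef G j1 j2 - c j1 j2)%C with
        (ccoef G j1 j2 + - c j1 j2)%C by ring.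
      eapply Rle_trans; [apply Cmod_triangle|]. rewrite Cmod_opp.
      specialize (Hc1 j1 j2). specialize (Hdecay j1 j2). lra. }
    assert (Hqe : 0 <= q * e) by nra.
    replace (eta * q * e) with (eta * (q * e)) by ring.
    clearbody x. clear - Hx0 Hx1 Hx2 Hqe Heta. set (y := q * e) in *. clearbody y.
    apply Rnot_lt_le. intros Hlt.
    assert (eta * y * (eta * y) < x * x) by (apply Rmult_le_0_lt_compat; nra).
    assert (x * x <= eta ^ 2 * y ^ 2) by (apply Rmult_le_compat; assumption).
    lra. }
  assert (H0 : Cmod (fourier_series (ccoef G) a1 a2 - G a1 a2) = 0).
  { apply Rle_antisym; [|apply Cmod_ge_0]. apply le_epsilon. intros eps Heps.
    rewrite Rplus_0_l.
    set (eta := Rmin 1 (eps / (E + 1))).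
    assert (Heta : 0 < eta).
    { apply Rmin_glb_lt; [lra|]. apply Rdiv_lt_0_compat; lra. }
    assert (Heta1 : eta <= 1) by apply Rmin_l.
    assert (Heta2 : eta * (E + 1) <= eps).
    { replace eps with (eps / (E + 1) * (E + 1)) by (field; lra).
      apply Rmult_le_compat_r; [lra|apply Rmin_r]. }
    eapply Rle_trans; [apply (Hle eta Heta)|]. nra. }
  apply Cmod_eq_0 in H0.
  replace (G a1 a2) with (fourier_series (ccoef G) a1 a2
    - (fourier_series (ccoef G) a1 a2 - G a1 a2))%C by ring.
  rewrite H0. ring.
Qed.

(** * Partial sums at complex points *)

Lemma Rabs_exp_sub1 (x : R) : Rabs (exp x - 1) <= Rabs x * exp (Rabs x).
Proof.
  pose proof (exp_ineq1_le x). pose proof (exp_ineq1_le (- x)).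
  pose proof (exp_pos x).
  destruct (Rle_lt_dec 0 x) as [Hx|Hx].
  - rewrite (Rabs_right x) by lra.
    assert (1 <= exp x) by lra. rewrite Rabs_right by lra.
    assert (E : exp x * exp (- x) = 1) by (rewrite <- exp_plus, <- exp_0; f_equal; ring).
    nra.
  - rewrite (Rabs_left x) by lra.
    assert (exp x <= 1) by (rewrite <- exp_0; apply exp_le; lra).
    rewrite Rabs_left1 by lra. nra.
Qed.

Lemma exp_dot_bound (rho : R) (j1 j2 : Z) (b1 b2 : R) :
  Rabs b1 <= rho -> Rabs b2 <= rho ->
  Rabs (exp (- (IZR j1 * b1 + IZR j2 * b2)) - 1)
  <= rho * abs1 j1 j2 * exp (rho * abs1 j1 j2).
Proof.
  intros H1 H2. eapply Rle_trans; [apply Rabs_exp_sub1|]. rewrite Rabs_Ropp.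
  assert (Hle : Rabs (IZR j1 * b1 + IZR j2 * b2) <= rho * abs1 j1 j2).
  { eapply Rle_trans; [apply Rabs_triang|]. rewrite !Rabs_mult. unfold abs1.
    pose proof (Rabs_pos (IZR j1)). pose proof (Rabs_pos (IZR j2)). nra. }
  apply Rmult_le_compat; [apply Rabs_pos|left; apply exp_pos|assumption|].
  now apply exp_le.
Qed.

(** The series is truncated before it is continued to [a + i b], which makes it a member of
    [lower_poly]. *)
Definition strip_sum (c : Z -> Z -> C) (N : nat) (a1 a2 b1 b2 : R) : C :=
  square_sum (fun j1 j2 => (c j1 j2 * complex_character j1 j2 a1 a2 b1 b2)%C) N.

Lemma lower_strip_sum (k : R) (c : Z -> Z -> C) (N : nat) :
  (forall j1 j2, 0 <= IZR j1 + IZR j2 * k -> c j1 j2 = RtoC 0) ->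
  lower_poly k (strip_sum c N) (RtoC 0).
Proof.
  intros Hc. unfold strip_sum.
  apply (lower_sym_sum k (fun j1 a1 a2 b1 b2 => sym_sum (fun j2 =>
    (c j1 j2 * complex_character j1 j2 a1 a2 b1 b2)%C) N)). intros j1.
  apply (lower_sym_sum k (fun j2 a1 a2 b1 b2 =>
    (c j1 j2 * complex_character j1 j2 a1 a2 b1 b2)%C)). intros j2.
  destruct (Rle_lt_dec 0 (IZR j1 + IZR j2 * k)) as [Hj|Hj].
  - eapply lower_ext; [| |apply (lower_const k (RtoC 0))]; [|reflexivity].
    intros. rewrite Hc by assumption. ring.
  - eapply lower_ext; [| |apply (lower_scal k (c j1 j2) _ _ (lower_character k j1 j2 Hj))].
    + reflexivity.
    + ring.
Qed.

Lemma strip_sum_0 (c : Z -> Z -> C) (N : nat) (a1 a2 : R) :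
  strip_sum c N a1 a2 0 0 = square_sum (term c a1 a2) N.
Proof.
  unfold strip_sum. f_equal. extensionality j1; extensionality j2.
  unfold term, complex_character. rewrite !Rmult_0_r, Rplus_0_l, Ropp_0, exp_0. ring.
Qed.

(** The reference value is the series at the real point [a], so bounds known only on the torus carry
    over to a thin complex neighborhood, with a width independent of the truncation. *)
Lemma strip_sum_close (c : Z -> Z -> C) (eps : R) : decay c -> 0 < eps ->
  exists rho N0, 0 < rho /\ forall N, (N0 <= N)%nat -> forall a1 a2 b1 b2,
    Rabs b1 <= rho -> Rabs b2 <= rho ->
    Cmod (strip_sum c N a1 a2 b1 b2 - fourier_series c a1 a2) <= eps.
Proof.
  intros Hc Heps. destruct (decay_quadratic c Hc) as [K [rho0 [Hrho0 HK]]].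
  destruct (fs_uniform c (eps / 2) Hc ltac:(lra)) as [N0 HN0].
  set (A := geom_total (rho0 / 2) ^ 2). assert (HA : 0 <= A) by apply pow2_ge_0.
  assert (HK0 : 0 <= K).
  { specialize (HK 0%Z 0%Z). pose proof (Cmod_ge_0 (c 0%Z 0%Z)).
    pose proof (exp_pos (- rho0 * abs1 0 0)).
    pose proof (pow2_ge_0 (1 + abs1 0 0)). nra. }
  assert (HKA : 0 <= K * A) by now apply Rmult_le_pos.
  (* The first entry leaves the decay rate [rho0 / 2] after the growth [exp (rho |j|)]; the second
     makes the remaining factor [rho K A] at most [eps / 2]. *)
  set (rho := Rmin (rho0 / 2) (eps / 2 / (K * A + 1))).
  assert (Hrho : 0 < rho).
  { apply Rmin_glb_lt; [lra|]. apply Rdiv_lt_0_compat; lra. }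
  assert (Hr1 : rho <= rho0 / 2) by apply Rmin_l.
  assert (Hr2 : rho * (K * A + 1) <= eps / 2).
  { replace (eps / 2) with (eps / 2 / (K * A + 1) * (K * A + 1)) by (field; lra).
    apply Rmult_le_compat_r; [lra|apply Rmin_r]. }
  exists rho, N0. split; [assumption|]. intros N HN a1 a2 b1 b2 Hb1 Hb2.
  specialize (HN0 N HN a1 a2).
  set (f := fun j1 j2 => (c j1 j2 * complex_character j1 j2 a1 a2 b1 b2
                          - term c a1 a2 j1 j2)%C).
  assert (E : (strip_sum c N a1 a2 b1 b2 - square_sum (term c a1 a2) N)%C = square_sum f N).
  { unfold strip_sum. rewrite !square_sumE, sym_sum_minus. apply sym_sum_ext.
    intros j1. apply sym_sum_minus. }
  assert (Hf : Cmod (square_sum f N) <= rho * K * A).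
  { apply square_sum_bound; [lra|]. intros j1 j2. unfold f, term, complex_character.
    set (x := exp (- (IZR j1 * b1 + IZR j2 * b2))).
    replace (_ - _)%C with (RtoC (x - 1) * c j1 j2 * character j1 j2 a1 a2)%C
      by (rewrite RtoC_minus; ring).
    rewrite !Cmod_mult, characterE, Cmod_expi, Cmod_R, Rmult_1_r.
    pose proof (exp_dot_bound rho j1 j2 b1 b2 Hb1 Hb2) as Hx. fold x in Hx.
    pose proof (abs1_nonneg j1 j2) as Hj. set (y := abs1 j1 j2) in *.
    pose proof (Cmod_ge_0 (c j1 j2)) as H0. specialize (HK j1 j2). fold y in HK.
    assert (Hyc : y * Cmod (c j1 j2) <= K * exp (- rho0 * y)).
    { eapply Rle_trans; [|apply HK]. apply Rmult_le_compat_r; [assumption|]. simpl; nra. }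
    apply Rle_trans with (rho * y * exp (rho * y) * Cmod (c j1 j2)).
    { apply Rmult_le_compat_r; assumption. }
    replace (rho * y * exp (rho * y) * Cmod (c j1 j2)) with
      (rho * (exp (rho * y) * (y * Cmod (c j1 j2)))) by ring.
    rewrite (Rmult_assoc rho). apply Rmult_le_compat_l; [lra|].
    apply Rle_trans with (exp (rho * y) * (K * exp (- rho0 * y))).
    { apply Rmult_le_compat_l; [left; apply exp_pos|assumption]. }
    replace (exp (rho * y) * (K * exp (- rho0 * y))) with
      (K * exp (rho * y + - rho0 * y)) by (rewrite exp_plus; ring).
    apply Rmult_le_compat_l; [assumption|]. apply exp_le. nra. }
  replace (_ - _)%C with ((strip_sum c N a1 a2 b1 b2 - square_sum (term c a1 a2) N)
    + (square_sum (term c a1 a2) N - fourier_series c a1 a2))%C by ring.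
  eapply Rle_trans; [apply Cmod_triangle|]. rewrite E. nra.
Qed.

(** The square of the modulus is at most [1 - 2 lam delta + lam ^ 2 B ^ 2], which
    [lam = delta / B ^ 2] minimizes. With [mu = delta ^ 2 / (2 B ^ 2)] the minimum is [1 - 2 mu],
    and this is at most [(1 - mu) ^ 2]. *)
Lemma Cmod_damped (y : C) (B delta : R) : 0 < delta -> Cmod y <= B -> delta <= Re y ->
  Cmod (1 - RtoC (delta / B ^ 2) * y) <= 1 - delta ^ 2 / (2 * B ^ 2).
Proof.
  intros Hd HB Hre.
  assert (HdB : delta <= B).
  { pose proof (re_le_Cmod y). pose proof (Rle_abs (Re y)). lra. }
  assert (HB2 : 0 < B ^ 2) by (apply pow_lt; lra).
  set (lam := delta / B ^ 2).
  assert (Hlam : 0 < lam) by now apply Rdiv_lt_0_compat.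
  assert (Hlam2 : lam * B ^ 2 = delta) by (unfold lam; field; lra).
  set (mu := delta ^ 2 / (2 * B ^ 2)).
  assert (Hmu : 2 * mu = lam * delta) by (unfold mu, lam; field; lra).
  assert (Hmu2 : 2 * mu <= 1).
  { rewrite Hmu. apply Rmult_le_reg_r with (B ^ 2); [assumption|].
    replace (lam * delta * B ^ 2) with (lam * B ^ 2 * delta) by ring.
    rewrite Hlam2. simpl. nra. }
  assert (Hsq : Cmod y ^ 2 <= B ^ 2) by (apply pow_incr; split; [apply Cmod_ge_0|assumption]).
  apply Rsqr_incr_0_var; [|lra]. rewrite !Rsqr_pow2.
  apply Rle_trans with (1 - 2 * mu); [|nra].
  rewrite Cmod2_alt. rewrite Cmod2_alt in Hsq.
  destruct y as [p q]. simpl Re in *. simpl Im in *.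
  replace ((1 + - (lam * p - 0 * q)) ^ 2 + (0 + - (lam * q + 0 * p)) ^ 2) with
    (1 - 2 * lam * p + lam * (lam * (p ^ 2 + q ^ 2))) by ring.
  assert (lam * (p ^ 2 + q ^ 2) <= delta) by (rewrite <- Hlam2; now apply Rmult_le_compat_l; [lra|]).
  assert (lam * (lam * (p ^ 2 + q ^ 2)) <= lam * delta) by (apply Rmult_le_compat_l; lra).
  assert (lam * delta <= lam * p) by (apply Rmult_le_compat_l; lra).
  lra.
Qed.

(** [1 / y] is [lam * sum_n (1 - lam y)^n] for small [lam > 0], because [Re y]
    is bounded below; replacing [y] by a truncation of its Fourier series, also
    at nearby complex points, makes the partial sums trigonometric polynomials
    with frequencies in the half plane and uniformly decaying coefficients. *)
Lemma lower_inverse (k delta : R) (c : Z -> Z -> C) : decay c -> 0 < delta ->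
  (forall j1 j2, 0 <= IZR j1 + IZR j2 * k -> c j1 j2 = RtoC 0) ->
  (forall a1 a2, delta <= 1 + Re (fourier_series c a1 a2)) ->
  exists d, decay d /\
    (forall j1 j2, 0 <= IZR j1 + IZR j2 * k -> d j1 j2 = delta0 j1 j2) /\
    (forall a1 a2, fourier_series d a1 a2 = (/ (1 + fourier_series c a1 a2))%C).
Proof.
  intros Hc Hdelta Hneg Hre.
  destruct (fs_bounded c Hc) as [B0 HB0].
  (* This bounds [Y] and is at least 1, so that [lam <= 1] and the mean [1 - lam] of the ratio lies
     in [[0, 1)]. *)
  set (B := 1 + Rabs B0).
  set (Y := fun a1 a2 => (1 + fourier_series c a1 a2)%C).
  assert (HB : forall a1 a2, Cmod (Y a1 a2) <= B).
  { intros a1 a2. eapply Rle_trans; [apply Cmod_triangle|]. rewrite Cmod_1.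
    specialize (HB0 a1 a2). pose proof (Rle_abs B0). unfold B. lra. }
  assert (HYre : forall a1 a2, delta <= Re (Y a1 a2)) by exact Hre.
  assert (HYmod : forall a1 a2, delta <= Cmod (Y a1 a2)).
  { intros a1 a2. specialize (HYre a1 a2). pose proof (re_le_Cmod (Y a1 a2)).
    pose proof (Rle_abs (Re (Y a1 a2))). lra. }
  assert (HY0 : forall a1 a2, Y a1 a2 <> RtoC 0).
  { intros a1 a2 E. specialize (HYmod a1 a2). rewrite E, Cmod_0 in HYmod. lra. }
  assert (HdB : delta <= B) by (eapply Rle_trans; [apply (HYmod 0 0)|apply HB]).
  assert (HB1 : 1 <= B) by (unfold B; pose proof (Rabs_pos B0); lra).
  assert (HB2 : 0 < B ^ 2) by (apply pow_lt; lra).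
  set (lam := delta / B ^ 2).
  assert (Hlam : 0 < lam) by now apply Rdiv_lt_0_compat.
  assert (Hlam1 : lam <= 1).
  { apply Rle_div_l; [assumption|]. simpl. nra. }
  set (mu := delta ^ 2 / (2 * B ^ 2)).
  assert (Hmu : 0 < mu) by (apply Rdiv_lt_0_compat; [apply pow_lt|]; lra).
  assert (HW : forall a1 a2, Cmod (1 - RtoC lam * Y a1 a2) <= 1 - mu)
    by (intros; now apply Cmod_damped).
  (* After multiplication by [lam], truncation and complex shift cost at most [mu / 2], half of the
     contraction gap; the ratio [r = 1 - mu / 2] is left. *)
  destruct (strip_sum_close c (mu / (2 * lam)) Hc) as [rho [N0 [Hrho HN0]]].
  { apply Rdiv_lt_0_compat; lra. }
  set (w := fun n a1 a2 b1 b2 => (1 - RtoC lam * (1 + strip_sum c n a1 a2 b1 b2))%C).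
  set (r := 1 - mu / 2).
  assert (Hr0 : 0 <= r).
  { pose proof (HW 0 0). pose proof (Cmod_ge_0 (1 - RtoC lam * Y 0 0)). unfold r. lra. }
  assert (Hr1 : r < 1) by (unfold r; lra).
  assert (Hw : forall n, (N0 <= n)%nat -> forall a1 a2 b1 b2,
    Rabs b1 <= rho -> Rabs b2 <= rho -> Cmod (w n a1 a2 b1 b2) <= r).
  { intros n Hn a1 a2 b1 b2 Hb1 Hb2.
    replace (w n a1 a2 b1 b2) with ((1 - RtoC lam * Y a1 a2)
      + - (RtoC lam * (strip_sum c n a1 a2 b1 b2 - fourier_series c a1 a2)))%C
      by (unfold w, Y; ring).
    eapply Rle_trans; [apply Cmod_triangle|].
    rewrite Cmod_opp, Cmod_mult, Cmod_R, (Rabs_right lam) by lra.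
    specialize (HN0 n Hn a1 a2 b1 b2 Hb1 Hb2). specialize (HW a1 a2).
    apply (Rmult_le_compat_l lam) in HN0; [|lra].
    replace (lam * (mu / (2 * lam))) with (mu / 2) in HN0 by (field; lra).
    unfold r. lra. }
  (* A single index [n] truncates both the Fourier series of [y] and the geometric series. *)
  set (T := fun n a1 a2 b1 b2 => (RtoC lam * cgeom (w n a1 a2 b1 b2) n)%C).
  set (M := lam * / (1 - r)).
  assert (HM : 0 <= M).
  { apply Rmult_le_pos; [lra|]. left. apply Rinv_0_lt_compat. lra. }
  assert (HT : forall n, (N0 <= n)%nat -> forall a1 a2 b1 b2,
    Rabs b1 <= rho -> Rabs b2 <= rho -> Cmod (T n a1 a2 b1 b2) <= M).
  { intros n Hn a1 a2 b1 b2 Hb1 Hb2. unfold T, M.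
    rewrite Cmod_mult, Cmod_R, (Rabs_right lam) by lra.
    apply Rmult_le_compat_l; [lra|]. apply Cmod_cgeom; [assumption|now apply Hw]. }
  (* The mean of [T n]. Since [y] has mean 1 and means are multiplicative, it equals
     [1 - (1 - lam) ^ S n], which tends to 1. *)
  set (t := fun n => (RtoC lam * cgeom (1 - RtoC lam) n)%C).
  assert (HTlower : forall n, lower_poly k (T n) (t n)).
  { intros n. apply lower_scal, lower_cgeom. unfold w.
    eapply lower_ext; [| |apply (lower_plus k (fun _ _ _ _ => (1 - RtoC lam)%C) _ _ _
      (lower_const k _) (lower_scal k (- RtoC lam) _ _ (lower_strip_sum k c n Hneg)))].
    - intros. cbv beta. ring.
    - ring. }
  assert (Hsmall : forall q eps, 0 <= q < 1 -> 0 < eps ->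
    exists n0, forall n, (n0 <= n)%nat -> q ^ S n <= eps).
  { intros q eps Hq Heps.
    assert (Hl : is_lim_seq (fun n => q ^ n) 0)
      by (apply is_lim_seq_geom; rewrite Rabs_right; lra).
    apply is_lim_seq_spec in Hl. destruct (Hl (mkposreal eps Heps)) as [n0 Hn0].
    exists n0. intros n Hn. specialize (Hn0 (S n) ltac:(lia)). simpl pos in Hn0.
    rewrite Rminus_0_r in Hn0. pose proof (Rle_abs (q ^ S n)). lra. }
  assert (HTlim : forall eps, 0 < eps -> exists n0, forall n, (n0 <= n)%nat ->
    forall a1 a2, Cmod (T n a1 a2 0 0 - / Y a1 a2) <= eps).
  { intros eps Heps.
    destruct (Hsmall r (eps * delta / 2) (conj Hr0 Hr1)) as [n1 Hn1]; [nra|].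
    destruct (fs_uniform c (eps * delta / 2 / (M + 1)) Hc) as [n2 Hn2].
    { apply Rdiv_lt_0_compat; nra. }
    exists (max N0 (max n1 n2)). intros n Hn a1 a2.
    specialize (Hn1 n ltac:(lia)). specialize (Hn2 n ltac:(lia) a1 a2).
    rewrite <- strip_sum_0 in Hn2.
    assert (H0 : Rabs 0 <= rho) by (rewrite Rabs_R0; lra).
    specialize (HT n ltac:(lia) a1 a2 0 0 H0 H0).
    specialize (Hw n ltac:(lia) a1 a2 0 0 H0 H0).
    pose proof (cgeomE (w n a1 a2 0 0) n) as E.
    set (z := (strip_sum c n a1 a2 0 0 - fourier_series c a1 a2)%C) in *.
    (* The error has two sources: the remainder [w ^ S n] of the geometric series and the truncation
       error [z] of [Y], weighted by the bounded factor [T n]. *)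
    assert (E1 : (T n a1 a2 0 0 - / Y a1 a2)%C =
      ((- w n a1 a2 0 0 ^ S n + - (T n a1 a2 0 0 * z)) / Y a1 a2)%C).
    { replace (- w n a1 a2 0 0 ^ S n)%C with
        ((1 - w n a1 a2 0 0) * cgeom (w n a1 a2 0 0) n - 1)%C by (rewrite E; ring).
      replace (1 - w n a1 a2 0 0)%C with (RtoC lam * (Y a1 a2 + z))%C
        by (unfold w, Y, z; ring).
      unfold T. field. apply HY0. }
    rewrite E1, Cmod_div by apply HY0.
    specialize (HYmod a1 a2). apply Rle_div_l; [lra|].
    apply Rle_trans with (eps * delta); [|apply Rmult_le_compat_l; lra].
    eapply Rle_trans; [apply Cmod_triangle|].
    rewrite !Cmod_opp, Cmod_mult, Cmod_pow.
    assert (Hp : Cmod (w n a1 a2 0 0) ^ S n <= eps * delta / 2).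
    { eapply Rle_trans; [|apply Hn1]. apply pow_incr. split; [apply Cmod_ge_0|assumption]. }
    assert (Hq : Cmod (T n a1 a2 0 0) * Cmod z <= eps * delta / 2).
    { apply Rle_trans with ((M + 1) * (eps * delta / 2 / (M + 1))).
      - apply Rmult_le_compat; [apply Cmod_ge_0|apply Cmod_ge_0|lra|lra].
      - right. field. lra. }
    lra. }
  assert (HGcont : ccont (fun a1 a2 => (/ Y a1 a2)%C)).
  { destruct (fs_lipschitz c Hc) as [L [HL HLip]].
    apply ccont_lipschitz with (L / (delta * delta)).
    { apply Rdiv_le_0_compat; nra. }
    intros a1 a2 b1 b2.
    replace (/ Y a1 a2 - / Y b1 b2)%C with
      ((fourier_series c b1 b2 - fourier_series c a1 a2) / (Y a1 a2 * Y b1 b2))%C.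
    2: { unfold Y. field. split; apply HY0. }
    rewrite Cmod_div, Cmod_mult by (apply Cmult_neq_0; apply HY0).
    pose proof (HYmod a1 a2). pose proof (HYmod b1 b2).
    assert (Hm : delta * delta <= Cmod (Y a1 a2) * Cmod (Y b1 b2))
      by (apply Rmult_le_compat; lra).
    apply Rle_div_l; [nra|].
    specialize (HLip b1 b2 a1 a2).
    rewrite (Rabs_minus_sym b1), (Rabs_minus_sym b2) in HLip.
    eapply Rle_trans; [exact HLip|].
    set (h := Rabs (a1 - b1) + Rabs (a2 - b2)).
    assert (Hh : 0 <= h) by
      (unfold h; pose proof (Rabs_pos (a1 - b1)); pose proof (Rabs_pos (a2 - b2)); lra).
    replace (L * h) with (L / (delta * delta) * h * (delta * delta)) by (field; lra).
    apply Rmult_le_compat_l; [|assumption].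
    apply Rmult_le_pos; [apply Rdiv_le_0_compat; nra|assumption]. }
  assert (Happ : forall eps, 0 < eps -> exists d,
    (forall j1 j2, Cmod (d j1 j2) <= 2 * M * exp (- rho * abs1 j1 j2)) /\
    (forall a1 a2, Cmod (fourier_series d a1 a2 - / Y a1 a2) <= eps) /\
    (forall j1 j2, 0 <= IZR j1 + IZR j2 * k ->
       Cmod (d j1 j2 - delta0 j1 j2) <= eps)).
  { intros eps Heps. destruct (HTlim eps Heps) as [n1 Hn1].
    destruct (Hsmall (1 - lam) eps) as [n2 Hn2]; [lra|assumption|].
    set (n := max N0 (max n1 n2)).
    destruct (lower_coef k (T n) (t n) rho M (HTlower n)) as [d [Hd1 [Hd2 Hd3]]];
      [|assumption|].
    { intros a1 a2 b1 b2 Hb1 Hb2. apply HT; [unfold n; lia|lra|lra]. }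
    exists d. split; [assumption|split].
    - intros a1 a2. rewrite Hd3. apply Hn1. unfold n; lia.
    - intros j1 j2 Hj. rewrite Hd1 by assumption.
      assert (Et : (t n - 1)%C = (- (1 - RtoC lam) ^ S n)%C).
      { pose proof (cgeomE (1 - RtoC lam) n) as E.
        unfold t. replace (RtoC lam) with (1 - (1 - RtoC lam))%C at 1 by ring.
        rewrite E. ring. }
      replace (t n * delta0 j1 j2 - delta0 j1 j2)%C with
        ((t n - 1) * delta0 j1 j2)%C by ring.
      rewrite Et, Cmod_mult, Cmod_opp, Cmod_pow, <- RtoC_minus, Cmod_R, Rabs_right by lra.
      specialize (Hn2 n ltac:(unfold n; lia)).
      assert (Hdl : Cmod (delta0 j1 j2) <= 1).
      { unfold delta0. destruct (Z.eq_dec j1 0), (Z.eq_dec j2 0);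
          rewrite ?Cmod_1, ?Cmod_0; lra. }
      pose proof (Cmod_ge_0 (delta0 j1 j2)).
      assert (0 <= (1 - lam) ^ S n) by (apply pow_le; lra). nra. }
  destruct (fs_limit (fun a1 a2 => (/ Y a1 a2)%C) (2 * M) rho Hrho HGcont)
    as [Hdec Hfs].
  { intros eps Heps. destruct (Happ eps Heps) as [d [Hd1 [Hd2 _]]]. now exists d. }
  exists (ccoef (fun a1 a2 => (/ Y a1 a2)%C)). split; [assumption|split; [|assumption]].
  intros j1 j2 Hj.
  set (G := fun a1 a2 => (/ Y a1 a2)%C) in *.
  assert (H0 : Cmod (ccoef G j1 j2 - delta0 j1 j2) = 0).
  { apply Rle_antisym; [|apply Cmod_ge_0]. apply le_epsilon. intros eps Heps.
    (* [ccoef_close] accounts for two thirds of [eps], the distance of [d] from [delta0] for the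
       last third. *)
    rewrite Rplus_0_l. destruct (Happ (eps / 3) ltac:(lra)) as [d [Hd1 [Hd2 Hd3]]].
    assert (Hd : decay d) by (exists (2 * M), rho; now split).
    specialize (Hd3 j1 j2 Hj).
    pose proof (ccoef_close G d (eps / 3) j1 j2 HGcont Hd Hd2).
    replace (ccoef G j1 j2 - delta0 j1 j2)%C with
      ((ccoef G j1 j2 - d j1 j2) + (d j1 j2 - delta0 j1 j2))%C by ring.
    eapply Rle_trans; [apply Cmod_triangle|]. lra. }
  apply Cmod_eq_0 in H0.
  replace (ccoef G j1 j2) with ((ccoef G j1 j2 - delta0 j1 j2) + delta0 j1 j2)%C by ring.
  rewrite H0. ring.
Qed.

Lemma decay_delta0 : decay delta0.
Proof.
  exists 1, 1. split; [lra|]. intros j1 j2. unfold delta0.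
  destruct (Z.eq_dec j1 0) as [->|]; [destruct (Z.eq_dec j2 0) as [->|]|];
    rewrite ?Cmod_1, ?Cmod_0; try (rewrite Rmult_1_l; left; apply exp_pos).
  unfold abs1. rewrite Rabs_R0, Rplus_0_l, Rmult_0_r, exp_0. lra.
Qed.

Lemma fs_delta0 (a1 a2 : R) : fourier_series delta0 a1 a2 = RtoC 1.
Proof.
  apply fs_eq. intros eps Heps. exists 0%nat. intros N _.
  replace (term delta0 a1 a2) with
    (fun j1 j2 => (delta0 (j1 - 0) (j2 - 0) * character j1 j2 a1 a2)%C)
    by (extensionality j1; extensionality j2; now rewrite !Z.sub_0_r).
  rewrite square_sum_delta by lia.
  rewrite characterE, !Rmult_0_l, Rplus_0_l, expi_0.
  replace (1 - 1)%C with (RtoC 0) by ring. now rewrite Cmod_0.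
Qed.

(** For such a series [f], the multiplier of [H] is [i] on [f] and [- i] on its conjugate, whose
    frequencies are positive. It therefore turns [(f - conj f) / (2 i)] into [(f + conj f) / 2]. *)
Lemma hilbert_lower (k : R) (d : Z -> Z -> C) : decay d ->
  (forall j1 j2, 0 <= IZR j1 + IZR j2 * k -> d j1 j2 = RtoC 0) ->
  (exists e, rep (fun a1 a2 => Im (fourier_series d a1 a2)) e) /\
  H k (fun a1 a2 => Im (fourier_series d a1 a2)) =
  (fun a1 a2 => Re (fourier_series d a1 a2)).
Proof.
  intros Hd Hneg.
  set (d' := fun j1 j2 => Cconj (d (- j1)%Z (- j2)%Z)).
  assert (Hd' : decay d') by now apply decay_conj_opp.
  set (u := fun j1 j2 => (/ (2 * Ci) * (d j1 j2 + (- (1)) * d' j1 j2))%C).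
  set (v := fun j1 j2 => (/ 2 * (d j1 j2 + d' j1 j2))%C).
  assert (Hi0 : Ci <> RtoC 0) by (intros E; injection E; lra).
  assert (Hu : rep (fun a1 a2 => Im (fourier_series d a1 a2)) u).
  { split.
    - apply decay_scal, decay_plus; [assumption|]. now apply decay_scal.
    - intros a1 a2. unfold u.
      rewrite fs_scal by (apply decay_plus; [|apply decay_scal]; assumption).
      rewrite (fs_plus d (fun j1 j2 => (- (1)) * d' j1 j2)%C)
        by (try apply decay_scal; assumption).
      rewrite fs_scal by assumption. unfold d'. rewrite <- fs_conj by assumption.
      rewrite im_alt. field. assumption. }
  assert (Hv : rep (fun a1 a2 => Re (fourier_series d a1 a2)) v).
  { split.
    - apply decay_scal. now apply decay_plus.
    - intros a1 a2. unfold v.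
      rewrite fs_scal by (apply decay_plus; assumption).
      rewrite fs_plus by assumption. unfold d'. rewrite <- fs_conj by assumption.
      rewrite re_alt. field. }
  split; [now exists u|].
  apply rep_eq with v; [|assumption].
  replace v with (hilbert_coef k u); [now apply rep_H|].
  extensionality j1; extensionality j2. unfold hilbert_coef, u, v, d'.
  set (m := IZR j1 + IZR j2 * k).
  assert (Hopp : IZR (- j1) + IZR (- j2) * k = - m) by (rewrite !opp_IZR; unfold m; ring).
  assert (Hc0 : Cconj (RtoC 0) = RtoC 0) by (apply injective_projections; simpl; ring).
  destruct (Rtotal_order m 0) as [Hm|[Hm|Hm]].
  - rewrite (Hneg (- j1)%Z (- j2)%Z), Hc0, sign_eq_m1 by (rewrite ?Hopp; lra).
    replace (RtoC (-1)) with (- (1))%C by (apply injective_projections; simpl; ring).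
    field. assumption.
  - rewrite (Hneg (- j1)%Z (- j2)%Z), (Hneg j1 j2) by (unfold m in *; rewrite ?Hopp; lra).
    rewrite Hc0. ring.
  - rewrite (Hneg j1 j2), sign_eq_1 by (unfold m in *; lra). field. assumption.
Qed.

(** * The traveling wave as a solution of the evolution equations *)

Lemma periodic2_mult (u : R -> R -> R) (n1 n2 : Z) (a1 a2 : R) : periodic2 u ->
  u (a1 + IZR n1 * (2 * PI)) (a2 + IZR n2 * (2 * PI)) = u a1 a2.
Proof.
  intros Hu.
  assert (Hnat : forall f : R -> R, (forall x, f (x + 2 * PI) = f x) ->
    forall (n : nat) x, f (x + INR n * (2 * PI)) = f x).
  { intros f Hf n. induction n as [|n IH]; intros x.
    - simpl INR. f_equal. ring.
    - rewrite S_INR, <- (IH x), <- (Hf (x + INR n * (2 * PI))). f_equal. ring. }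
  assert (HZ : forall f : R -> R, (forall x, f (x + 2 * PI) = f x) ->
    forall (n : Z) x, f (x + IZR n * (2 * PI)) = f x).
  { intros f Hf n x. destruct (Z.le_ge_cases 0 n) as [Hn|Hn].
    - rewrite <- (Z2Nat.id n Hn), <- INR_IZR_INZ. now apply Hnat.
    - rewrite <- (Hnat f Hf (Z.to_nat (- n)) (x + IZR n * (2 * PI))).
      rewrite INR_IZR_INZ, Z2Nat.id, opp_IZR by lia. f_equal. ring. }
  rewrite (HZ (fun x => u x (a2 + IZR n2 * (2 * PI)))) by (intros; apply Hu).
  apply (HZ (u a1)). intros; apply Hu.
Qed.

Lemma mod_2PI (x : R) : exists n : Z, 0 <= x + IZR n * (2 * PI) < 2 * PI.
Proof.
  pose proof two_PI_pos as HPI. destruct (base_Int_part (x / (2 * PI))) as [H1 H2].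
  exists (- Int_part (x / (2 * PI)))%Z. rewrite opp_IZR.
  set (n := IZR (Int_part _)) in *.
  assert (E : x = x / (2 * PI) * (2 * PI)) by (field; lra).
  set (q := x / (2 * PI)) in *. rewrite E. split; nra.
Qed.

Lemma rep_positive_bound (u : R -> R -> R) (c : Z -> Z -> C) : rep u c ->
  (forall a1 a2, 0 < 1 + u a1 a2) ->
  exists delta, 0 < delta /\ forall a1 a2, delta <= 1 + u a1 a2.
Proof.
  intros Hu Hpos. destruct (fs_lipschitz c (proj1 Hu)) as [L [HL HLip]].
  assert (Hlip : forall a1 a2 b1 b2,
    Rabs (u a1 a2 - u b1 b2) <= L * (Rabs (a1 - b1) + Rabs (a2 - b2))).
  { intros a1 a2 b1 b2. eapply Rle_trans; [|apply HLip].
    rewrite <- !(proj2 Hu), <- RtoC_minus, Cmod_R. apply Rle_refl. }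
  (* Within this radius of a point, the Lipschitz bound keeps [1 + u] above the radius itself. The
     uniform radius given by compactness is thus also the lower bound. *)
  assert (Hq : forall a1 a2, 0 < (1 + u a1 a2) / (4 * (L + 1)))
    by (intros; apply Rdiv_lt_0_compat; [apply Hpos|lra]).
  destruct (compactness_value_2d 0 (2 * PI) 0 (2 * PI)
    (fun a1 a2 => mkposreal _ (Hq a1 a2))) as [d Hd].
  exists d. split; [apply cond_pos|]. intros a1 a2.
  destruct (mod_2PI a1) as [n1 Hn1], (mod_2PI a2) as [n2 Hn2].
  rewrite <- (periodic2_mult u n1 n2) by now apply rep_periodic with c.
  set (x := a1 + IZR n1 * (2 * PI)) in *. set (y := a2 + IZR n2 * (2 * PI)) in *.
  apply Rnot_lt_le. intros Hlt. apply (Hd x y); [lra|lra|].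
  intros [v [w [_ [_ [H1 [H2 H3]]]]]]. simpl in H1, H2, H3.
  specialize (Hlip x y v w). apply Rabs_le_between in Hlip.
  set (e := (1 + u v w) / (4 * (L + 1))) in *.
  assert (E : 1 + u v w = 4 * (L + 1) * e) by (unfold e; field; lra).
  assert (He : 0 < e) by apply Hq.
  assert (L * (Rabs (x - v) + Rabs (y - w)) <= L * (2 * e))
    by (apply Rmult_le_compat_l; lra).
  assert (0 <= L * e) by nra. lra.
Qed.

(** Since [1 / y = (X - i D eta) / J], the series [1 / y - 1] has real part [X / J - 1] and
    imaginary part [- D eta / J], and [hilbert_lower] relates the two. The representation of the
    quotient is also exported, because scaling and translating under [H] require it. *)
Lemma hilbert_wave (k delta : R) (eta : R -> R -> R) (c : Z -> Z -> C) :
  rep eta c -> 0 < delta -> (forall a1 a2, delta <= X k eta a1 a2) ->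
  (exists e, rep (fun a1 a2 => D k eta a1 a2 / J k eta a1 a2) e) /\
  H k (fun a1 a2 => D k eta a1 a2 / J k eta a1 a2) =
  (fun a1 a2 => 1 - X k eta a1 a2 / J k eta a1 a2).
Proof.
  intros Heta Hdelta HX.
  set (dx := hilbert_coef k (deriv_coef 1 k c)).
  set (z := fun j1 j2 => (dx j1 j2 + Ci * deriv_coef 1 k c j1 j2)%C).
  pose proof (rep_D k eta c Heta) as HD.
  pose proof (rep_H k _ _ HD) as HHD. fold dx in HHD.
  assert (Hz : decay z).
  { apply decay_plus; [apply HHD|]. apply decay_scal, HD. }
  assert (Hzfs : forall a1 a2, (1 + fourier_series z a1 a2)%C =
    (X k eta a1 a2, D k eta a1 a2)).
  { intros a1 a2. unfold z.
    rewrite (fs_plus dx (fun j1 j2 => Ci * deriv_coef 1 k c j1 j2)%C), fs_scal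
      by (try apply decay_scal; (apply HHD || apply HD)).
    rewrite <- (proj2 HHD), <- (proj2 HD). unfold X.
    apply injective_projections; simpl; ring. }
  destruct (lower_inverse k delta z Hz Hdelta) as [d [Hd [Hd0 Hdfs]]].
  (* At frequency [m] the coefficient of [y - 1] is [(sign m * m - m)] times that of [eta], which
     vanishes for [m >= 0]. *)
  { intros j1 j2 Hj. unfold z, dx, hilbert_coef, deriv_coef.
    rewrite Rmult_1_r. set (m := IZR j1 + IZR j2 * k) in *.
    assert (Hs : sign m * m = m).
    { destruct Hj as [Hj|Hj]; [rewrite sign_eq_1 by assumption|rewrite <- Hj]; ring. }
    transitivity (RtoC (sign m * m - m) * c j1 j2)%C;
      [|rewrite Hs, Rminus_eq_0; ring].
    apply injective_projections; simpl; ring. }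
  { intros a1 a2. replace (1 + Re (fourier_series z a1 a2)) with
      (Re (1 + fourier_series z a1 a2)) by (simpl; ring).
    rewrite Hzfs. apply HX. }
  set (d1 := fun j1 j2 => (d j1 j2 + (- (1)) * delta0 j1 j2)%C).
  assert (Hd1 : decay d1) by (apply decay_plus; [|apply decay_scal, decay_delta0]; assumption).
  assert (Hd1fs : forall a1 a2, fourier_series d1 a1 a2 =
    (X k eta a1 a2 / J k eta a1 a2 - 1, - (D k eta a1 a2 / J k eta a1 a2))).
  { intros a1 a2. unfold d1.
    rewrite (fs_plus d (fun j1 j2 => (- (1)) * delta0 j1 j2)%C), fs_scal, fs_delta0, Hdfs, Hzfs
      by (try apply decay_scal; try apply decay_delta0; assumption).
    apply injective_projections; unfold J; simpl; unfold Rdiv; ring. }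
  destruct (hilbert_lower k d1 Hd1) as [[e He] HH].
  { intros j1 j2 Hj. unfold d1. rewrite Hd0 by assumption. ring. }
  assert (E : (fun a1 a2 => D k eta a1 a2 / J k eta a1 a2) =
    (fun a1 a2 => -1 * Im (fourier_series d1 a1 a2))).
  { extensionality a1; extensionality a2. rewrite Hd1fs. simpl. ring. }
  rewrite E. split; [eexists; now apply rep_scal; apply He|].
  rewrite (H_scal k (-1) _ e He), HH.
  extensionality a1; extensionality a2. rewrite Hd1fs. simpl. ring.
Qed.

Lemma D_scal (k r : R) (u : R -> R -> R) :
  D k (fun a1 a2 => r * u a1 a2) = (fun a1 a2 => r * D k u a1 a2).
Proof.
  extensionality a1; extensionality a2. unfold D, pd1, pd2.
  rewrite (Derive_scal (fun s => u s a2)), (Derive_scal (fun s => u a1 s)). ring.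
Qed.

Lemma D_plus_const (k r : R) (u : R -> R -> R) :
  D k (fun a1 a2 => u a1 a2 + r) = D k u.
Proof.
  assert (Hd : forall f x, Derive (fun y => f y + r) x = Derive f x).
  { intros f x. unfold Derive. do 2 f_equal. extensionality h. f_equal. ring. }
  extensionality a1; extensionality a2. unfold D, pd1, pd2.
  now rewrite (Hd (fun s => u s a2)), (Hd (u a1)).
Qed.

(** For [phi = r H eta], the potential [psi] contains [H] twice, so [D_H_H] applies and no transform
    survives. *)
Lemma D_psi (k r : R) (eta : R -> R -> R) (c : Z -> Z -> C) : rep eta c ->
  D k (psi k (fun a1 a2 => r * H k eta a1 a2)) = (fun a1 a2 => r * D k eta a1 a2).
Proof.
  intros Heta.
  replace (psi k (fun a1 a2 => r * H k eta a1 a2)) with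
    (fun a1 a2 => - r * H k (H k eta) a1 a2).
  - rewrite D_scal, (D_H_H k eta c) by assumption.
    extensionality a1; extensionality a2. ring.
  - extensionality a1; extensionality a2. unfold psi.
    rewrite (H_scal k r _ _ (rep_H k eta c Heta)). ring.
Qed.

(** * Inverting the profile along flow lines of [D] *)

Section LineMap.

Context (k : R) (u : R -> R -> R) (c : Z -> Z -> C) (Hu : rep u c) (delta : R)
  (Hdelta : 0 < delta) (HD : forall a1 a2, delta <= 1 + D k u a1 a2).

Lemma line_map_derive (x1 x2 a : R) :
  is_derive (fun s => s + u (x1 + s) (x2 + k * s)) a
    (1 + D k u (x1 + a) (x2 + k * a)).
Proof.
  apply (is_derive_plus (V := R_NormedModule)); [apply (is_derive_id (K := R_AbsRing))|].
  now apply rep_is_derive_line with c.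
Qed.

Lemma line_map_MVT (x1 x2 a b : R) : exists y, Rmin a b <= y <= Rmax a b /\
  (b + u (x1 + b) (x2 + k * b)) - (a + u (x1 + a) (x2 + k * a)) =
  (1 + D k u (x1 + y) (x2 + k * y)) * (b - a).
Proof.
  apply (MVT_gen (fun s => s + u (x1 + s) (x2 + k * s)) a b
    (fun s => 1 + D k u (x1 + s) (x2 + k * s))).
  - intros s _. apply line_map_derive.
  - intros s _. apply derivable_continuous_pt. eexists.
    apply is_derive_Reals, line_map_derive.
Qed.

Lemma line_map_inj (x1 x2 a b : R) :
  a + u (x1 + a) (x2 + k * a) = b + u (x1 + b) (x2 + k * b) -> a = b.
Proof.
  intros E. destruct (line_map_MVT x1 x2 a b) as [y [_ Hy]].
  rewrite E, Rminus_eq_0 in Hy. specialize (HD (x1 + y) (x2 + k * y)).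
  symmetry in Hy. apply Rmult_integral in Hy. lra.
Qed.

(** The bounded perturbation forces a sign change on [[- B, B]]. The conclusion is a sigma type so
    that [A0] can be defined as its projection. *)
Lemma line_map_zero (B x1 x2 : R) : (forall a1 a2, Rabs (u a1 a2) <= B) ->
  {a : R | a + u (x1 + a) (x2 + k * a) = 0}.
Proof.
  intros HB.
  destruct (IVT_gen (fun s => s + u (x1 + s) (x2 + k * s)) (- B) B 0) as [a [_ Ha]].
  - intros s. apply derivable_continuous_pt. eexists.
    apply is_derive_Reals, line_map_derive.
  - pose proof (HB (x1 + - B) (x2 + k * - B)) as H1. apply Rabs_le_between in H1.
    pose proof (HB (x1 + B) (x2 + k * B)) as H2. apply Rabs_le_between in H2.
    split; [eapply Rle_trans; [apply Rmin_l|]|eapply Rle_trans; [|apply Rmax_r]]; lra.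
  - now exists a.
Qed.

(** No continuity of [beta] is assumed. The mean value theorem gives [v h = p (b' - b)] with
    [p >= delta], hence a Lipschitz bound for [beta]; replacing [p] by the slope [q] at the base
    point costs another factor [|b' - b|], so the remainder is quadratic in [h]. *)
Lemma inverse_line_map_derive (v : R) (beta : R -> R) (t : R) :
  (forall s, v * s - beta s + u (- beta s) (- (k * beta s)) = 0) ->
  is_derive beta t (v / (1 + D k u (- beta t) (- (k * beta t)))).
Proof.
  intros Hbeta.
  destruct (fs_lipschitz _ (proj1 (rep_D k u c Hu))) as [L [HL HLip]].
  assert (Hlip : forall a1 a2 b1 b2, Rabs (D k u a1 a2 - D k u b1 b2)
    <= L * (Rabs (a1 - b1) + Rabs (a2 - b2))).
  { intros a1 a2 b1 b2. eapply Rle_trans; [|apply HLip].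
    rewrite <- !(proj2 (rep_D k u c Hu)), <- RtoC_minus, Cmod_R. apply Rle_refl. }
  set (L' := L * (1 + Rabs k)).
  assert (HL' : 0 <= L') by (pose proof (Rabs_pos k); unfold L'; nra).
  set (b := beta t). set (q := 1 + D k u (- b) (- (k * b))).
  assert (Hq : delta <= q) by apply HD.
  assert (Hd3 : 0 < delta ^ 3) by now apply pow_lt.
  (* Two factors [1 / delta] come from [|b' - b| <= |v h| / delta], the third from the division by
     [q]; [L'] is a Lipschitz constant of [D u] in the direction [(1, k)]. *)
  apply is_derive_quadratic with (L' * v ^ 2 / delta ^ 3).
  { apply Rdiv_le_0_compat; [|assumption].
    apply Rmult_le_pos; [assumption|apply pow2_ge_0]. }
  intros h. fold b. set (b' := beta (t + h)).
  destruct (line_map_MVT 0 0 (- b) (- b')) as [y [Hy1 Hy2]].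
  rewrite !Rplus_0_l, <- !Ropp_mult_distr_r in Hy2.
  set (p := 1 + D k u y (k * y)) in Hy2.
  assert (Hp : delta <= p) by apply HD.
  assert (E : v * h = p * (b' - b)).
  { pose proof (Hbeta t) as E1. pose proof (Hbeta (t + h)) as E2.
    fold b in E1. fold b' in E2. lra. }
  assert (Hyb : Rabs (- b - y) <= Rabs (b' - b)).
  { rewrite (Rabs_minus_sym b'). unfold Rmin, Rmax in Hy1.
    destruct (Rle_dec (- b) (- b')); unfold Rabs;
      destruct (Rcase_abs (- b - y)), (Rcase_abs (b - b')); lra. }
  assert (Hpq : Rabs (q - p) <= L' * Rabs (b' - b)).
  { unfold p, q. replace (1 + D k u (- b) (- (k * b)) - (1 + D k u y (k * y))) with
      (D k u (- b) (- (k * b)) - D k u y (k * y)) by ring.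
    eapply Rle_trans; [apply Hlip|].
    replace (- (k * b) - k * y) with (k * (- b - y)) by ring.
    rewrite Rabs_mult. unfold L'.
    replace (L * (Rabs (- b - y) + Rabs k * Rabs (- b - y))) with
      (L * (1 + Rabs k) * Rabs (- b - y)) by ring.
    apply Rmult_le_compat_l; assumption. }
  assert (Hbd : delta * Rabs (b' - b) <= Rabs (v * h)).
  { rewrite E, Rabs_mult, (Rabs_right p) by lra.
    apply Rmult_le_compat_r; [apply Rabs_pos|assumption]. }
  replace (b' - b - h * (v / q)) with ((b' - b) * (q - p) / q).
  2: { replace (h * (v / q)) with (v * h / q) by (field; lra). rewrite E. field. lra. }
  rewrite Rabs_div, Rabs_mult, (Rabs_right q) by lra.
  rewrite Rabs_mult in Hbd.
  set (x := Rabs (b' - b)) in *. assert (Hx : 0 <= x) by apply Rabs_pos.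
  apply Rle_trans with (L' * x ^ 2 / delta).
  - apply Rle_trans with (L' * x ^ 2 / q).
    + unfold Rdiv. apply Rmult_le_compat_r; [left; apply Rinv_0_lt_compat; lra|].
      replace (L' * x ^ 2) with (x * (L' * x)) by ring. now apply Rmult_le_compat_l.
    + unfold Rdiv. apply Rmult_le_compat_l.
      * apply Rmult_le_pos; [assumption|apply pow2_ge_0].
      * apply Rinv_le_contravar; assumption.
  - replace (L' * v ^ 2 / delta ^ 3 * Rabs h ^ 2) with
      (L' * ((Rabs v * Rabs h) ^ 2 / delta ^ 2) / delta).
    2: { rewrite Rpow_mult_distr, pow2_abs. field. lra. }
    unfold Rdiv at 1 3. apply Rmult_le_compat_r; [left; now apply Rinv_0_lt_compat|].
    apply Rmult_le_compat_l; [assumption|].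
    apply (proj1 (Rle_div_r (x ^ 2) ((Rabs v * Rabs h) ^ 2) (delta ^ 2)
      (pow_lt delta 2 Hdelta))).
    rewrite <- Rpow_mult_distr. apply pow_incr. split; [nra|]. lra.
Qed.

End LineMap.

(** * Translation invariance of the wave quantities *)

Lemma X_shift (k s1 s2 : R) (eta : R -> R -> R) (c : Z -> Z -> C) : rep eta c ->
  X k (fun a1 a2 => eta (a1 - s1) (a2 - s2)) =
  (fun a1 a2 => X k eta (a1 - s1) (a2 - s2)).
Proof.
  intros Heta. unfold X. rewrite D_shift.
  now rewrite (H_shift k s1 s2 _ _ (rep_D k eta c Heta)).
Qed.

Lemma J_shift (k s1 s2 : R) (eta : R -> R -> R) (c : Z -> Z -> C) : rep eta c ->
  J k (fun a1 a2 => eta (a1 - s1) (a2 - s2)) =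
  (fun a1 a2 => J k eta (a1 - s1) (a2 - s2)).
Proof. intros Heta. unfold J. now rewrite (X_shift k s1 s2 eta c), D_shift. Qed.

Lemma kappa_shift (k s1 s2 : R) (eta : R -> R -> R) (c : Z -> Z -> C) : rep eta c ->
  kappa k (fun a1 a2 => eta (a1 - s1) (a2 - s2)) =
  (fun a1 a2 => kappa k eta (a1 - s1) (a2 - s2)).
Proof.
  intros Heta. unfold kappa.
  now rewrite (X_shift k s1 s2 eta c), (J_shift k s1 s2 eta c), !D_shift.
Qed.

(** * From the hypotheses on the initial data to the torus *)

Lemma decay_of_max (c : Z -> Z -> C) (k K eps : R) : 0 < eps ->
  (forall j1 j2 : Z, Cmod (c j1 j2)
     <= K * exp (- 3 * eps * Rmax k 1 * Rmax (Rabs (IZR j1)) (Rabs (IZR j2)))) ->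
  decay c.
Proof.
  (* The maximum norm is at least half the [l^1] length and [Rmax k 1 >= 1], so the exponent [3 eps]
     leaves at least the rate [eps]. *)
  intros Heps Hc. exists K, eps. split; [assumption|]. intros j1 j2.
  assert (HK : 0 <= K).
  { specialize (Hc 0%Z 0%Z). pose proof (Cmod_ge_0 (c 0%Z 0%Z)).
    pose proof (exp_pos (- 3 * eps * Rmax k 1 * Rmax (Rabs 0) (Rabs 0))). nra. }
  eapply Rle_trans; [apply Hc|]. apply Rmult_le_compat_l; [assumption|].
  apply exp_le. unfold abs1.
  set (x := Rabs (IZR j1)). set (y := Rabs (IZR j2)).
  assert (Hx : 0 <= x) by apply Rabs_pos.
  pose proof (Rmax_l x y). pose proof (Rmax_r x y). pose proof (Rmax_r k 1).
  set (m := Rmax x y) in *. set (M := Rmax k 1) in *.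
  assert (0 <= eps * m) by nra.
  assert (eps * m * 1 <= eps * m * M) by (apply Rmult_le_compat_l; assumption).
  assert (eps * (x + y) <= eps * (2 * m)) by (apply Rmult_le_compat_l; lra).
  lra.
Qed.

(** Every torus point lies on one of the lines: reduce [a1] modulo the period, then take [theta] to
    be [a2 - k a] reduced as well. The slope along that line is [1 + D xi0] at the point. *)
Lemma X_positive (k : R) (eta : R -> R -> R) (c : Z -> Z -> C) : rep eta c ->
  (forall a theta, 0 <= a < 2 * PI -> 0 <= theta < 2 * PI ->
     0 < Derive (xi0_line k eta theta) a) ->
  forall a1 a2, 0 < 1 + D k (H k eta) a1 a2.
Proof.
  intros Heta Hgraph a1 a2.
  pose proof (rep_D k _ _ (rep_H k eta c Heta)) as HD.
  destruct (mod_2PI a1) as [n1 Hn1].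
  destruct (mod_2PI (a2 - k * (a1 + IZR n1 * (2 * PI)))) as [n2 Hn2].
  specialize (Hgraph _ _ Hn1 Hn2). unfold xi0_line in Hgraph.
  set (a := a1 + IZR n1 * (2 * PI)) in *.
  set (theta := a2 - k * a + IZR n2 * (2 * PI)) in *.
  rewrite (is_derive_unique _ _ (1 + D k (H k eta) a (theta + k * a))) in Hgraph.
  - replace (theta + k * a) with (a2 + IZR n2 * (2 * PI)) in Hgraph
      by (unfold theta; ring).
    unfold a in Hgraph. rewrite periodic2_mult in Hgraph; [assumption|].
    now apply rep_periodic with (1 := HD).
  - pose proof (line_map_derive k (H k eta) _ (rep_H k eta c Heta) 0 theta a) as Hd.
    rewrite Rplus_0_l in Hd. apply is_derive_ext with (2 := Hd).
    intros s. now rewrite Rplus_0_l.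
Qed.

(** * Algebraic verification for the translated wave *)

Section Wave.

(** [beta] stands for [alpha0], and [Hbeta] is the normalization [xi (0, 0, t) = 0] of the
    translated wave. *)
Context (k c g tau : R) (eta0 : R -> R -> R) (etahat : Z -> Z -> C)
  (Heta : rep eta0 etahat) (delta : R) (Hdelta : 0 < delta)
  (Hpos : forall a1 a2, delta <= 1 + D k (H k eta0) a1 a2)
  (Htravel : traveling_wave k c g tau eta0) (beta : R -> R)
  (Hbeta : forall t,
     c * t - beta t + H k eta0 (- beta t) (- (k * beta t)) = 0).

Let zeta (t a1 a2 : R) : C :=
  (zeta0_torus k eta0 (a1 - beta t) (a2 - k * beta t) + RtoC (c * t - beta t))%C.

Let phi (t a1 a2 : R) : R := phi0_torus k c eta0 (a1 - beta t) (a2 - k * beta t).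

Lemma X_wave : X k eta0 = (fun a1 a2 => 1 + D k (H k eta0) a1 a2).
Proof. unfold X. now rewrite (H_D k eta0 etahat). Qed.

Lemma J_wave_pos (a1 a2 : R) : 0 < J k eta0 a1 a2.
Proof.
  unfold J. rewrite X_wave. specialize (Hpos a1 a2).
  pose proof (pow2_ge_0 (D k eta0 a1 a2)) as Hsq.
  assert (Hsq' : 0 < (1 + D k (H k eta0) a1 a2) ^ 2) by (apply pow_lt; lra). lra.
Qed.

Lemma eta_of_wave (t : R) :
  eta_of zeta t = (fun a1 a2 => eta0 (a1 - beta t) (a2 - k * beta t)).
Proof.
  extensionality a1; extensionality a2. unfold eta_of, zeta, zeta0_torus. simpl. ring.
Qed.

Lemma xi_of_wave (t : R) : xi_of zeta t =
  (fun a1 a2 => H k eta0 (a1 - beta t) (a2 - k * beta t) + (c * t - beta t)).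
Proof.
  extensionality a1; extensionality a2. unfold xi_of, zeta, zeta0_torus. now simpl.
Qed.

Lemma D_psi_wave (t : R) : D k (psi k (phi t)) =
  (fun a1 a2 => c * D k eta0 (a1 - beta t) (a2 - k * beta t)).
Proof.
  assert (E : phi t = (fun a1 a2 =>
    c * H k (fun b1 b2 => eta0 (b1 - beta t) (b2 - k * beta t)) a1 a2)).
  { now rewrite (H_shift k (beta t) (k * beta t) eta0 etahat). }
  rewrite E, (D_psi k c _ _ (rep_shift (beta t) (k * beta t) _ _ Heta)).
  now rewrite (D_shift k (beta t) (k * beta t) eta0).
Qed.

Lemma chi_wave (t : R) : chi k (eta_of zeta t) (phi t) =
  (fun a1 a2 => c * (D k eta0 (a1 - beta t) (a2 - k * beta t)
                     / J k eta0 (a1 - beta t) (a2 - k * beta t))).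
Proof.
  unfold chi. rewrite D_psi_wave, eta_of_wave, (J_shift k (beta t) (k * beta t) eta0 etahat) by assumption.
  extensionality a1; extensionality a2. unfold Rdiv. ring.
Qed.

Lemma H_chi_wave (t : R) : H k (chi k (eta_of zeta t) (phi t)) =
  (fun a1 a2 => c * (1 - X k eta0 (a1 - beta t) (a2 - k * beta t)
                         / J k eta0 (a1 - beta t) (a2 - k * beta t))).
Proof.
  destruct (hilbert_wave k delta eta0 etahat Heta Hdelta) as [[e He] HH].
  { rewrite X_wave. exact Hpos. }
  rewrite chi_wave.
  rewrite (H_scal k c _ _ (rep_shift (beta t) (k * beta t) _ _ He)).
  now rewrite (H_shift k (beta t) (k * beta t) _ _ He), HH.
Qed.

(** With [H chi = c (1 - X / J)], the two fractions in [C1_choice] combine to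
    [c (X ^ 2 + (D eta) ^ 2) / (X J) = c / X]. *)
Lemma C1_wave (t : R) : C1_choice k zeta phi t =
  c - c / (1 + D k (H k eta0) (- beta t) (- (k * beta t))).
Proof.
  unfold C1_choice.
  change (fun a1 a2 => D k (psi k (phi t)) a1 a2 / J k (eta_of zeta t) a1 a2)
    with (chi k (eta_of zeta t) (phi t)).
  rewrite H_chi_wave, D_psi_wave, eta_of_wave, (J_shift k (beta t) (k * beta t) eta0 etahat) by assumption.
  rewrite (D_shift k (beta t) (k * beta t) eta0), xi_of_wave, (D_plus_const k (c * t - beta t)
    (fun a1 a2 => H k eta0 (a1 - beta t) (a2 - k * beta t))),
    (D_shift k (beta t) (k * beta t) (H k eta0)).
  rewrite !Rminus_0_l. set (b1 := - beta t). set (b2 := - (k * beta t)).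
  pose proof (J_wave_pos b1 b2) as HJ. specialize (Hpos b1 b2).
  unfold J in *. rewrite X_wave in *.
  field. split; lra.
Qed.

Lemma beta_derive (t : R) : is_derive beta t (c - C1_choice k zeta phi t).
Proof.
  rewrite C1_wave.
  replace (c - (c - _)) with (c / (1 + D k (H k eta0) (- beta t) (- (k * beta t))))
    by ring.
  exact (inverse_line_map_derive k (H k eta0) _ (rep_H k _ _ Heta) delta Hdelta Hpos
    c beta t Hbeta).
Qed.

(** All profiles are carried along [(1, k)] with speed [beta' = c - C1], so a time derivative is
    [(C1 - c) D]. Each evolution equation thereby loses its time derivative. *)
Lemma shift_derive (u : R -> R -> R) (d : Z -> Z -> C) (a1 a2 t : R) : rep u d ->
  is_derive (fun s => u (a1 - beta s) (a2 - k * beta s)) t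
    ((C1_choice k zeta phi t - c) * D k u (a1 - beta t) (a2 - k * beta t)).
Proof.
  intros Hu.
  pose proof (is_derive_comp (fun s => u (a1 + s) (a2 + k * s)) (fun s => - beta s) t
    _ _ (rep_is_derive_line k u d a1 a2 (- beta t) Hu)
    (is_derive_opp _ _ _ (beta_derive t))) as Hd.
  evar_last.
  - apply is_derive_ext with (2 := Hd). intros s. cbv beta. f_equal; ring.
  - unfold scal, opp; simpl; unfold mult; simpl.
    replace (a2 + k * - beta t) with (a2 - k * beta t) by ring.
    change (a1 + - beta t) with (a1 - beta t). ring.
Qed.

Lemma wave_solution : water_wave_solution k g tau (C1_choice k zeta phi) zeta phi.
Proof.
  pose proof (rep_H k eta0 etahat Heta) as Hxi.
  unfold water_wave_solution. cbv zeta. split; [|split].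
  - intros t. rewrite eta_of_wave.
    pose proof (rep_shift (beta t) (k * beta t) _ _ Heta) as H1.
    pose proof (rep_shift (beta t) (k * beta t) _ _ (rep_scal c _ _ Hxi)) as H2.
    split; [exact (rep_periodic _ _ H1)|split; [exact (rep_smooth _ _ H1)|]].
    split; [exact (rep_periodic _ _ H2)|exact (rep_smooth _ _ H2)].
  - intros t a1 a2. rewrite eta_of_wave, (J_shift k (beta t) (k * beta t) eta0 etahat) by assumption.
    apply J_wave_pos.
  - exists (fun t => c * t - beta t). split; [|split; [|split]].
    + intros t a1 a2. rewrite eta_of_wave, (H_shift k (beta t) (k * beta t) eta0 etahat), xi_of_wave
        by assumption. ring.
    + intros t.
      rewrite H_chi_wave, chi_wave, eta_of_wave, (X_shift k (beta t) (k * beta t) eta0 etahat),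
        (D_shift k (beta t) (k * beta t) eta0) by assumption.
      set (C1 := C1_choice k zeta phi t).
      replace (P0 _) with C1.
      * evar_last.
        -- apply (is_derive_minus (V := R_NormedModule) (fun s => c * s));
             [|apply beta_derive].
           auto_derive; [easy|reflexivity].
        -- fold C1. unfold minus, plus, opp; simpl. ring.
      (* The terms in [1 / J] combine to [c (X ^ 2 + (D eta) ^ 2) / J = c], leaving
         [c + (C1 - c) X]; writing [X = 1 + D xi0] isolates the mean [C1]. *)
      * transitivity (P0 (fun a1 a2 =>
          C1 + (C1 - c) * D k (H k eta0) (a1 - beta t) (a2 - k * beta t))).
        { symmetry. exact (P0_affine_D k C1 (C1 - c) _ _ _ _ Hxi). }
        f_equal. extensionality a1; extensionality a2.
        pose proof (J_wave_pos (a1 - beta t) (a2 - k * beta t)) as HJ.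
        unfold J in *. rewrite X_wave in *. field. lra.
    + intros t a1 a2.
      rewrite H_chi_wave, chi_wave, eta_of_wave, (X_shift k (beta t) (k * beta t) eta0 etahat),
        (D_shift k (beta t) (k * beta t) eta0) by assumption.
      set (C1 := C1_choice k zeta phi t).
      evar_last.
      * apply is_derive_ext with (2 := shift_derive eta0 etahat a1 a2 t Heta).
        intros s. now rewrite eta_of_wave.
      (* The two terms in [X D eta / J] cancel, and [(C1 - c) D eta] remains. *)
      * fold C1. pose proof (J_wave_pos (a1 - beta t) (a2 - k * beta t)) as HJ.
        field. lra.
    + intros t a1 a2.
      rewrite H_chi_wave, D_psi_wave, eta_of_wave, (J_shift k (beta t) (k * beta t) eta0 etahat),
        (kappa_shift k (beta t) (k * beta t) eta0 etahat) by assumption.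
      assert (ED : D k (phi t) =
        (fun a1 a2 => c * D k (H k eta0) (a1 - beta t) (a2 - k * beta t))).
      { unfold phi, phi0_torus. rewrite (D_shift k (beta t) (k * beta t)
          (fun a1 a2 => c * H k eta0 a1 a2)), D_scal. reflexivity. }
      rewrite ED.
      set (C1 := C1_choice k zeta phi t).
      (* [M] is the Bernoulli constant: the traveling wave equation says that this expression equals
         its mean everywhere. *)
      set (M := P0 (fun b1 b2 => c ^ 2 / (2 * J k eta0 b1 b2) + g * eta0 b1 b2
                                 - tau * kappa k eta0 b1 b2)).
      assert (HM : forall b1 b2, c ^ 2 / (2 * J k eta0 b1 b2) + g * eta0 b1 b2
                                 - tau * kappa k eta0 b1 b2 = M).
      { intros b1 b2. pose proof (Htravel b1 b2) as E. unfold P in E. fold M in E. lra. }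
      (* Substituting [D phi = c (X - 1)] and [D psi = c D eta], all terms in [X / J] cancel and [c
         ^ 2 / 2 - c ^ 2 / (2 J) + c (C1 - c) (X - 1)] is left. The gravity and capillary terms then
         complete the Bernoulli expression, leaving a constant that [P] removes. *)
      replace (fun b1 b2 => (_ + tau * _)) with (fun b1 b2 =>
        (c ^ 2 / 2 - M) + c * (C1 - c) * D k (H k eta0) (b1 - beta t) (b2 - k * beta t)).
      * unfold P.
        rewrite (P0_affine_D k (c ^ 2 / 2 - M) (c * (C1 - c)) (beta t) (k * beta t)
          (H k eta0) _ Hxi).
        evar_last.
        -- exact (shift_derive _ _ a1 a2 t (rep_scal c _ _ Hxi)).
        -- rewrite D_scal. fold C1. ring.
      * extensionality b1; extensionality b2.
        specialize (HM (b1 - beta t) (b2 - k * beta t)).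
        set (x1 := b1 - beta t) in *. set (x2 := b2 - k * beta t) in *.
        rewrite <- HM.
        pose proof (J_wave_pos x1 x2) as HJ.
        generalize (kappa k eta0 x1 x2). intros kap.
        unfold J in *. rewrite X_wave in *. field. lra.
Qed.

End Wave.

Theorem corollaryA5
  (k c g tau : R) (hk : 0 < k) (hkirr : irrational k)
  (etahat : Z -> Z -> C) (eta0 : R -> R -> R)
  (heta0 : forall a1 a2, RtoC (eta0 a1 a2) = fourier_series etahat a1 a2)
  (heven : forall a1 a2, eta0 (- a1) (- a2) = eta0 a1 a2)
  (hconj : forall j1 j2 : Z, etahat (- j1)%Z (- j2)%Z = Cconj (etahat j1 j2))
  (K eps : R) (heps : 0 < eps)
  (hdecay : forall j1 j2 : Z,
     Cmod (etahat j1 j2)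
     <= K * exp (- 3 * eps * Rmax k 1 * Rmax (Rabs (IZR j1)) (Rabs (IZR j2))))
  (hinj : forall theta, 0 <= theta < 2 * PI ->
     forall a b, zeta0_line k eta0 theta a = zeta0_line k eta0 theta b -> a = b)
  (hregular : forall theta, 0 <= theta < 2 * PI ->
     forall a, dzeta0_line k eta0 theta a <> RtoC 0)
  (htravel : traveling_wave k c g tau eta0)
  (hgraph : forall a theta, 0 <= a < 2 * PI -> 0 <= theta < 2 * PI ->
     0 < Derive (xi0_line k eta0 theta) a) :
  exists A0 : R -> R -> R,
    periodic2 A0 /\
    (forall x1 x2 a : R,
       a + H k eta0 (x1 + a) (x2 + k * a) = 0 <-> a = A0 x1 x2) /\
    let alpha0 := fun t : R => c * t - A0 (- (c * t)) (- (k * c * t)) in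
    let zeta := fun t a1 a2 : R =>
      (zeta0_torus k eta0 (a1 - alpha0 t) (a2 - k * alpha0 t)
       + RtoC (c * t - alpha0 t))%C in
    let phi := fun t a1 a2 : R =>
      phi0_torus k c eta0 (a1 - alpha0 t) (a2 - k * alpha0 t) in
    water_wave_solution k g tau (C1_choice k zeta phi) zeta phi /\
    (forall a1 a2, zeta 0 a1 a2 = zeta0_torus k eta0 a1 a2) /\
    (forall a1 a2, phi 0 a1 a2 = phi0_torus k c eta0 a1 a2) /\
    (forall t, xi_of zeta t 0 0 = 0).
Proof.
  assert (Heta : rep eta0 etahat) by (split; [now apply decay_of_max with k K eps|exact heta0]).
  pose proof (rep_H k _ _ Heta) as Hxi.
  destruct (rep_positive_bound _ _ (rep_D k _ _ Hxi) (X_positive k eta0 etahat Heta hgraph))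
    as [delta [Hdelta Hpos]].
  destruct (fs_bounded _ (proj1 Hxi)) as [B HB].
  assert (HB' : forall a1 a2, Rabs (H k eta0 a1 a2) <= B).
  { intros a1 a2. rewrite <- Cmod_R, (proj2 Hxi). apply HB. }
  set (A0 := fun x1 x2 => proj1_sig (line_map_zero k _ _ Hxi B x1 x2 HB')).
  assert (HA0 : forall x1 x2,
    A0 x1 x2 + H k eta0 (x1 + A0 x1 x2) (x2 + k * A0 x1 x2) = 0)
    by (intros; apply (proj2_sig (line_map_zero k _ _ Hxi B x1 x2 HB'))).
  assert (HA0' : forall x1 x2 a,
    a + H k eta0 (x1 + a) (x2 + k * a) = 0 <-> a = A0 x1 x2).
  { intros x1 x2 a. split; [|intros ->; apply HA0]. intros E.
    apply (line_map_inj k _ _ Hxi delta Hdelta Hpos x1 x2). now rewrite E, HA0. }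
  clearbody A0. exists A0. split; [|split; [exact HA0'|]].
  - intros x1 x2. pose proof (rep_periodic _ _ Hxi) as Hper.
    (* Periodicity follows from uniqueness: the root for [(x1, x2)] also solves the equation with
       either variable shifted by a period. *)
    split; symmetry; apply HA0'; rewrite <- (HA0 x1 x2); f_equal.
    + rewrite <- (proj1 (Hper (x1 + A0 x1 x2) (x2 + k * A0 x1 x2))). f_equal. ring.
    + rewrite <- (proj2 (Hper (x1 + A0 x1 x2) (x2 + k * A0 x1 x2))). f_equal. ring.
  - intros alpha0 zeta phi.
    assert (Halpha0 : forall t,
      c * t - alpha0 t + H k eta0 (- alpha0 t) (- (k * alpha0 t)) = 0).
    (* The equation of [A0] at [(- c t, - k c t)]: there [x1 + A0 = - alpha0] and
       [x2 + k A0 = - k alpha0]. *)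
    { intros t. rewrite <- (HA0 (- (c * t)) (- (k * c * t))). unfold alpha0.
      f_equal; [ring|]. f_equal; ring. }
    (* Evenness of [eta0] makes [xi0] odd, so 0 is the root at the origin. *)
    assert (E0 : alpha0 0 = 0).
    { assert (E : 0 = A0 0 0).
      { apply HA0'. rewrite Rmult_0_r, !Rplus_0_l.
        pose proof (H_even k eta0 etahat 0 0 Heta heven) as E.
        rewrite Ropp_0 in E. lra. }
      unfold alpha0. rewrite !Rmult_0_r, Ropp_0, <- E. ring. }
    split; [|split; [|split]].
    + exact (wave_solution k c g tau eta0 etahat Heta delta Hdelta Hpos htravel
        alpha0 Halpha0).
    + intros a1 a2. unfold zeta. rewrite E0, !Rmult_0_r, !Rminus_0_r. ring.
    + intros a1 a2. unfold phi. now rewrite E0, !Rmult_0_r, !Rminus_0_r.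
    + intros t. etransitivity; [|exact (Halpha0 t)].
      unfold xi_of, zeta, zeta0_torus. simpl. rewrite !Rminus_0_l. ring.
Qed.
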